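(* Let $\mathfrak{o}$ be a compact discrete valuation ring with residue field of cardinality $q$. Setting $x=q^{-s_1}$, $y=q^{-s_2}$, $z=q^{-s_3}$, the cotype zeta function of subalgebras of $\mathfrak{o}^4$ containing the identity is $$F(x,y,z)=\frac{N(x,y,z)}{(1-x)(1-xy)(1-xyz)(1-qx^2y)(1-q^2x^2yz)(1-q^2x^2y^2z)(1-q^3x^3y^2z)},$$ where $N(x,y,z)=A_0(x,y)+A_1(x,y)z+A_2(x,y)z^2+A_3(x,y)z^3$ and $$\begin{aligned} A_0(x,y)=\;&1+5x+6xy+(3q-2)x^2y+(3q-4)x^3y-6qx^3y^2-6qx^4y^2,\\ A_1(x,y)=\;&(q-5)x^2y+(q-6)x^2y^2-(q+1)x^3y+(1-5q-5q^2)x^3y^2-(q+1)x^3y^3\\ &+(5-3q-14q^2)x^4y^2+(1+6q-6q^2-4q^3)x^4y^3\\ &+(q+q^2)x^5y^2+(8q+8q^2-7q^3)x^5y^3+(q+q^2)x^5y^4\\ &+(-q+4q^2+5q^3)x^6y^3+(-q+13q^3)x^6y^4+(-q^2+5q^3)x^7y^4,\\ A_2(x,y)=\;&(5q^2-q^3)x^4y^3+(13q^2-q^4)x^5y^3+(5q^2+4q^3-q^4)x^5y^4\\ &+(q^3+q^4)x^6y^3+(-7q^2+8q^3+8q^4)x^6y^4+(q^3+q^4)x^6y^5\\ &+(-4q^2-6q^3+q^5+6q^4)x^7y^4+(-14q^3-3q^4+5q^5)x^7y^5\\ &-(q^5+q^4)x^8y^4+(q^5-5q^4-5q^3)x^8y^5-(q^5+q^4)x^8y^6\\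 &+(-6q^5+q^4)x^9y^5+(-5q^5+q^4)x^9y^6,\\ A_3(x,y)=\;&-6q^4x^7y^5+(3q^4-4q^5)x^8y^6-6q^4x^8y^5+(3q^4-2q^5)x^9y^6\\ &+6q^5x^{10}y^6+5q^5x^{10}y^7+q^5x^{11}y^7. \end{aligned}$$
   Context: Let $\pi$ be a uniformizer of $\mathfrak{o}$. $\mathfrak{o}^4$ carries componentwise multiplication. A subalgebra of $\mathfrak{o}^4$ containing the identity is an $\mathfrak{o}$-submodule closed under multiplication and containing $(1,1,1,1)$. Any such subalgebra $\Lambda$ of finite index has elementary divisors $\pi^{\alpha_1},\pi^{\alpha_2},\pi^{\alpha_3},1$ for some integers $\alpha_1\ge\alpha_2\ge\alpha_3\ge0$, i.e. $\mathfrak{o}^4/\Lambda\cong\bigoplus_{i=1}^3\mathfrak{o}/\pi^{\alpha_i}\mathfrak{o}$. The cotype zeta function of subalgebras of $\mathfrak{o}^4$ containing the identity is $$\sum_{\alpha_1\ge\alpha_2\ge\alpha_3\ge0}f_4(\alpha_1,\alpha_2,\alpha_3)\,q^{-s_1\alpha_1}q^{-s_2\alpha_2}q^{-s_3\alpha_3},$$ where $f_4(\alpha_1,\alpha_2,\alpha_3)$ is the number of finite-index subalgebras of $\mathfrak{o}^4$ containing the identity with elementary divisors $\pi^{\alpha_1},\pi^{\alpha_2},\pi^{\alpha_3},1$. The identity is to be read as an identity of formal power series in $x,y,z$. *)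

(* Defs.v *)
From HB Require Import structures.
From mathcomp Require Import all_boot all_order all_algebra.
From mathcomp Require Import boolp classical_sets functions cardinality.
From mathcomp Require Import topology finmap.

Set Implicit Arguments.
Unset Strict Implicit.
Unset Printing Implicit Defensive.

Import GRing.Theory.
Local Open Scope classical_set_scope.
Local Open Scope card_scope.
Local Open Scope ring_scope.

Section QuotientModule.
Variables (R : pzRingType) (V : lmodType R) (S : {pred V}).
Hypothesis S_submod : submod_closed S.

Definition submod_pred of submod_closed S : V -> bool := S.

HB.instance Definition _ := GRing.isZmodClosed.Build V (submod_pred S_submod)
  (GRing.submod_closedB S_submod).

Local Notation quotS := (@Quotient.quot V (GRing.ZmodClosed.clone V (submod_pred S_submod) _)).

Definition quotmod : Type := quotS.

HB.instance Definition _ := GRing.Zmodule.on quotmod.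

Definition quotmod_pi (x : V) : quotmod := \pi_quotS%qT x.

Definition quotmod_scale (a : R) (x : quotmod) : quotmod :=
  quotmod_pi (a *: (repr (x : quotS) : V)).

Lemma quotmod_piP x y : quotmod_pi x = quotmod_pi y <-> x - y \in S.
Proof.
split => [/eqP|]; first by rewrite /quotmod_pi -Quotient.idealrBE.
by move=> xy; apply/eqP; rewrite /quotmod_pi -Quotient.idealrBE.
Qed.

Lemma quotmod_reprK (x : quotmod) : quotmod_pi (repr (x : quotS)) = x.
Proof. exact: reprK. Qed.

Lemma quotmod_piZ a x : quotmod_scale a (quotmod_pi x) = quotmod_pi (a *: x).
Proof.
apply/quotmod_piP; rewrite -scalerBr.
have [S0 Slin] := S_submod.
rewrite -[_ *: _]addr0; apply: Slin => //.
by apply/quotmod_piP; rewrite quotmod_reprK.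
Qed.

Lemma quotmod_piD x y : quotmod_pi (x + y) = quotmod_pi x + quotmod_pi y.
Proof. by rewrite /quotmod_pi raddfD. Qed.

Fact quotmod_scaleA a b x :
  quotmod_scale a (quotmod_scale b x) = quotmod_scale (a * b) x.
Proof. by rewrite -[x]quotmod_reprK !quotmod_piZ scalerA. Qed.

Fact quotmod_scale1 : left_id 1 quotmod_scale.
Proof. by move=> x; rewrite -[x]quotmod_reprK quotmod_piZ scale1r. Qed.

Fact quotmod_scaleDr : right_distributive quotmod_scale +%R.
Proof.
move=> a x y; rewrite -[x]quotmod_reprK -[y]quotmod_reprK.
by rewrite -quotmod_piD !quotmod_piZ scalerDr quotmod_piD.
Qed.

Fact quotmod_scaleDl x : {morph quotmod_scale^~ x : a b / a + b}.
Proof.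
move=> a b; rewrite -[x]quotmod_reprK.
by rewrite !quotmod_piZ scalerDl quotmod_piD.
Qed.

HB.instance Definition _ := GRing.Zmodule_isLmodule.Build R quotmod
  quotmod_scaleA quotmod_scale1 quotmod_scaleDr quotmod_scaleDl.

End QuotientModule.

Section DiscreteValuationRing.
Variable O : idomainType.

Definition principal (g : O) : {pred O^o} :=
  fun x => `[< exists u : O, x = u * g >].

Fact principal_submod (g : O) : submod_closed (principal g).
Proof.
split=> [|a x y /asboolP[u ->] /asboolP[v ->]]; apply/asboolP.
  by exists 0; rewrite mul0r.
by exists (a * u + v); rewrite mulrDl -mulrA.
Qed.

Definition nonunits : {pred O^o} := fun x : O => x \isn't a GRing.unit.

(* A local principal ideal domain that is not a field. *)
Definition is_dvr : Prop :=
  [/\ forall I : {pred O^o}, submod_closed I -> exists g, I =i principal g,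
      submod_closed nonunits
    & exists2 x : O, x != 0 & x \in nonunits].

Definition is_uniformizer (p : O) : Prop := nonunits =i principal p.

(* The quotient by the maximal ideal has q elements. *)
Definition residue_card (q : nat) : Prop :=
  exists h : submod_closed nonunits, [set: quotmod h] #= `I_q.

Definition quot_pow (p : O) (n : nat) : lmodType O :=
  quotmod (principal_submod (p ^+ n)).

End DiscreteValuationRing.

(* The ring O with its p-adic topology.  When p is a uniformizer of a discrete
   valuation ring this is the topology given by the valuation. *)
Definition adic (O : comNzRingType) (p : O) : Type := O.

Section AdicTopology.
Variables (O : comNzRingType) (p : O).

HB.instance Definition _ := GRing.ComNzRing.on (adic p).

Definition adic_open : set_system (adic p) :=
  [set A | forall x : O, A x -> exists n : nat, forall u : O, A (x + u * p ^+ n)].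

Fact adic_openT : adic_open setT.
Proof. by move=> x _; exists 0%N. Qed.

Fact adic_openI : setI_closed adic_open.
Proof.
move=> A B oA oB x [/oA[m Am] /oB[n Bn]].
exists (m + n)%N => u; split.
  by rewrite addnC exprD mulrA.
by rewrite exprD mulrA.
Qed.

Fact adic_open_bigU (I : Type) (f : I -> set (adic p)) :
  (forall i, adic_open (f i)) -> adic_open (\bigcup_i f i).
Proof. by move=> of_ x [i _ /of_[n fn]]; exists n => u; exists i. Qed.

HB.instance Definition _ := isOpenTopological.Build (adic p)
  adic_openT adic_openI adic_open_bigU.

End AdicTopology.

Section Cotype.
Variables (O : idomainType) (p : O).

Definition pow4 : lalgType O := (O^o * O^o * O^o * O^o)%type.

Definition has_cotype (L : {pred pow4}) (hL : submod_closed L) (a b c : nat) :=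
  exists f : {linear quotmod hL ->
      (quot_pow p a * quot_pow p b * quot_pow p c)%type},
    bijective f.

(* subalg_closed requires 1 \in L.  The cotype condition is
   O^4 / L ~ O / p^a + O / p^b + O / p^c as O-modules. *)
Definition subalgebras_of_cotype (a b c : nat) : set {pred pow4} :=
  [set L | exists2 hL : subalg_closed L,
     finite_set [set: quotmod (GRing.subalg_closedZ hL)]
     & has_cotype (GRing.subalg_closedZ hL) a b c].

(* fset_set is meaningful on finite sets only; it sends infinite sets to the
   empty set. *)
Definition f4 (a b c : nat) : nat := #|` fset_set (subalgebras_of_cotype a b c)|.

End Cotype.

(* Formal power series in x, y, z: the function gives the coefficient of
   x^i y^j z^k. *)
Definition series3 := nat -> nat -> nat -> int.

Definition series3_mul (F G : series3) : series3 := fun i j k =>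
  \sum_(a < i.+1) \sum_(b < j.+1) \sum_(c < k.+1)
    F a b c * G (i - a)%N (j - b)%N (k - c)%N.

(* z is the outermost indeterminate and x the innermost. *)
Definition poly3 := {poly {poly {poly int}}}.
Definition var_x : poly3 := 'X%:P%:P.
Definition var_y : poly3 := 'X%:P.
Definition var_z : poly3 := 'X.

Definition series3_of_poly (P : poly3) : series3 := fun i j k => P`_k`_j`_i.

Definition cotype_zeta (O : idomainType) (p : O) : series3 := fun i j k =>
  if (k <= j <= i)%N then (f4 p i j k)%:Z else 0.

Section RationalFunction.
Variable R : comNzRingType.
Implicit Types q x y z : R.

Definition A0 q x y : R :=
  1 + 5 * x + 6 * x * y + (3 * q - 2) * x ^+ 2 * y
  + (3 * q - 4) * x ^+ 3 * y - 6 * q * x ^+ 3 * y ^+ 2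
  - 6 * q * x ^+ 4 * y ^+ 2.

Definition A1 q x y : R :=
  (q - 5) * x ^+ 2 * y + (q - 6) * x ^+ 2 * y ^+ 2
  - (q + 1) * x ^+ 3 * y
  + (1 - 5 * q - 5 * q ^+ 2) * x ^+ 3 * y ^+ 2
  - (q + 1) * x ^+ 3 * y ^+ 3
  + (5 - 3 * q - 14 * q ^+ 2) * x ^+ 4 * y ^+ 2
  + (1 + 6 * q - 6 * q ^+ 2 - 4 * q ^+ 3) * x ^+ 4 * y ^+ 3
  + (q + q ^+ 2) * x ^+ 5 * y ^+ 2
  + (8 * q + 8 * q ^+ 2 - 7 * q ^+ 3) * x ^+ 5 * y ^+ 3
  + (q + q ^+ 2) * x ^+ 5 * y ^+ 4
  + (- q + 4 * q ^+ 2 + 5 * q ^+ 3) * x ^+ 6 * y ^+ 3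
  + (- q + 13 * q ^+ 3) * x ^+ 6 * y ^+ 4
  + (- q ^+ 2 + 5 * q ^+ 3) * x ^+ 7 * y ^+ 4.

Definition A2 q x y : R :=
  (5 * q ^+ 2 - q ^+ 3) * x ^+ 4 * y ^+ 3
  + (13 * q ^+ 2 - q ^+ 4) * x ^+ 5 * y ^+ 3
  + (5 * q ^+ 2 + 4 * q ^+ 3 - q ^+ 4) * x ^+ 5 * y ^+ 4
  + (q ^+ 3 + q ^+ 4) * x ^+ 6 * y ^+ 3
  + (- 7 * q ^+ 2 + 8 * q ^+ 3 + 8 * q ^+ 4) * x ^+ 6 * y ^+ 4
  + (q ^+ 3 + q ^+ 4) * x ^+ 6 * y ^+ 5
  + (- 4 * q ^+ 2 - 6 * q ^+ 3 + q ^+ 5 + 6 * q ^+ 4) * x ^+ 7 * y ^+ 4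
  + (- 14 * q ^+ 3 - 3 * q ^+ 4 + 5 * q ^+ 5) * x ^+ 7 * y ^+ 5
  - (q ^+ 5 + q ^+ 4) * x ^+ 8 * y ^+ 4
  + (q ^+ 5 - 5 * q ^+ 4 - 5 * q ^+ 3) * x ^+ 8 * y ^+ 5
  - (q ^+ 5 + q ^+ 4) * x ^+ 8 * y ^+ 6
  + (- 6 * q ^+ 5 + q ^+ 4) * x ^+ 9 * y ^+ 5
  + (- 5 * q ^+ 5 + q ^+ 4) * x ^+ 9 * y ^+ 6.

Definition A3 q x y : R :=
  - 6 * q ^+ 4 * x ^+ 7 * y ^+ 5
  + (3 * q ^+ 4 - 4 * q ^+ 5) * x ^+ 8 * y ^+ 6
  - 6 * q ^+ 4 * x ^+ 8 * y ^+ 5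
  + (3 * q ^+ 4 - 2 * q ^+ 5) * x ^+ 9 * y ^+ 6
  + 6 * q ^+ 5 * x ^+ 10 * y ^+ 6
  + 5 * q ^+ 5 * x ^+ 10 * y ^+ 7
  + q ^+ 5 * x ^+ 11 * y ^+ 7.

Definition numerator q x y z : R :=
  A0 q x y + A1 q x y * z + A2 q x y * z ^+ 2 + A3 q x y * z ^+ 3.

(* The constant coefficient is 1, so the denominator is an invertible power
   series and F = N / D is equivalent to D * F = N. *)
Definition denominator q x y z : R :=
  (1 - x) * (1 - x * y) * (1 - x * y * z)
  * (1 - q * x ^+ 2 * y)
  * (1 - q ^+ 2 * x ^+ 2 * y * z)
  * (1 - q ^+ 2 * x ^+ 2 * y ^+ 2 * z)
  * (1 - q ^+ 3 * x ^+ 3 * y ^+ 2 * z).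

End RationalFunction.

(* Main.v *)
(* Splitting off the identity, a subalgebra of O^4 is a multiplicatively closed
   lattice M of O^3 of the same cotype (a, b, c).  Such a lattice has a unique
   Hermite form: for an order (i, j, k) of the coordinates it has the basis
     p^c (e_i + s e_j + t e_k),  p^b (e_j + r e_k),  p^a e_k
   with s, r, t determined modulo p^(b - c), p^(a - b), p^(a - c), and M is
   closed under multiplication iff four congruences in s, r, t hold.  For a > 2c
   the second of them reads t^2 - t = r (s^2 - s) modulo p^(a - 2c).  This
   surface is smooth: where s is congruent to neither 0 nor 1 it determines r,
   and elsewhere, by Hensel's lemma for X^2 - X, it determines t and allows
   s^2 - s to be taken as a coordinate instead of s.  Counting solutions gives
   f4 as an explicit function of D = a - b, B = b - c and c.  In the variables
   X = x, Y = x y, Z = x y z this function is a sum of monomial functions on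
   unimodular cones generated by 0/1-vectors, each cone contributing one partial
   fraction of F. *)
From HB Require Import structures.
Require Import Defs.
From Stdlib Require Import Ring ZArith.
From mathcomp Require Import all_boot all_order all_algebra.
From mathcomp Require Import boolp classical_sets functions cardinality.
From mathcomp Require Import topology finmap.
From mathcomp Require Import zify lra.

Set Implicit Arguments.
Unset Strict Implicit.
Unset Printing Implicit Defensive.

Import Order.TTheory GRing.Theory Num.Theory.
Local Open Scope classical_set_scope.
Local Open Scope ring_scope.

(** * Ring identities *)

(** All counts are integer sums of indicator functions over residue systems modulo p^n, so that a
    change of variables or a fibre count becomes an exchange of finite sums. Near an idempotent of
    the residue field the derivative 2 s - 1 of s^2 - s is congruent to 1 or -1, also in residue
    characteristic 2, so no residue field is special; the remaining q - 2 classes of s give the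
    terms with Q - 2. The obstacle is the branch where s and t are close to the same idempotent.
    There x = s^2 - s remains free and r is bound by (r^2 - r) x = 0 modulo p^(D - c). The required
    valuation can be shared between r^2 - r and x in several ways, so the number of solutions
    contains a factor linear in D, B or c and is not monomial on cones. Its difference in the
    direction D is, and taking this difference is multiplication by 1 - x in the generating
    function. The six pivot orders differ only in which of s, r, t are confined to the maximal
    ideal. Near idempotents their contributions combine so that r is counted with weight 1 outside
    the maximal ideal and 2 inside, which removes most of the case distinctions. *)

Section RingTactic.
Variable R : comNzRingType.

Definition cadd (x y : R) : R := x + y.
Definition cmul (x y : R) : R := x * y.
Definition copp (x : R) : R := - x.
Definition csub (x y : R) : R := x - y.
Definition cexp (x : R) (n : nat) : R := x ^+ n.
Definition cmuln (x : R) (n : nat) : R := x *+ n.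
Definition czero : R := 0.
Definition cone : R := 1.

Lemma cring_theory : ring_theory czero cone cadd cmul csub copp eq.
Proof.
split.
- exact: add0r.
- exact: addrC.
- exact: addrA.
- exact: mul1r.
- exact: mulrC.
- exact: mulrA.
- exact: mulrDl.
- by [].
- exact: subrr.
Qed.

Lemma cpower_theory : power_theory cone cmul eq N.to_nat cexp.
Proof.
split=> x [|n] //=; elim/Pos.peano_ind: n => [|n IH]; first exact: expr1.
rewrite Pos2Nat.inj_succ /cexp exprS -[_ ^+ _]/(cexp _ _) IH pow_pos_succ //.
exact: mulrA.
Qed.

(* Puts an operation of [R] at the head of the goal, where the ring tactic
   looks for the carrier. *)
Lemma csub_eq0 (x y : R) : csub x y = czero -> x = y.
Proof. exact: subr0_eq. Qed.

End RingTactic.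

Ltac nat_literal t :=
  lazymatch t with
  | O => constr:(N0)
  | S ?n => lazymatch nat_literal n with
            | InitialRing.NotConstant => constr:(InitialRing.NotConstant)
            | ?m => let r := eval compute in (N.succ m) in constr:(r)
            end
  | _ => constr:(InitialRing.NotConstant)
  end.

Ltac crepeat R x n :=
  lazymatch n with
  | O => constr:(czero R)
  | S O => constr:(x)
  | S ?m => let y := crepeat R x m in constr:(@cadd R x y)
  end.

(* The same operation of [R] occurs with different, convertible structure
   instances, which syntactic reification would tell apart. *)
Ltac canon R t :=
  lazymatch t with
  | @GRing.add _ ?a ?b =>
      let a' := canon R a in let b' := canon R b in constr:(@cadd R a' b')
  | @GRing.mul _ ?a ?b =>
      let a' := canon R a in let b' := canon R b in constr:(@cmul R a' b')
  | @GRing.opp _ ?a => let a' := canon R a in constr:(@copp R a')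
  | @GRing.exp _ ?a ?n => let a' := canon R a in constr:(@cexp R a' n)
  | @GRing.zero _ => constr:(czero R)
  | @GRing.one _ => constr:(cone R)
  | @GRing.natmul _ ?a ?n =>
      lazymatch nat_literal n with
      | InitialRing.NotConstant =>
          let a' := canon R a in constr:(@cmuln R a' n)
      | _ => let a' := canon R a in crepeat R a' n
      end
  | _ => constr:(t)
  end.

Ltac cring_over R :=
  lazymatch goal with
  | |- @eq _ ?a ?b =>
      let a' := canon R a in let b' := canon R b in
      apply: (@csub_eq0 R a b);
      change (@eq (GRing.ComNzRing.sort R) (@csub R a' b') (czero R)); ring
  end.

(** * Residues modulo powers of the uniformizer *)

Section PowerDivisibility.
Variables (O : idomainType) (p : O).

Definition pdvd n (x : O) : bool := principal (p ^+ n) x.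

Lemma pdvdP n x : reflect (exists u, x = u * p ^+ n) (pdvd n x).
Proof. exact: asboolP. Qed.

Lemma pdvd_exp n u : pdvd n (u * p ^+ n).
Proof. by apply/pdvdP; exists u. Qed.

Lemma pdvd0n x : pdvd 0 x.
Proof. by apply/pdvdP; exists x; rewrite expr0 mulr1. Qed.

Lemma pdvd0 n : pdvd n 0.
Proof. by apply/pdvdP; exists 0; rewrite mul0r. Qed.

Lemma pdvdD n x y : pdvd n x -> pdvd n y -> pdvd n (x + y).
Proof.
by move=> /pdvdP[u ->] /pdvdP[v ->]; apply/pdvdP; exists (u + v); rewrite mulrDl.
Qed.

Lemma pdvdN n x : pdvd n (- x) = pdvd n x.
Proof.
by apply/pdvdP/pdvdP => -[u e]; exists (- u); rewrite mulNr -e // opprK.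
Qed.

Lemma pdvdB n x y : pdvd n x -> pdvd n y -> pdvd n (x - y).
Proof. by move=> hx hy; apply: pdvdD => //; rewrite pdvdN. Qed.

Lemma pdvdMl n x y : pdvd n x -> pdvd n (y * x).
Proof. by move=> /pdvdP[u ->]; apply/pdvdP; exists (y * u); rewrite mulrA. Qed.

Lemma pdvdMr n x y : pdvd n x -> pdvd n (x * y).
Proof. by rewrite mulrC; apply: pdvdMl. Qed.

Lemma pdvdW m n x : (m <= n)%N -> pdvd n x -> pdvd m x.
Proof.
move=> /subnK <- /pdvdP[u ->]; apply/pdvdP.
by exists (u * p ^+ (n - m)); rewrite exprD mulrA.
Qed.

Lemma pdvdDr n x y : pdvd n x -> pdvd n (x + y) = pdvd n y.
Proof.
move=> hx; apply/idP/idP => [|hy]; last exact: pdvdD.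
by move=> /pdvdB/(_ hx); rewrite addrC addrA addNr add0r.
Qed.

Lemma pdvd_congr n x y : pdvd n (x - y) -> pdvd n x = pdvd n y.
Proof. by move=> h; rewrite -[x in LHS](subrK y) pdvdDr. Qed.

Lemma pdvd_sym n x y : pdvd n (x - y) = pdvd n (y - x).
Proof. by rewrite -opprB pdvdN. Qed.

Lemma pdvd_unit n u x : u \is a GRing.unit -> pdvd n (u * x) = pdvd n x.
Proof.
move=> uu; apply/idP/idP; last exact: pdvdMl.
by move=> /(pdvdMl u^-1); rewrite mulKr.
Qed.

Lemma pdvd_le n m x : (n <= m)%N -> pdvd n (p ^+ m * x).
Proof. by move=> h; apply/pdvdMr/(pdvdW h)/pdvdP; exists 1; rewrite mul1r. Qed.

Lemma pdvd1p x : pdvd 1 (p * x).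
Proof. by have := pdvd_le x (leqnn 1); rewrite expr1. Qed.

Hypothesis p0 : p != 0.

Lemma pdvdX m n x : pdvd (m + n) (p ^+ m * x) = pdvd n x.
Proof.
apply/pdvdP/pdvdP => -[u e]; exists u.
  have pm : p ^+ m != 0 by rewrite expf_neq0.
  by apply: (mulfI pm); rewrite e exprD mulrCA.
by rewrite e exprD mulrCA.
Qed.

Lemma pdvdS n x : pdvd n.+1 (p * x) = pdvd n x.
Proof. by rewrite -(pdvdX 1 n x) expr1. Qed.

(** Truncated subtraction covers n <= m, where no condition on x is left. This is how congruences
    carrying a factor p^c become void for large c. *)
Lemma pdvd_sub n m x : pdvd n (p ^+ m * x) = pdvd (n - m) x.
Proof.
have [le_nm|/ltnW le_mn] := leqP n m.
  by rewrite pdvd_le // (eqP le_nm) pdvd0n.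
by rewrite -{1}(subnKC le_mn) pdvdX.
Qed.

Hypothesis p_unif : is_uniformizer p.

Lemma pdvd1_nonunit x : pdvd 1 x = (x \isn't a GRing.unit).
Proof. by rewrite -[RHS]/(x \in (nonunits (O := O))) p_unif /pdvd expr1. Qed.

Lemma npdvd_unit x : ~~ pdvd 1 x -> x \is a GRing.unit.
Proof. by rewrite pdvd1_nonunit negbK. Qed.

Lemma pdvd11 : pdvd 1 1 = false.
Proof. by rewrite pdvd1_nonunit unitr1. Qed.

Lemma pdvd1M x y : pdvd 1 (x * y) = pdvd 1 x || pdvd 1 y.
Proof. by rewrite !pdvd1_nonunit unitrM negb_and. Qed.

End PowerDivisibility.

(** * Finite sums over residue systems *)

Section Representatives.
Variables (O : idomainType) (p : O) (q : nat) (digits : seq O).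
Hypotheses (p0 : p != 0) (p_unif : is_uniformizer p).
Hypotheses (size_digits : size digits = q)
  (digitsP : forall a, \sum_(d <- digits) (pdvd p 1 (d - a))%:R = 1%R :> int).

Local Notation pd := (pdvd p).

(** Digit expansions of length n. [digitsP] says that every class modulo p contains exactly one
    digit; as a sum of indicators it enters the counts directly. *)
Fixpoint reps n : seq O :=
  if n is m.+1 then [seq d + p * y | d <- digits, y <- reps m] else [:: 0].

Lemma sum_reps0 (h : O -> int) : \sum_(x <- reps 0) h x = h 0.
Proof. by rewrite big_seq1. Qed.

Lemma sum_repsS n (h : O -> int) :
  \sum_(x <- reps n.+1) h x = \sum_(d <- digits) \sum_(y <- reps n) h (d + p * y).
Proof. exact: big_allpairs_dep. Qed.

Lemma size_reps n : size (reps n) = (q ^ n)%N.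
Proof. by elim: n => //= n IH; rewrite size_allpairs IH size_digits expnS. Qed.

(** Exactly one lowest digit agrees with a modulo p, say d = a + u p; the higher digits must then be
    congruent to -u modulo one power less. *)
Lemma sum_reps_class m n a : (m <= n)%N ->
  \sum_(x <- reps n) (pd m (x - a))%:R = (q ^ (n - m))%:R :> int.
Proof.
elim: m n a => [|m IH] n a.
  move=> _; rewrite subn0 -size_reps.
  rewrite (eq_bigr (fun=> 1)) => [|x _]; first by rewrite big_const_seq count_predT iter_addr_0.
  by rewrite pdvd0n.
case: n => // n le_mn; rewrite sum_repsS subSS.
rewrite -[RHS]mul1r -[X in _ = X * _](digitsP a) mulr_suml; apply: eq_bigr => d _.
have [/pdvdP[u e]|nda] := boolP (pd 1 (d - a)); last first.
  rewrite mul0r big1 // => y _; rewrite (_ : pd _ _ = false) //.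
  apply/negbTE; apply: contra nda => /(@pdvdW _ _ 1 m.+1 _ isT).
  by rewrite addrAC addrC (pdvdDr _ (pdvd1p _ _)).
rewrite mul1r -(IH n (- u)) //; apply: eq_bigr => y _.
by rewrite addrAC e expr1 [u * p]mulrC -mulrDr pdvdS // opprK addrC.
Qed.

Lemma sum_reps_class1 n a :
  \sum_(x <- reps n) (pd n (x - a))%:R = 1%R :> int.
Proof. by rewrite sum_reps_class // subnn. Qed.

Definition invariant_mod n (h : O -> int) :=
  forall x y, pd n (x - y) -> h x = h y.

(** The indicator of a class acts as a delta function on functions of residues. Inserting such
    indicators replaces explicit bijections in the changes of variables. *)
Lemma sum_reps_pick n a h : invariant_mod n h ->
  \sum_(x <- reps n) (pd n (x - a))%:R * h x = h a.
Proof.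
move=> hinv; rewrite -[RHS]mul1r -[X in _ = X * _](sum_reps_class1 n a) mulr_suml.
apply: eq_bigr => x _; have [/hinv -> //|] := boolP (pd n (x - a)).
by rewrite !mul0r.
Qed.

Lemma sum_reps_const n (k : int) : \sum_(x <- reps n) k = (q ^ n)%:R * k.
Proof. by rewrite big_const_seq count_predT iter_addr_0 size_reps mulr_natl. Qed.

Lemma sum_reps_mem n a : exists2 x, x \in reps n & pd n (x - a).
Proof.
apply/hasP; rewrite -[has _ _]negbK; apply/negP => /hasPn na.
have := sum_reps_class1 n a.
by rewrite big_seq big1 // => d /na /negPf ->.
Qed.

Lemma uniq_reps n x y : x \in reps n -> y \in reps n -> pd n (x - y) -> x = y.
Proof.
move=> xr yr xy; apply/eqP; apply: contraT => nxy.
have yr' : y \in rem x (reps n).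
  by have := perm_to_rem xr; move/perm_mem/(_ y); rewrite yr inE eq_sym (negPf nxy).
(* Two distinct congruent entries would contribute 2 to a sum of nonnegative terms equal to 1. *)
have := sum_reps_class1 n y; rewrite (big_rem x) //= (big_rem y) //=.
rewrite xy subrr pdvd0 !mulr1n => e.
have : (0 : int) <= \sum_(z <- rem y (rem x (reps n))) (pd n (z - y))%:R.
  by apply: sumr_ge0 => z _; rewrite ler0n.
by lra.
Qed.

Lemma reps_uniq n : uniq (reps n).
Proof.
apply: count_mem_uniq => a; have [a_in|/count_memPn //] := boolP (a \in reps n).
apply/eqP; rewrite eqn_leq -has_count has_pred1 a_in andbT.
rewrite -(ler_nat int) -[leRHS](sum_reps_class1 n a) -sum1_count natr_sum big_mkcond /=.
apply: ler_sum => x _; case: eqP => [->|_]; last exact: ler0n.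
by rewrite subrr pdvd0.
Qed.

Lemma invariant_pdvd m n f : (m <= n)%N ->
  (forall x y, pd n (x - y) -> pd m (f x - f y)) ->
  invariant_mod n (fun x => (pd m (f x))%:R).
Proof. by move=> le_mn hf x y /hf/pdvd_congr ->. Qed.

Lemma invariant_mul n f g : invariant_mod n f -> invariant_mod n g ->
  invariant_mod n (fun x => f x * g x).
Proof. by move=> hf hg x y xy; rewrite (hf _ _ xy) (hg _ _ xy). Qed.

Lemma sum_reps_multiples k n h : (k <= n)%N -> invariant_mod n h ->
  \sum_(x <- reps n) (pd k x)%:R * h x = \sum_(y <- reps (n - k)) h (p ^+ k * y).
Proof.
move=> le_kn hinv.
transitivity (\sum_(y <- reps (n - k)) \sum_(x <- reps n)
    (pd n (x - p ^+ k * y))%:R * h x).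
  rewrite exchange_big; apply: eq_bigr => x _; rewrite -mulr_suml; congr (_ * _).
  have [/pdvdP[u ->]|nx] := boolP (pd k x).
    rewrite -[LHS](sum_reps_class1 (n - k) u); apply: eq_bigr => y _.
    by rewrite [u * _]mulrC -mulrBr pdvd_sub // pdvd_sym.
  rewrite big1 // => y _; rewrite (_ : pd _ _ = false) //.
  apply/negbTE; apply: contra nx => /(pdvdW le_kn).
  by rewrite addrC pdvdDr // pdvdN pdvd_le.
by apply: eq_bigr => y _; rewrite sum_reps_pick.
Qed.

(** Change of variables x = g(s): by the last hypothesis the s in P lying over a given x in Q form a
    single class. Summing over the pairs with x congruent to g(s) in both orders avoids an inverse
    of g. *)
Lemma sum_reps_subst n (P Q : O -> bool) g h :
  (forall s, P s -> Q (g s)) ->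
  (forall x y, pd n (x - y) -> Q x = Q y) -> invariant_mod n h ->
  (forall x, Q x -> exists a, forall s, P s && pd n (x - g s) = pd n (s - a)) ->
  \sum_(s <- reps n) (P s)%:R * h (g s) = \sum_(x <- reps n) (Q x)%:R * h x.
Proof.
move=> PQ Qinv hinv hPQ.
transitivity (\sum_(s <- reps n) \sum_(x <- reps n)
    (pd n (x - g s))%:R * ((P s)%:R * (Q x)%:R * h x)).
  apply: eq_bigr => s _; rewrite (@sum_reps_pick _ (g s) (fun x => (P s)%:R * (Q x)%:R * h x)).
    by have [/PQ ->|] := boolP (P s); rewrite ?mulr1 ?mul0r.
  by move=> x y xy; rewrite (Qinv _ _ xy) (hinv _ _ xy).
rewrite exchange_big; apply: eq_bigr => x _.
have [/hPQ[a ha]|] := boolP (Q x); last first.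
  by rewrite mul0r big1 // => s _; rewrite mulr0 mul0r mulr0.
rewrite mul1r -[RHS]mul1r -[X in _ = X * _](sum_reps_class1 n a) mulr_suml.
apply: eq_bigr => s _; rewrite mulr1 mulrA -natrM mulnb andbC ha //.
Qed.

Add Ring ring1 : (@cring_theory O) (power_tac (@cpower_theory O) [nat_literal]).

(** The element is congruent to 2 s0 - 1, which is 1 or -1. It is the cofactor of s - t in (s^2 - s)
    - (t^2 - t). *)
Lemma idem_unit (s0 s t : O) : s0 = 0 \/ s0 = 1 -> pd 1 (s - s0) -> pd 1 (t - s0) ->
  s + t - 1 \is a GRing.unit.
Proof.
move=> s01 hs ht; apply: (npdvd_unit p_unif); apply/negP => h.
have := pdvdB (pdvdD hs ht) h; case: s01 => ->.
  rewrite (_ : _ - _ = 1); first by rewrite pdvd11.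
  by cring_over O.
rewrite (_ : _ - _ = -1); first by rewrite pdvdN pdvd11.
by cring_over O.
Qed.

(* Iterate the contraction a |-> a^2 - x; the root near 1 is 1 - a. *)
Lemma artin_schreier_root (s0 : O) n x : s0 = 0 \/ s0 = 1 -> pd 1 x ->
  exists2 a, pd 1 (a - s0) & pd n (x - (a ^+ 2 - a)).
Proof.
move=> s01 px.
have [a pa ha] : exists2 a, pd 1 a & pd n (x - (a ^+ 2 - a)).
  elim: n => [|n [a pa ha]]; first by exists 0; rewrite ?pdvd0 ?pdvd0n.
  exists (a ^+ 2 - x); first by rewrite expr2 pdvdB // pdvdMl.
  rewrite (_ : _ - _ = (x - (a ^+ 2 - a)) * (a + (a ^+ 2 - x))); last by cring_over O.
  case/pdvdP: ha => u ->.
  have /pdvdP[v ->] : pd 1 (a + (a ^+ 2 - x)).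
    by rewrite pdvdD // expr2 pdvdB // pdvdMl.
  by apply/pdvdP; exists (u * v); rewrite expr1 exprSr; cring_over O.
case: s01 => ->; first by exists a; rewrite ?subr0.
exists (1 - a); first by rewrite addrAC subrr add0r pdvdN.
by rewrite (_ : _ - _ = x - (a ^+ 2 - a)) //; cring_over O.
Qed.

(** On the class of an idempotent s0 the map s |-> s^2 - s is a bijection onto the maximal ideal:
    [artin_schreier_root] gives a preimage a, and the unit [s + a - 1] makes it unique. *)
Lemma sum_artin_schreier (s0 : O) n h : s0 = 0 \/ s0 = 1 -> (0 < n)%N -> invariant_mod n h ->
  \sum_(s <- reps n) (pd 1 (s - s0))%:R * h (s ^+ 2 - s)
  = \sum_(x <- reps n) (pd 1 x)%:R * h x.
Proof.
move=> s01 n0 hinv.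
have asE s : s ^+ 2 - s = (s - s0) * (s + s0 - 1).
  by case: s01 => ->; cring_over O.
apply: (sum_reps_subst (P := fun s => pd 1 (s - s0)) (g := fun s => s ^+ 2 - s)) => //.
- by move=> s hs; rewrite asE pdvdMr.
- by move=> x y /(pdvdW n0)/pdvd_congr.
move=> x /(artin_schreier_root n s01)[a a0 ha]; exists a => s.
have key : pd 1 (s - s0) -> pd n (x - (s ^+ 2 - s)) = pd n (s - a).
  move=> hs.
  rewrite (_ : _ - _ = x - (a ^+ 2 - a) - (s + a - 1) * (s - a)); last by cring_over O.
  by rewrite pdvdDr // pdvdN pdvd_unit // (idem_unit s01).
have [hs|ns] := boolP (pd 1 (s - s0)); first exact: key.
apply/esym/negbTE; apply: contra ns => /(pdvdW n0) sa.
by rewrite -[s](subrK a) -addrA pdvdD.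
Qed.

End Representatives.

(** * Counting multiplicatively closed lattices *)

Section ClosedTriples.
Variables (O : idomainType) (p : O) (q : nat) (digits : seq O).
Hypotheses (p0 : p != 0) (p_unif : is_uniformizer p).
Hypotheses (size_digits : size digits = q)
  (digitsP : forall a, \sum_(d <- digits) (pdvd p 1 (d - a))%:R = 1%R :> int).
Variables (B D c : nat).

Local Notation pd := (pdvd p).
Local Notation reps := (reps p digits).
Add Ring ring2 : (@cring_theory O) (power_tac (@cpower_theory O) [nat_literal]).

(* The products of the basis vectors p^c (e_i + s e_j + t e_k) and
   p^b (e_j + r e_k) lie in the lattice, where b = c + B and a = c + B + D. *)
Definition closed_triple (s r t : O) : bool :=
  [&& pd B (p ^+ c * (s ^+ 2 - s)),
      pd (B + D) (p ^+ c * (t ^+ 2 - t - r * (s ^+ 2 - s))),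
      pd D (p ^+ c * (r * (t - s)))
    & pd D (p ^+ (B + c) * (r ^+ 2 - r))].

(* The flags tell which of s, t, r the Hermite form forces to vanish modulo p. *)
Definition cell (bs bt br : bool) : int :=
  \sum_(s <- reps B) \sum_(r <- reps D) \sum_(t <- reps (B + D))
    [&& closed_triple s r t, bs ==> pd 1 s, bt ==> pd 1 t & br ==> pd 1 r]%:R.

(** For n = 0 the truncated exponent is right: the only representative is 0, which passes the
    flag. *)
Lemma sum_flag n (b : bool) :
  \sum_(x <- reps n) (b ==> pd 1 x)%:R = (q ^ (n - b))%:R :> int.
Proof.
case: b => /=; last by rewrite (sum_reps_const _ size_digits) mulr1 subn0.
case: n => [|n]; first by rewrite sum_reps0 pdvd0.
rewrite -(sum_reps_class p0 size_digits digitsP 0 (isT : (1 <= n.+1)%N)).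
by apply: eq_bigr => x _; rewrite subr0.
Qed.

(** Every modulus is at most p^(B + D) and every congruence carries p^c, so only the flags
    remain. *)
Lemma cell_free bs bt br : (B + D <= c)%N ->
  cell bs bt br = (q ^ (B - bs) * q ^ (D - br) * q ^ (B + D - bt))%:R.
Proof.
move=> le_c; rewrite !natrM -!sum_flag -mulrA mulr_suml; apply: eq_bigr => s _.
rewrite mulr_suml mulr_sumr; apply: eq_bigr => r _.
rewrite !mulr_sumr; apply: eq_bigr => t _.
rewrite /closed_triple !pdvd_le //=; try lia.
Qed.

Hypothesis lt_cA : (c < B + D)%N.

(** The substitution x = t^2 - t turns the condition into membership in one class modulo p^(B + D -
    c). As c < B + D, this class lies inside the maximal ideal. *)
Lemma sum_t_root (t0 rho : O) : t0 = 0 \/ t0 = 1 -> pd 1 rho ->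
  \sum_(t <- reps (B + D)) (pd 1 (t - t0))%:R *
    (pd (B + D) (p ^+ c * (t ^+ 2 - t - rho)))%:R = (q ^ c)%:R :> int.
Proof.
move=> t01 prho.
have Ag : (0 < B + D)%N by exact: leq_ltn_trans lt_cA.
pose h x : int := (pd (B + D) (p ^+ c * (x - rho)))%:R.
rewrite (@sum_artin_schreier _ _ _ _ p0 p_unif size_digits digitsP _ _ h t01 Ag); last first.
  apply: invariant_pdvd => // x y xy.
  by rewrite -mulrBr opprB addrA subrK pdvdMl.
rewrite -[in RHS](subKn (ltnW lt_cA)).
rewrite -(sum_reps_class p0 size_digits digitsP rho (leq_subr c (B + D))).
apply: eq_bigr => x _; rewrite /h pdvd_sub //.
have [xr|] := boolP (pd _ (x - rho)); last by rewrite mulr0.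
rewrite (_ : pd 1 x) // -[x](subrK rho) pdvdD //.
by apply: pdvdW xr; rewrite subn_gt0.
Qed.

(* What remains of the congruences, for s an idempotent modulo p and
   x = s^2 - s, when t is congruent to s, resp. to 1 - s, modulo p. *)
Definition same_cond (x r : O) : bool :=
  pd D (p ^+ c * ((r ^+ 2 - r) * x)) && pd D (p ^+ (B + c) * (r ^+ 2 - r)).
Definition cross_cond (r : O) : bool := pd D (p ^+ c * r).

(** The second congruence puts t^2 - t into the maximal ideal, so t is close to s0 or to 1 - s0. In
    the first case s + t - 1 is a unit, and (t - s)(s + t - 1) = (t^2 - t) - (s^2 - s) transforms
    the third congruence. In the second case t - s is a unit, and the third congruence implies the
    fourth. *)
Lemma closed_idem (s0 s r t : O) : s0 = 0 \/ s0 = 1 -> pd 1 (s - s0) ->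
  (closed_triple s r t)%:R =
  (pd B (p ^+ c * (s ^+ 2 - s)))%:R *
  ((pd 1 (t - s0))%:R * (pd (B + D) (p ^+ c * (t ^+ 2 - t - r * (s ^+ 2 - s))))%:R
     * (same_cond (s ^+ 2 - s) r)%:R
   + (pd 1 (t - (1 - s0)))%:R
     * (pd (B + D) (p ^+ c * (t ^+ 2 - t - r * (s ^+ 2 - s))))%:R * (cross_cond r)%:R)
  :> int.
Proof.
move=> s01 ss0; rewrite /closed_triple /same_cond /cross_cond.
case: (pd B _) => /=; last by rewrite mul0r.
rewrite mul1r.
have [h2|] := boolP (pd (B + D) _); last by rewrite !mulr0 !mul0r addr0.
rewrite !mulr1 /=.
have [t0|nt0] := boolP (pd 1 (t - s0)).
  rewrite (_ : pd 1 (t - (1 - s0)) = false); last first.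
    apply/negbTE/negP => h; move: (pdvdB t0 h); case: s01 => ->.
      by rewrite (_ : _ - _ = 1) ?pdvd11 //; cring_over O.
    by rewrite (_ : _ - _ = -1) ?pdvdN ?pdvd11 //; cring_over O.
  rewrite mul0r addr0 mul1r; congr (_%:R); congr (nat_of_bool (_ && _)).
  rewrite -(@pdvd_unit _ p D _ (p ^+ c * (r * (t - s))) (idem_unit p_unif s01 ss0 t0)).
  (* Subtracting r times the second congruence eliminates t and leaves p^c (r^2 - r)(s^2 - s). *)
  rewrite -(pdvdDr _ (pdvdMl (- r) (pdvdW (leq_addl B D) h2))).
  by congr (pd D _); cring_over O.
rewrite mul0r add0r.
have [t1|nt1] := boolP (pd 1 (t - (1 - s0))); last first.
  suff : pd 1 (t ^+ 2 - t).
    rewrite (_ : _ - t = (t - s0) * (t - (1 - s0))).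
      by rewrite pdvd1M // (negPf nt0) (negPf nt1).
    by case: s01 => ->; cring_over O.
  move: h2; rewrite pdvd_sub // => h2.
  have {}h2 : pd 1 (t ^+ 2 - t - r * (s ^+ 2 - s)).
    by apply: pdvdW h2; rewrite subn_gt0.
  rewrite -[_ - t](subrK (r * (s ^+ 2 - s))) pdvdD // pdvdMl //.
  rewrite (_ : _ - s = (s - s0) * (s - (1 - s0))); first by rewrite pdvdMr.
  by case: s01 => ->; cring_over O.
rewrite mul1r; congr (_%:R); congr (nat_of_bool _).
have uts : t - s \is a GRing.unit.
  apply: (npdvd_unit p_unif); apply/negP => ts.
  have := pdvdB (pdvdD ts ss0) t1; case: s01 => ->.
    by rewrite (_ : _ - _ = 1) ?pdvd11 //; cring_over O.
  by rewrite (_ : _ - _ = -1) ?pdvdN ?pdvd11 //; cring_over O.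
rewrite (_ : p ^+ c * (r * (t - s)) = (t - s) * (p ^+ c * r)); last by cring_over O.
rewrite pdvd_unit //; case: (boolP (pd D (p ^+ c * r))) => //= h.
rewrite (_ : _ * (_ - r) = p ^+ B * (r - 1) * (p ^+ c * r)); first exact: pdvdMl.
by rewrite exprD; cring_over O.
Qed.

(** Each branch of t has q^c roots; a flag on t keeps only the branch near 0. *)
Lemma sum_t_idem (s0 s r : O) (bt : bool) : s0 = 0 \/ s0 = 1 -> pd 1 (s - s0) ->
  \sum_(t <- reps (B + D)) (closed_triple s r t && (bt ==> pd 1 t))%:R =
  (q ^ c)%:R * ((pd B (p ^+ c * (s ^+ 2 - s)))%:R *
  ((bt ==> (s0 == 0%R))%:R * (same_cond (s ^+ 2 - s) r)%:R +
   (bt ==> (s0 == 1%R))%:R * (cross_cond r)%:R)) :> int.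
Proof.
move=> s01 ss0.
have rs : pd 1 (r * (s ^+ 2 - s)).
  apply: pdvdMl; rewrite (_ : _ - s = (s - s0) * (s - (1 - s0))); first by rewrite pdvdMr.
  by case: s01 => ->; cring_over O.
have s01' : 1 - s0 = 0 \/ 1 - s0 = 1 by case: s01 => ->; [right|left]; rewrite ?subr0 ?subrr.
have bE (t t0 : O) : t0 = 0 \/ t0 = 1 -> pd 1 (t - t0) -> pd 1 t = (t0 == 0).
  case=> ->; rewrite ?subr0 ?eqxx // oner_eq0 => h.
  apply/negbTE/negP => /pdvdB/(_ h); rewrite (_ : _ - _ = 1) ?pdvd11 //; cring_over O.
transitivity (\sum_(t <- reps (B + D)) (pd B (p ^+ c * (s ^+ 2 - s)))%:R *
  (((pd 1 (t - s0))%:R * (pd (B + D) (p ^+ c * (t ^+ 2 - t - r * (s ^+ 2 - s))))%:R)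
     * ((bt ==> (s0 == 0%R))%:R * (same_cond (s ^+ 2 - s) r)%:R)
   + (pd 1 (t - (1 - s0)))%:R
     * (pd (B + D) (p ^+ c * (t ^+ 2 - t - r * (s ^+ 2 - s))))%:R *
      ((bt ==> (s0 == 1%R))%:R * (cross_cond r)%:R)) : int).
  apply: eq_bigr => t _; rewrite -mulnb natrM (closed_idem r t s01 ss0).
  case: bt; rewrite ?mulr1 ?mul1r //=.
  have -> : (s0 == 1%R) = (1 - s0 == 0) by rewrite subr_eq0 eq_sym.
  rewrite -mulrA; congr (_ * _); rewrite mulrDl; congr (_ + _).
    have [t0|] := boolP (pd 1 (t - s0)); last by rewrite !mul0r.
    by rewrite (bE _ _ s01 t0) -!mulrA; congr (_ * (_ * _)); rewrite mulrC.
  have [t0|] := boolP (pd 1 (t - (1 - s0))); last by rewrite !mul0r.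
  by rewrite (bE _ _ s01' t0) -!mulrA; congr (_ * (_ * _)); rewrite mulrC.
rewrite -mulr_sumr big_split /= -!mulr_suml !sum_t_root //.
by rewrite -mulrDr mulrCA.
Qed.

Definition same_weight (br : bool) (x : O) : int :=
  \sum_(r <- reps D) (br ==> pd 1 r)%:R * (same_cond x r)%:R.
Definition cross_weight (br : bool) : int :=
  \sum_(r <- reps D) (br ==> pd 1 r)%:R * (cross_cond r)%:R.

Lemma sum_rt_idem (s0 s : O) (bs bt br : bool) : s0 = 0 \/ s0 = 1 -> pd 1 (s - s0) ->
  \sum_(r <- reps D) \sum_(t <- reps (B + D))
    [&& closed_triple s r t, bs ==> pd 1 s, bt ==> pd 1 t & br ==> pd 1 r]%:R =
  (q ^ c)%:R * (bs ==> (s0 == 0%R))%:R * ((pd B (p ^+ c * (s ^+ 2 - s)))%:R *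
   ((bt ==> (s0 == 0%R))%:R * same_weight br (s ^+ 2 - s) +
    (bt ==> (s0 == 1%R))%:R * cross_weight br)) :> int.
Proof.
move=> s01 ss0.
have -> : (bs ==> (s0 == 0%R)) = (bs ==> pd 1 s).
  case: s01 ss0 => ->; rewrite ?subr0 ?eqxx ?oner_eq0; first by move->.
  move=> h;  congr (_ ==> _); apply/esym/negbTE/negP => /pdvdB/(_ h).
  by rewrite (_ : _ - _ = 1) ?pdvd11 //; cring_over O.
transitivity (\sum_(r <- reps D) (bs ==> pd 1 s)%:R * ((br ==> pd 1 r)%:R *
   \sum_(t <- reps (B + D)) (closed_triple s r t && (bt ==> pd 1 t))%:R) : int).
  apply: eq_bigr => r _; rewrite mulrA mulr_sumr; apply: eq_bigr => t _.
  by case: (closed_triple s r t); case: (bs ==> _); case: (bt ==> _);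
    case: (br ==> _); rewrite /= ?mul0r ?mulr0 ?mul1r.
rewrite -mulr_sumr [(q ^ c)%:R * _]mulrC -mulrA; congr (_ * _).
transitivity (\sum_(r <- reps D) (q ^ c)%:R * (pd B (p ^+ c * (s ^+ 2 - s)))%:R *
  ((bt ==> (s0 == 0%R))%:R * ((br ==> pd 1 r)%:R * (same_cond (s ^+ 2 - s) r)%:R) +
   (bt ==> (s0 == 1%R))%:R * ((br ==> pd 1 r)%:R * (cross_cond r)%:R)) : int).
  apply: eq_bigr => r _; rewrite (sum_t_idem _ _ s01 ss0).
  by case: (br ==> _); rewrite ?mul1r ?mul0r ?mulr0 ?addr0 ?mulr0 // !mulrA.
by rewrite -mulr_sumr big_split /= -!mulr_sumr mulrA.
Qed.

Definition same_count br : int :=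
  \sum_(x <- reps B) (pd 1 x)%:R * ((pd B (p ^+ c * x))%:R * same_weight br x).
Definition cross_count br : int :=
  \sum_(x <- reps B) (pd 1 x)%:R * ((pd B (p ^+ c * x))%:R * cross_weight br).

(** The fourth congruence is what makes the condition on (r^2 - r) x insensitive to multiples of p^B
    in x. *)
Lemma invariant_same_weight br : invariant_mod p B (same_weight br).
Proof.
move=> x y xy; apply: eq_bigr => r _; congr (_ * _%:R); congr nat_of_bool.
rewrite /same_cond; have [h|] := boolP (pd D (p ^+ (B + c) * _)); last by rewrite !andbF.
rewrite !andbT; apply: pdvd_congr; rewrite -!mulrBr.
case/pdvdP: xy => u ->.
rewrite (_ : p ^+ c * _ = u * (p ^+ (B + c) * (r ^+ 2 - r))); first exact: pdvdMl.
by rewrite exprD; cring_over O.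
Qed.

Lemma invariant_level : invariant_mod p B (fun x => (pd B (p ^+ c * x))%:R).
Proof. by apply: invariant_pdvd => // x y xy; rewrite -mulrBr pdvdMl. Qed.

Hypothesis B_gt0 : (0 < B)%N.

Lemma sum_idem_class (s0 : O) (bs bt br : bool) : s0 = 0 \/ s0 = 1 ->
  \sum_(s <- reps B) (pd 1 (s - s0))%:R *
    \sum_(r <- reps D) \sum_(t <- reps (B + D))
    [&& closed_triple s r t, bs ==> pd 1 s, bt ==> pd 1 t & br ==> pd 1 r]%:R =
  (q ^ c)%:R * (bs ==> (s0 == 0%R))%:R *
   ((bt ==> (s0 == 0%R))%:R * same_count br + (bt ==> (s0 == 1%R))%:R * cross_count br)
  :> int.
Proof.
move=> s01.
pose h1 x := (pd B (p ^+ c * x))%:R * same_weight br x.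
pose h2 x := (pd B (p ^+ c * x))%:R * cross_weight br.
have -> : same_count br = \sum_(s <- reps B) (pd 1 (s - s0))%:R * h1 (s ^+ 2 - s).
  rewrite (@sum_artin_schreier _ _ _ _ p0 p_unif size_digits digitsP _ _ h1 s01) //.
  by apply: invariant_mul; [exact: invariant_level | exact: invariant_same_weight].
have -> : cross_count br = \sum_(s <- reps B) (pd 1 (s - s0))%:R * h2 (s ^+ 2 - s).
  rewrite (@sum_artin_schreier _ _ _ _ p0 p_unif size_digits digitsP _ _ h2 s01) //.
  by apply: invariant_mul; first exact: invariant_level.
rewrite !mulr_sumr -big_split mulr_sumr; apply: eq_bigr => s _ /=.
have [ss0|_] := boolP (pd 1 (s - s0)); last by rewrite !(mul0r, mulr0, addr0).
rewrite (sum_rt_idem _ _ _ s01 ss0) !mul1r /h1 /h2; congr (_ * _).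
by rewrite mulrDr; congr (_ + _); rewrite mulrCA.
Qed.

Definition generic (s : O) : bool := ~~ pd 1 s && ~~ pd 1 (s - 1).

Definition generic_count (bt br : bool) : int :=
  \sum_(s <- reps B) (generic s)%:R *
    \sum_(r <- reps D) \sum_(t <- reps (B + D))
    [&& closed_triple s r t, bt ==> pd 1 t & br ==> pd 1 r]%:R.

(** A flag on s leaves only s near 0. A flag on t removes the cross branch for s near 0 and the same
    branch for s near 1. *)
Lemma cell_split (bs bt br : bool) :
  cell bs bt br =
    (q ^ c)%:R * (same_count br + (~~ bt)%:R * cross_count br
      + (~~ bs)%:R * ((~~ bt)%:R * same_count br + cross_count br))
    + (~~ bs)%:R * generic_count bt br.
Proof.
have I0 := sum_idem_class bs bt br (or_introl erefl : 0 = 0 :> O \/ 0 = 1 :> O).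
have I1 := sum_idem_class bs bt br (or_intror erefl : 1 = 0 :> O \/ 1 = 1 :> O).
rewrite !eqxx !implybT [0 == 1]eq_sym oner_eq0 !implybF !mulr1 !mul1r in I0.
rewrite !eqxx !implybT oner_eq0 !implybF !mul1r in I1.
rewrite mulrDr -I0 mulrA -I1 /generic_count mulr_sumr -!big_split.
clear I0 I1.
apply: eq_bigr => s _ /=.
set S := \sum_(r <- _) _; set G := \sum_(r <- _) _.
rewrite subr0.
have SG : (generic s)%:R * S = (generic s)%:R * ((~~ bs)%:R * G).
  rewrite /generic; case: (boolP (pd 1 s)) => [|/negPf ns] /=; first by rewrite !mul0r.
  congr (_ * _); rewrite /S /G ns; case: (bs) => /=.
    by rewrite mul0r big1 // => r _; rewrite big1 // => t _; rewrite andbF.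
  by rewrite mul1r.
rewrite mulrCA -SG -!mulrDl -[LHS]mul1r; congr (_ * _).
rewrite /generic; case: (boolP (pd 1 s)) => [h0|_]; case: (boolP (pd 1 (s - 1))) => [h1|_] //=.
by have := pdvdB h0 h1; rewrite (_ : _ - _ = 1) ?pdvd11 //; cring_over O.
Qed.

(** These are the flag triples of the six pivot orders. The same and cross counts enter only through
    the sum over both values of the flag on r, whence [weight]. *)
Lemma cells_sum :
  cell false false false + cell false false true + cell true false false
  + cell false true true + cell true true false + cell true true true
  = (q ^ c)%:R * (4 * (same_count false + same_count true)
       + 3 * (cross_count false + cross_count true))
    + (generic_count false false + generic_count false true + generic_count true true).
Proof. by rewrite !cell_split /=; lra. Qed.

(** For D = 0 only the three pivot orders with j < k are admissible; these are their flags. *)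
Lemma cells_sum_D0 :
  cell false false false + cell true false false + cell true true false
  = (q ^ c)%:R * (4 * same_count false + 3 * cross_count false)
    + generic_count false false.
Proof. by rewrite !cell_split /=; lra. Qed.

End ClosedTriples.

(** * Weighted counts of r and of pairs (e, r) *)

Section Evaluation.
Variables (O : idomainType) (p : O) (q : nat) (digits : seq O).
Hypotheses (p0 : p != 0) (p_unif : is_uniformizer p).
Hypotheses (size_digits : size digits = q)
  (digitsP : forall a, \sum_(d <- digits) (pdvd p 1 (d - a))%:R = 1%R :> int).
Variable D : nat.

Local Notation pd := (pdvd p).
Local Notation reps := (reps p digits).
Local Notation Q := (q%:R : int).
Add Ring ring3 : (@cring_theory O) (power_tac (@cpower_theory O) [nat_literal]).

Lemma sum_pdvd n m a : (m <= n)%N ->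
  \sum_(x <- reps n) (pd m (x - a))%:R = Q ^+ (n - m).
Proof. by move=> le_mn; rewrite (sum_reps_class p0 size_digits digitsP) // natrX. Qed.

Lemma sum_pdvd0 n m : (m <= n)%N -> \sum_(x <- reps n) (pd m x)%:R = Q ^+ (n - m).
Proof.
by move=> le_mn; rewrite -(sum_pdvd 0 le_mn); apply: eq_bigr => x _; rewrite subr0.
Qed.

Lemma sum_reps_cst n (k : int) : \sum_(x <- reps n) k = Q ^+ n * k.
Proof. by rewrite (sum_reps_const _ size_digits) natrX. Qed.

(** Since a and b are distinct modulo p, at most one factor is a nonunit, and it must carry the
    whole power. *)
Lemma pdvd_prod2 m (x a b : O) : (0 < m)%N -> ~~ pd 1 (a - b) ->
  (pd m ((x - a) * (x - b)))%:R = (pd m (x - a))%:R + (pd m (x - b))%:R :> int.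
Proof.
move=> m0 nab.
have [h1|h1] := boolP (pd 1 (x - a)).
  have h2 : ~~ pd 1 (x - b).
    apply: contra nab => h2.
    have -> : a - b = (x - b) - (x - a) by cring_over O.
    exact: pdvdB.
  rewrite mulrC pdvd_unit; last exact: npdvd_unit.
  rewrite (_ : pd m (x - b) = false) ?addr0 //.
  by apply/negbTE; apply: contra h2; apply: pdvdW.
rewrite pdvd_unit; last exact: npdvd_unit.
rewrite (_ : pd m (x - a) = false) ?add0r //.
by apply/negbTE; apply: contra h1; apply: pdvdW.
Qed.

Lemma pdvd_idem m r : (0 < m)%N ->
  (pd m (r ^+ 2 - r))%:R = (pd m r)%:R + (pd m (r - 1))%:R :> int.
Proof.
move=> m0; rewrite (_ : _ - r = (r - 0) * (r - 1)); last by cring_over O.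
by rewrite pdvd_prod2 ?subr0 // sub0r pdvdN pdvd11.
Qed.

Lemma pdvd1_and m r : (0 < m)%N ->
  (pd 1 r)%:R * (pd m (r - 1))%:R = 0 :> int.
Proof.
move=> m0; have [h|] := boolP (pd 1 r); last by rewrite mul0r.
rewrite (_ : pd m _ = false) ?mulr0 //; apply/negbTE/negP => /(pdvdW m0) /(pdvdB h).
by rewrite (_ : _ - _ = 1) ?pdvd11 //; cring_over O.
Qed.

Lemma pdvdW_mul m r : (0 < m)%N ->
  (pd 1 r)%:R * (pd m r)%:R = (pd m r)%:R :> int.
Proof.
move=> m0; have [h|] := boolP (pd m r); last by rewrite mulr0.
by rewrite (pdvdW m0 h).
Qed.

(* Each r in the maximal ideal counts twice: once in the cell where r is free
   and once in the cell where it must vanish modulo p. *)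
Definition weight (r : O) : int := 1 + (pd 1 r)%:R.

Lemma sum_weight_idem m : (0 < m <= D)%N ->
  \sum_(r <- reps D) weight r * (pd m (r ^+ 2 - r))%:R = 3 * Q ^+ (D - m).
Proof.
case/andP=> m0 le_mD.
transitivity (\sum_(r <- reps D) ((pd m r)%:R + (pd m r)%:R + (pd m (r - 1))%:R) : int).
  apply: eq_bigr => r _; rewrite pdvd_idem // /weight.
  by have := pdvd1_and r m0; have := pdvdW_mul r m0; lra.
by rewrite !big_split /= sum_pdvd0 // sum_pdvd //; lra.
Qed.

Lemma sum_weight : (0 < D)%N -> \sum_(r <- reps D) weight r = (Q + 1) * Q ^+ D.-1.
Proof.
move=> D0; rewrite /weight big_split /= sum_reps_cst sum_pdvd0 // subn1.
by rewrite -{1}(prednK D0) exprS; lra.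
Qed.

(** This is [same_cond] summed over r and over x = p^k e. The second divisibility makes the first
    depend on e modulo p^M only. *)
Definition level_sum M m : int := \sum_(e <- reps M) \sum_(r <- reps D)
  weight r * (pd m ((r ^+ 2 - r) * e) && pd m (p ^+ M * (r ^+ 2 - r)))%:R.

Lemma level_sum0 M : (0 < D)%N -> level_sum M 0 = (Q + 1) * Q ^+ (M + D.-1).
Proof.
move=> D0; rewrite /level_sum (eq_bigr (fun=> (Q + 1) * Q ^+ D.-1)) => [|e _].
  by rewrite sum_reps_cst exprD; lra.
rewrite -(sum_weight D0); apply: eq_bigr => r _.
by rewrite !pdvd0n mulr1.
Qed.

Lemma level_sum00 m : (0 < m <= D)%N -> level_sum 0 m = 3 * Q ^+ (D - m).
Proof.
move=> hm; rewrite /level_sum sum_reps0 -sum_weight_idem //.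
by apply: eq_bigr => r _; rewrite mulr0 pdvd0 expr0 mul1r.
Qed.

(* Split off the units e; a nonunit e = p e' lowers both M and m by one. *)
Lemma level_sumS M m : (m < D)%N ->
  level_sum M.+1 m.+1 = 3 * (Q - 1) * Q ^+ (M + D - m.+1) + level_sum M m.
Proof.
move=> lt_mD.
pose h e : int := \sum_(r <- reps D) weight r *
  (pd m.+1 ((r ^+ 2 - r) * e) && pd m.+1 (p ^+ M.+1 * (r ^+ 2 - r)))%:R.
have hinv : invariant_mod p M.+1 h.
  move=> x y xy; apply: eq_bigr => r _; congr (_ * _%:R); congr nat_of_bool.
  case hr: (pd m.+1 (p ^+ _ * _)); last by rewrite !andbF.
  rewrite !andbT; apply: pdvd_congr; rewrite -mulrBr.
  case/pdvdP: xy => u ->.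
  have -> : (r ^+ 2 - r) * (u * p ^+ M.+1) = u * (p ^+ M.+1 * (r ^+ 2 - r)).
    by cring_over O.
  exact: pdvdMl.
have -> : level_sum M m = \sum_(e <- reps M.+1) (pd 1 e)%:R * h e.
  rewrite (sum_reps_multiples p0 size_digits digitsP (k := 1)) //.
  rewrite subSS subn0; apply: eq_bigr => e _; apply: eq_bigr => r _.
  have -> : (r ^+ 2 - r) * (p ^+ 1 * e) = p * ((r ^+ 2 - r) * e).
    by rewrite expr1 mulrCA.
  by rewrite (exprS p M) -mulrA !pdvdS.
have -> : 3 * (Q - 1) * Q ^+ (M + D - m.+1) =
    \sum_(e <- reps M.+1) (1 - (pd 1 e)%:R) * (3 * Q ^+ (D - m.+1)).
  rewrite -mulr_suml sumrB sum_reps_cst sum_pdvd0 // subn1 /=.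
  by rewrite -addnBA // exprD exprS; lra.
rewrite -big_split; apply: eq_bigr => e _ /=.
have [|/(npdvd_unit p_unif) ue] := boolP (pd 1 e); first by rewrite subrr mul0r add0r mul1r.
rewrite subr0 mul1r mul0r addr0 -sum_weight_idem //.
apply: eq_bigr => r _; congr (_ * _%:R); congr nat_of_bool.
rewrite mulrC pdvd_unit //; case: (boolP (pd m.+1 (r ^+ 2 - r))) => // hr.
by rewrite pdvdMl.
Qed.

(** [level_sumS] is applied until m = 0. The term it adds depends on M - m only, so each of the m
    possible valuations of e contributes the same amount: this is the source of the linear
    factor. *)
Lemma level_sum_le M m : (m <= M)%N -> (m < D)%N ->
  level_sum M m = (3 * m%:R * (Q - 1) + Q + 1) * Q ^+ (M + D - m.+1).
Proof.
elim: m M => [|m IH] M le_mM lt_mD.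
  rewrite level_sum0 // mulr0 mul0r add0r -subn1 addnBA //.
case: M le_mM => // M le_mM; rewrite level_sumS ?IH //; try lia.
rewrite (_ : M + D - m.+1 = (M + D - m.+2).+1)%N; last by lia.
rewrite (_ : M.+1 + D - m.+2 = (M + D - m.+2).+1)%N; last by lia.
by rewrite -[(m.+1)%:R]natr1; lra.
Qed.

(** Here the recursion stops at M = 0, where the condition concerns r alone. *)
Lemma level_sum_gt M m : (M < m)%N -> (m < D)%N ->
  level_sum M m = 3 * (M%:R * (Q - 1) + Q) * Q ^+ (M + D - m.+1).
Proof.
elim: M m => [|M IH] m lt_Mm lt_mD.
  rewrite level_sum00 ?(ltnW lt_mD) ?lt_Mm // mul0r add0r add0n -mulrA -exprS.
  by rewrite -subSn // subSS.
case: m lt_Mm lt_mD => // m lt_Mm lt_mD; rewrite level_sumS ?IH //; try lia.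
rewrite (_ : M + D - m.+1 = (M + D - m.+2).+1)%N; last by lia.
rewrite (_ : M.+1 + D - m.+2 = (M + D - m.+2).+1)%N; last by lia.
by rewrite -[(M.+1)%:R]natr1; lra.
Qed.

End Evaluation.

(** * Contributions of idempotent and generic s *)

Section ClassCounts.
Variables (O : idomainType) (p : O) (q : nat) (digits : seq O).
Hypotheses (p0 : p != 0) (p_unif : is_uniformizer p).
Hypotheses (size_digits : size digits = q)
  (digitsP : forall a, \sum_(d <- digits) (pdvd p 1 (d - a))%:R = 1%R :> int).
Variables B D c : nat.
Hypotheses (lt_cA : (c < B + D)%N) (B_gt0 : (0 < B)%N).

Local Notation pd := (pdvd p).
Local Notation reps := (reps p digits).
Local Notation Q := (q%:R : int).
Local Notation same_count := (same_count p digits B D c).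
Local Notation cross_count := (cross_count p digits B D c).
Local Notation generic_count := (generic_count p digits B D c).
Add Ring ring4 : (@cring_theory O) (power_tac (@cpower_theory O) [nat_literal]).

(** For x in the maximal ideal, p^B divides p^c x iff p^k divides x. Writing x = p^k e leaves e
    modulo p^(B - k), with B - k = min(c, B - 1) and c + k = max(B, c + 1). *)
Let k := maxn 1 (B - c).

Lemma pdvd_level x : (pd 1 x)%:R * (pd B (p ^+ c * x))%:R = (pd k x)%:R :> int.
Proof.
rewrite pdvd_sub // -natrM mulnb /k; congr (_%:R); congr nat_of_bool.
by case: (leqP 1 (B - c)) => h; apply/andP/idP => [[] //|h1]; split;
  rewrite // ?(pdvdW _ h1) //; lia.
Qed.

Lemma sum_level (h : O -> int) : invariant_mod p B h ->
  \sum_(x <- reps B) (pd 1 x)%:R * ((pd B (p ^+ c * x))%:R * h x)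
  = \sum_(e <- reps (minn c B.-1)) h (p ^+ k * e).
Proof.
move=> hinv.
rewrite (_ : minn c B.-1 = B - k)%N; last by rewrite /k; lia.
rewrite -(sum_reps_multiples p0 size_digits digitsP) //; last by rewrite /k; lia.
by apply: eq_bigr => x _; rewrite mulrA pdvd_level.
Qed.

Lemma same_counts_sum : same_count false + same_count true
  = level_sum p digits D (minn c B.-1) (D - maxn B c.+1).
Proof.
rewrite /same_count !sum_level; try exact: invariant_same_weight.
rewrite -big_split; apply: eq_bigr => e _ /=.
rewrite -big_split; apply: eq_bigr => r _ /=.
rewrite -mulrDl; congr (_ * _%:R); congr nat_of_bool.
rewrite /same_cond.
have -> : p ^+ c * ((r ^+ 2 - r) * (p ^+ k * e)) = p ^+ (c + k) * ((r ^+ 2 - r) * e).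
  by rewrite exprD; cring_over O.
have -> : p ^+ (B + c) * (r ^+ 2 - r) = p ^+ (c + k) * (p ^+ minn c B.-1 * (r ^+ 2 - r)).
  by rewrite mulrA -exprD; congr (p ^+ _ * _); rewrite /k; lia.
by rewrite !(pdvd_sub p0 D (c + k)) (_ : c + k = maxn B c.+1)%N // /k; lia.
Qed.

Lemma cross_counts_sum : (0 < D)%N -> cross_count false + cross_count true
  = Q ^+ minn c B.-1 * (if (D <= c)%N then (Q + 1) * Q ^+ D.-1 else 2 * Q ^+ c).
Proof.
move=> D0; rewrite /cross_count !sum_level //.
rewrite -big_split /= (sum_reps_cst p size_digits); congr (_ * _).
rewrite -big_split /=.
transitivity (\sum_(r <- reps D) weight p r * (cross_cond p D c r)%:R).
  by apply: eq_bigr => r _; rewrite -mulrDl.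
case: leqP => [le_Dc|lt_cD].
  rewrite -(sum_weight p0 size_digits digitsP D0); apply: eq_bigr => r _.
  by rewrite /cross_cond pdvd_le // mulr1.
(* For c < D the condition confines r to the maximal ideal, where every weight is 2. *)
transitivity (\sum_(r <- reps D) ((pd (D - c) r)%:R * 2) : int).
  apply: eq_bigr => r _; rewrite /weight /cross_cond pdvd_sub //.
  have [h|] := boolP (pd (D - c) r); last by rewrite mulr0 mul0r.
  by rewrite (pdvdW _ h) // subn_gt0.
rewrite -mulr_suml (sum_pdvd0 p0 size_digits digitsP) ?leq_subr //.
by rewrite subKn 1?mulrC // ltnW.
Qed.

Lemma same_count_D0 : D = 0%N -> same_count false = Q ^+ minn c B.-1.
Proof.
move=> D0; rewrite /same_count !sum_level; last exact: invariant_same_weight.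
rewrite (eq_bigr (fun=> 1)) => [|e _]; first by rewrite (sum_reps_cst p size_digits) mulr1.
by rewrite /same_weight D0 sum_reps0 /same_cond !pdvd0n.
Qed.

Lemma cross_count_D0 : D = 0%N -> cross_count false = Q ^+ minn c B.-1.
Proof.
move=> D0; rewrite /cross_count !sum_level // (sum_reps_cst p size_digits).
have -> : cross_weight p digits D c false = 1.
  by rewrite /cross_weight D0 sum_reps0 /cross_cond !pdvd0n.
by rewrite mulr1.
Qed.

(** For c < B the first congruence forces p to divide s (s - 1). *)
Lemma generic_count_lt bt br : (c < B)%N -> generic_count bt br = 0.
Proof.
move=> lt_cB; rewrite /generic_count big1 // => s _.
have [/andP[s0 s1]|] := boolP (generic p s); last by rewrite mul0r.
rewrite big1 ?mulr0 // => r _; rewrite big1 // => t _.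
rewrite /closed_triple pdvd_sub //.
rewrite (_ : pd _ _ = false) //; apply/negbTE/negP => /(@pdvdW _ _ 1 _ _).
rewrite subn_gt0 => /(_ lt_cB); rewrite (_ : _ - s = s * (s - 1)); last by cring_over O.
by rewrite pdvd1M // (negPf s0) (negPf s1).
Qed.

Hypothesis le_Bc : (B <= c)%N.

(** As w = s^2 - s is a unit, the second congruence determines r modulo p^(B + D - c). Put T = t^2 -
    t. Replacing r w by T removes r from the third congruence and turns w^2 (r^2 - r) into T (T - w)
    = T (t - s)(t + s - 1), so that the fourth follows from the third. *)
Lemma closed_generic s r t : generic p s ->
  closed_triple p B D c s r t
  = pd (B + D - c) (r - (s ^+ 2 - s)^-1 * (t ^+ 2 - t))
    && pd D (p ^+ c * ((t ^+ 2 - t) * (t - s))).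
Proof.
case/andP=> s0 s1; set n := (B + D - c)%N; set w := s ^+ 2 - s.
have uw : w \is a GRing.unit.
  apply: (npdvd_unit p_unif); rewrite /w (_ : _ - s = s * (s - 1)); last by cring_over O.
  by rewrite pdvd1M // negb_or s0.
rewrite /closed_triple pdvd_le //= pdvd_sub //.
set E := (X in X && _ = _); set F := (X in _ = X && _).
have EF : E = F.
  rewrite /F -(@pdvd_unit _ p _ (- w) (r - _)) ?unitrN // /E; congr (pd _ _).
  have -> : - w * (r - w^-1 * (t ^+ 2 - t)) = (w * w^-1) * (t ^+ 2 - t) - r * w.
    by cring_over O.
  by rewrite mulrV // mul1r.
rewrite EF; case: (boolP F) => //= hF.
have /pdvdP[u hu] : E by rewrite EF.
have lt : (D <= n + c)%N by rewrite /n; lia.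
(* The error u p^n in r w = T - u p^n is harmless, because n + c = B + D. *)
have small x : pd D (p ^+ c * (u * p ^+ n * x)).
  apply: (pdvdW lt).
  have -> : p ^+ c * (u * p ^+ n * x) = u * x * p ^+ (n + c).
    by rewrite exprD; cring_over O.
  exact: pdvd_exp.
have rw : r * w = t ^+ 2 - t - u * p ^+ n by rewrite -hu /w; cring_over O.
have -> : pd D (p ^+ c * (r * (t - s))) = pd D (p ^+ c * ((t ^+ 2 - t) * (t - s))).
  rewrite -(@pdvd_unit _ p _ w _ uw).
  have -> : w * (p ^+ c * (r * (t - s))) = p ^+ c * ((r * w) * (t - s)) by cring_over O.
  rewrite rw.
  have -> : p ^+ c * ((t ^+ 2 - t - u * p ^+ n) * (t - s))
    = - (p ^+ c * (u * p ^+ n * (t - s))) + p ^+ c * ((t ^+ 2 - t) * (t - s)).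
    by cring_over O.
  by rewrite pdvdDr // pdvdN small.
case: (boolP (pd D _)) => //= ht.
rewrite -(@pdvd_unit _ p _ w _ uw) -(@pdvd_unit _ p _ w _ uw).
have -> : w * (w * (p ^+ (B + c) * (r ^+ 2 - r))) = p ^+ B * (p ^+ c * ((r * w) * (r * w - w))).
  by rewrite exprD; cring_over O.
apply: pdvdMl; rewrite rw.
have -> : p ^+ c * ((t ^+ 2 - t - u * p ^+ n) * (t ^+ 2 - t - u * p ^+ n - w))
  = p ^+ c * (u * p ^+ n * (u * p ^+ n + w - 2 * (t ^+ 2 - t)))
    + (t + s - 1) * (p ^+ c * ((t ^+ 2 - t) * (t - s))).
  by rewrite /w; cring_over O.
by rewrite pdvdD ?small // pdvdMl.
Qed.

Lemma sum_generic : \sum_(s <- reps B) (generic p s)%:R = (Q - 2) * Q ^+ B.-1.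
Proof.
transitivity (\sum_(s <- reps B) (1 - (pd 1 s)%:R - (pd 1 (s - 1))%:R) : int).
  apply: eq_bigr => s _; rewrite /generic.
  have := pdvd1_and p_unif s (ltn0Sn 0).
  by case: (pd 1 s); case: (pd 1 (s - 1)).
rewrite !sumrB (sum_reps_cst p size_digits) (sum_pdvd0 p0 size_digits digitsP) //.
rewrite (sum_pdvd p0 size_digits digitsP) // subn1 -{1}(prednK B_gt0) exprS.
by lra.
Qed.

Lemma generic_counts_sum : (0 < D)%N ->
  generic_count false false + generic_count false true + generic_count true true
  = (Q - 2) * Q ^+ c.-1 *
    (if (D <= c)%N then (Q + 3) * Q ^+ (B + D).-1 else 6 * Q ^+ (B + c)).
Proof.
move=> D0.
(* The first factor, with Q - 2, counts the generic s; the second counts the r modulo p^D in one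
   class modulo p^(B + D - c). *)
have -> : Q ^+ c.-1 = Q ^+ B.-1 * Q ^+ (c - B) by rewrite -exprD; congr (_ ^+ _); lia.
rewrite mulrA -sum_generic /generic_count -!big_split -mulrA mulr_suml.
apply: eq_bigr => s _ /=; rewrite -!mulrDr.
have [sg|] := boolP (generic p s); last by rewrite !mul0r.
rewrite !mul1r -!big_split /=.
rewrite (eq_bigr (fun r => \sum_(t <- reps (B + D))
   (pd (B + D - c) (r - (s ^+ 2 - s)^-1 * (t ^+ 2 - t)))%:R *
   ((pd D (p ^+ c * ((t ^+ 2 - t) * (t - s))))%:R *
   (1 + 2 * (pd 1 t)%:R + (pd 1 (t - 1))%:R)))); last first.
  move=> r _; rewrite -!big_split; apply: eq_bigr => t _ /=.
  rewrite !closed_generic //.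
  case: (boolP (pd (_ - _) _)) => [h|_] /=; last by rewrite mul0r.
  case: (boolP (pd D _)) => [_|_] /=; last by rewrite mul0r mulr0.
  (* The three flag patterns add up to 1 + [p | r] + [p | t], and r is a unit multiple of t (t - 1)
     modulo p. *)
  have -> : pd 1 r = pd 1 t || pd 1 (t - 1).
    rewrite -pdvd1M // -[r](subrK ((s ^+ 2 - s)^-1 * (t ^+ 2 - t))).
    rewrite pdvdDr; last by apply: pdvdW h; rewrite subn_gt0.
    rewrite pdvd_unit.
      by congr (pd 1 _); cring_over O.
    rewrite unitrV; apply: (npdvd_unit p_unif).
    rewrite (_ : _ - s = s * (s - 1)); last by cring_over O.
    by rewrite pdvd1M // negb_or; case/andP: sg => -> ->.
  have := pdvd1_and p_unif t (ltn0Sn 0).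
  by case: (pd 1 t); case: (pd 1 (t - 1)).
rewrite exchange_big /=.
rewrite (eq_bigr (fun t => Q ^+ (c - B) *
   ((pd D (p ^+ c * ((t ^+ 2 - t) * (t - s))))%:R *
   (1 + 2 * (pd 1 t)%:R + (pd 1 (t - 1))%:R)))); last first.
  move=> t _; rewrite -mulr_suml (sum_pdvd p0 size_digits digitsP); last by lia.
  by congr (_ ^+ _ * _); lia.
rewrite -mulr_sumr; congr (_ * _).
case: leqP => [le_Dc|lt_cD].
  rewrite (eq_bigr (fun t => (1 + 2 * (pd 1 t)%:R + (pd 1 (t - 1))%:R))); last first.
    by move=> t _; rewrite pdvd_le // mul1r.
  rewrite !big_split /= -mulr_sumr (sum_reps_cst p size_digits).
  rewrite (sum_pdvd p0 size_digits digitsP) ?(sum_pdvd0 p0 size_digits digitsP); try lia.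
  by rewrite subn1 -[in X in X + _ + _](@prednK (B + D)) ?exprS; [lra | lia].
set m := (D - c)%N.
have m0 : (0 < m)%N by rewrite subn_gt0.
case/andP: sg => s0 s1.
(* The elements 0, 1 and s are pairwise incongruent modulo p, so t must be congruent to one of them
   modulo p^m; the weights there are 3, 2 and 1, with sum 6. *)
rewrite (eq_bigr (fun t => 3 * (pd m t)%:R + 2 * (pd m (t - 1))%:R + (pd m (t - s))%:R)).
  rewrite !big_split /= -!mulr_sumr !(sum_pdvd p0 size_digits digitsP); try lia.
  rewrite (sum_pdvd0 p0 size_digits digitsP); last by lia.
  by rewrite (_ : B + D - m = B + c)%N; [lra | lia].
move=> t _; rewrite pdvd_sub // -/m.
have [h0|h0] := boolP (pd 1 t).
  have ut1 : t - 1 \is a GRing.unit.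
    apply: (npdvd_unit p_unif); apply/negP => h; have := pdvdB h0 h.
    by rewrite (_ : _ - _ = 1) ?pdvd11 //; cring_over O.
  have uts : t - s \is a GRing.unit.
    apply: (npdvd_unit p_unif); apply/negP => h; move/negP: s0; apply.
    by have := pdvdB h0 h; rewrite (_ : _ - _ = s) //; cring_over O.
  have nu x : x \is a GRing.unit -> pd m x = false.
    move=> ux; apply/negbTE/negP => /(pdvdW m0); rewrite pdvd1_nonunit //.
    by rewrite ux.
  rewrite (nu _ ut1) (nu _ uts).
  rewrite (_ : pd 1 (t - 1) = false); last by rewrite pdvd1_nonunit // ut1.
  rewrite (_ : _ * _ = (t - 1) * (t - s) * t); last by cring_over O.
  by rewrite pdvd_unit ?unitrM ?ut1 //; case: (pd m t).
have ut : t \is a GRing.unit by apply: (npdvd_unit p_unif).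
rewrite (_ : pd m t = false); last first.
  by apply/negbTE; apply: contra h0; apply: pdvdW.
rewrite (_ : (t ^+ 2 - t) * _ = t * ((t - 1) * (t - s))); last by cring_over O.
rewrite pdvd_unit // pdvd_prod2 //; last first.
  by rewrite -pdvdN opprB.
have [h1|h1] := boolP (pd 1 (t - 1)).
  rewrite (_ : pd m (t - s) = false); first by case: (pd m (t - 1)).
  apply/negbTE; apply: contra s1 => /(pdvdW m0) h.
  by have := pdvdB h1 h; rewrite (_ : _ - _ = s - 1) //; cring_over O.
rewrite (_ : pd m (t - 1) = false); last first.
  by apply/negbTE; apply: contra h1; apply: pdvdW.
by case: (pd m (t - s)).
Qed.

End ClassCounts.

(** For c >= B + D all lattices of the cotype are counted: Q^2 + Q + 1 is the number of points, or
    of lines, and (Q^2 + Q + 1)(Q + 1) the number of flags of the projective plane over the residue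
    field. At c = 0 the constants 6 and 7 count the partitions of the four coordinates into three
    and into two blocks of congruent coordinates. The last case adds generic triples, four same
    counts and three cross counts. *)
Definition cotype_count (Q : int) (D B c : nat) : int :=
  if (B == 0)%N then
    if (D == 0)%N then 1 else
    if (D <= c)%N then (Q ^+ 2 + Q + 1) * Q ^+ (2 * D - 2) else 6 * Q ^+ (2 * c)
  else if (D == 0)%N then
    if (B <= c)%N then (Q ^+ 2 + Q + 1) * Q ^+ (2 * B - 2) else 7 * Q ^+ (2 * c)
  else if (B + D <= c)%N then
    (Q ^+ 2 + Q + 1) * (Q + 1) * Q ^+ (2 * (B + D) - 3)
  else
    (if (B <= c)%N then (Q - 2) * Q ^+ c.-1 *
       (if (D <= c)%N then (Q + 3) * Q ^+ (B + D).-1 else 6 * Q ^+ (B + c))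
     else 0)
    + Q ^+ c * (4 *
       (if (D <= maxn B c.+1)%N then (Q + 1) * Q ^+ (minn c B.-1 + D.-1)
        else if (D <= B + c)%N then
          (3 * (D - maxn B c.+1)%:R * (Q - 1) + Q + 1) * Q ^+ (B + c).-1
        else 3 * ((minn c B.-1)%:R * (Q - 1) + Q) * Q ^+ (B + c).-1)
      + 3 * (Q ^+ minn c B.-1 *
        (if (D <= c)%N then (Q + 1) * Q ^+ D.-1 else 2 * Q ^+ c))).

(* [(i, j, k)] lists the coordinates of O^3 in the order in which the Hermite
   form of a lattice uses them as pivots. *)
Definition pivots : seq (nat * nat * nat) :=
  [:: (0, 1, 2); (0, 2, 1); (1, 0, 2); (1, 2, 0); (2, 0, 1); (2, 1, 0)]%N.

(* A pivot order that a repeated elementary divisor makes redundant is excluded. *)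
Definition admissible (B D : nat) (w : nat * nat * nat) : bool :=
  let: (i, j, k) := w in ((0 < D) || (j < k))%N && ((0 < B) || (i < j))%N.

(** * Summation over the pivot orders *)

Section TotalCount.
Variables (O : idomainType) (p : O) (q : nat) (digits : seq O).
Hypotheses (p0 : p != 0) (p_unif : is_uniformizer p).
Hypotheses (size_digits : size digits = q)
  (digitsP : forall a, \sum_(d <- digits) (pdvd p 1 (d - a))%:R = 1%R :> int).

Local Notation pd := (pdvd p).
Local Notation reps := (reps p digits).
Local Notation Q := (q%:R : int).
Local Notation cell := (cell p digits).

(** [cell_split] needs B > 0. For B = 0 the only s is 0, and the class of the idempotent 0 is all
    there is. *)
Lemma cell_B0 D c (bt br : bool) : (c < D)%N ->
  cell 0 D c false bt br = Q ^+ c *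
    (same_weight p digits 0 D c br 0 + (~~ bt)%:R * cross_weight p digits D c br).
Proof.
move=> lt_cD; rewrite /cell sum_reps0.
have := @sum_rt_idem _ _ _ _ p0 p_unif size_digits digitsP 0 D c lt_cD 0 0
  false bt br (or_introl erefl).
rewrite subrr pdvd0 => /(_ isT) ->.
rewrite pdvd0n eqxx !implybT [0 == 1]eq_sym oner_eq0 !implybF mulr1 !mul1r.
by rewrite expr2 mulr0 subrr natrX.
Qed.

Lemma same_weight_B0 D c br : (c < D)%N ->
  same_weight p digits 0 D c br 0 = if br then Q ^+ c else 2 * Q ^+ c.
Proof.
move=> lt_cD; have m0 : (0 < D - c)%N by rewrite subn_gt0.
transitivity (\sum_(r <- reps D)
   ((pd (D - c) r)%:R + (~~ br)%:R * (pd (D - c) (r - 1))%:R) : int).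
  apply: eq_bigr => r _; rewrite /same_cond mulr0 mulr0 pdvd0 add0n pdvd_sub //=.
  rewrite pdvd_idem //.
  have := pdvd1_and p_unif r m0; have := pdvdW_mul p r m0.
  by case: br => /=; [lra | rewrite !mul1r].
rewrite big_split -mulr_sumr /= (sum_pdvd0 p0 size_digits digitsP) ?leq_subr //.
rewrite (sum_pdvd p0 size_digits digitsP) ?leq_subr // subKn; last exact: ltnW.
by case: br => /=; lra.
Qed.

Lemma cross_weight_lt D c br : (c < D)%N -> cross_weight p digits D c br = Q ^+ c.
Proof.
move=> lt_cD; have m0 : (0 < D - c)%N by rewrite subn_gt0.
transitivity (\sum_(r <- reps D) (pd (D - c) r)%:R : int).
  apply: eq_bigr => r _; rewrite /cross_cond pdvd_sub //.
  by case: br; rewrite /= ?mul1r // pdvdW_mul.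
by rewrite (sum_pdvd0 p0 size_digits digitsP) ?leq_subr // subKn // ltnW.
Qed.

Lemma generic_count_D0 B c bt br : (0 < B)%N -> (c < B + 0)%N ->
  generic_count p digits B 0 c bt br = 0.
Proof. by move=> B0 lt_cB; rewrite generic_count_lt //; move: lt_cB; rewrite addn0. Qed.

Lemma sum_cells B D c :
  \sum_(w <- pivots) (admissible B D w)%:R *
     cell B D c (w.1.2 < w.1.1)%N (w.2 < w.1.1)%N (w.2 < w.1.2)%N
  = cotype_count Q D B c.
Proof.
rewrite /pivots !big_cons big_nil /= /cotype_count.
case: (posnP B) => [->|B0]; case: (posnP D) => [->|D0] /=.
- rewrite !mul0r !addr0 mul1r (cell_free p0 size_digits digitsP) //.
- rewrite !mul0r !addr0 !mul1r add0r.
  case: (leqP D c) => [le_Dc|lt_cD].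
    rewrite !(cell_free p0 size_digits digitsP) // !natrM !natrX /=.
    rewrite ?add0n !subn0 ?sub0n expr0 !mul1r -!exprD.
    have -> : (2 * D - 2 = (D - 1) + (D - 1))%N by lia.
    have e : Q ^+ D = Q * Q ^+ (D - 1) by rewrite -exprS subn1 prednK.
    by rewrite !exprD e; lra.
  rewrite !cell_B0 // !same_weight_B0 // !cross_weight_lt //= mul2n -addnn exprD.
  by lra.
- rewrite !mul0r !addr0 !mul1r add0r.
  case: (leqP B c) => [le_Bc|lt_cB].
    rewrite !(cell_free p0 size_digits digitsP) ?addn0 // !natrM !natrX /=.
    rewrite !sub0n !subn0 !expr0 !mulr1 -!exprD.
    have -> : (2 * B - 2 = (B - 1) + (B - 1))%N by lia.
    have e : Q ^+ B = Q * Q ^+ (B - 1) by rewrite -exprS subn1 prednK.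
    by rewrite !exprD e; lra.
  have lt_cA : (c < B + 0)%N by rewrite addn0.
  have := cells_sum_D0 p0 p_unif size_digits digitsP lt_cA B0.
  rewrite (generic_count_D0 _ _ B0 lt_cA) (same_count_D0 p0 size_digits digitsP) //
    (cross_count_D0 p0 size_digits digitsP) //.
  rewrite (_ : minn c B.-1 = c) ?natrX; last lia.
  by rewrite mul2n -addnn exprD; lra.
rewrite !mul1r; case: (leqP (B + D) c) => [le_Ac|lt_cA].
  rewrite !(cell_free p0 size_digits digitsP) // !natrM !natrX !subn0.
  rewrite (_ : Q ^+ B = Q * Q ^+ (B - 1)); last by rewrite -exprS; congr (_ ^+ _); lia.
  rewrite (_ : Q ^+ D = Q * Q ^+ (D - 1)); last by rewrite -exprS; congr (_ ^+ _); lia.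
  rewrite (_ : Q ^+ (B + D) = Q * Q ^+ (B + D - 1)); last first.
    by rewrite -exprS; congr (_ ^+ _); lia.
  rewrite (_ : Q ^+ (2 * (B + D) - 3) = Q ^+ (B - 1) * Q ^+ (D - 1) * Q ^+ (B + D - 1)).
    by lra.
  by rewrite -!exprD; congr (_ ^+ _); lia.
have := cells_sum p0 p_unif size_digits digitsP lt_cA B0.
rewrite (same_counts_sum p0 size_digits digitsP) //
  (cross_counts_sum p0 size_digits digitsP) //.
have -> : generic_count p digits B D c false false
   + generic_count p digits B D c false true
   + generic_count p digits B D c true true
  = (if (B <= c)%N then (Q - 2) * Q ^+ c.-1 *
       (if (D <= c)%N then (Q + 3) * Q ^+ (B + D).-1 else 6 * Q ^+ (B + c))
     else 0).
  case: (leqP B c) => [le_Bc|lt_cB]; last by rewrite !generic_count_lt.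
  exact: (generic_counts_sum p0 p_unif size_digits digitsP).
have -> : level_sum p digits D (minn c B.-1) (D - maxn B c.+1)
  = (if (D <= maxn B c.+1)%N then (Q + 1) * Q ^+ (minn c B.-1 + D.-1)
        else if (D <= B + c)%N then
          (3 * (D - maxn B c.+1)%:R * (Q - 1) + Q + 1) * Q ^+ (B + c).-1
        else 3 * ((minn c B.-1)%:R * (Q - 1) + Q) * Q ^+ (B + c).-1).
  case: (leqP D (maxn B c.+1)) => [h|h].
    (* The truncated exponent is 0 here, so nothing is required of (e, r). *)
    by move: (h); rewrite -subn_eq0 => /eqP ->; rewrite (level_sum0 p0 size_digits digitsP).
  have -> : ((B + c).-1 = minn c B.-1 + D - (D - maxn B c.+1).+1)%N by lia.
  case: (leqP D (B + c)) => h2.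
    by apply: (level_sum_le p0 p_unif size_digits digitsP); lia.
  by apply: (level_sum_gt p0 p_unif size_digits digitsP); lia.
by rewrite natrX => E; rewrite [RHS]addrC -E addr0 !addrA.
Qed.

End TotalCount.

(** * Hermite forms of sublattices *)

Section HermiteForms.
Variables (O : idomainType) (p : O).
Hypotheses (p0 : p != 0) (p_unif : is_uniformizer p).
Local Notation pd := (pdvd p).
Add Ring ring5 : (@cring_theory O) (power_tac (@cpower_theory O) [nat_literal]).

(* The defining congruences of the lattice spanned by p^c (e_i + s e_j + t e_k),
   p^b (e_j + r e_k) and p^a e_k. *)
Definition hform (a b c : nat) (w : nat * nat * nat) (u : O * O * O)
    (y : nat -> O) : bool :=
  let: (i, j, k) := w in let: (s, r, t) := u in
  [&& pd c (y i), pd b (y j - s * y i)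
    & pd a (y k - r * (y j - s * y i) - t * y i)].

Definition dot (F y : nat -> O) : O :=
  F 0%N * y 0%N + F 1%N * y 1%N + F 2%N * y 2%N.

Lemma pivotsP (P : nat -> nat -> nat -> Prop) :
  P 0%N 1%N 2%N -> P 0%N 2%N 1%N -> P 1%N 0%N 2%N -> P 1%N 2%N 0%N ->
  P 2%N 0%N 1%N -> P 2%N 1%N 0%N ->
  forall i j k, (i, j, k) \in pivots -> P i j k.
Proof.
move=> h1 h2 h3 h4 h5 h6 i j k; rewrite /pivots !inE.
by do 5?[case/orP]; move=> /eqP[-> -> ->].
Qed.

Lemma pivots_neq i j k : (i, j, k) \in pivots -> (i != j) /\ (j != k).
Proof. by move: i j k; apply: pivotsP. Qed.

Lemma dotE i j k F y : (i, j, k) \in pivots ->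
  dot F y = F i * y i + F j * y j + F k * y k.
Proof. by move: i j k; apply: pivotsP; rewrite /dot; cring_over O. Qed.

Lemma dot_unit F y : ~~ pd 1 (dot F y) -> exists i j k,
  [/\ (i, j, k) \in pivots, (j, i, k) \in pivots & F k \is a GRing.unit].
Proof.
move=> h.
have [h0|/npdvd_unit u0] := boolP (pd 1 (F 0%N)); last by exists 1%N, 2%N, 0%N; split; auto.
have [h1|/npdvd_unit u1] := boolP (pd 1 (F 1%N)); last by exists 0%N, 2%N, 1%N; split; auto.
have [h2|/npdvd_unit u2] := boolP (pd 1 (F 2%N)); last by exists 0%N, 1%N, 2%N; split; auto.
by case/negP: h; rewrite /dot !pdvdD // pdvdMr.
Qed.

Lemma pdvd_dot_unit n (x : O) : (0 < n)%N -> pd n (x - 1) -> ~~ pd 1 x.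
Proof.
move=> n0 /(pdvdW n0) h; apply/negP => /pdvdB/(_ h).
by rewrite (_ : _ - _ = 1) ?pdvd11 //; cring_over O.
Qed.

(** Gaussian elimination on three linear forms. A form may be changed by multiples of forms that
    vanish modulo a higher power, so the pivot k for p^a is chosen first. The vectors [Y1], [Y2],
    [Y3] witness surjectivity and guarantee a unit coefficient at each stage. *)
Lemma hform_exists a b c (F1 F2 F3 Y1 Y2 Y3 : nat -> O) : (c <= b <= a)%N ->
  pd a (dot F1 Y1 - 1) ->
  pd a (dot F1 Y2) -> pd b (dot F2 Y2 - 1) ->
  pd a (dot F1 Y3) -> pd b (dot F2 Y3) -> pd c (dot F3 Y3 - 1) ->
  exists w u, w \in pivots /\ forall y,
    [&& pd c (dot F3 y), pd b (dot F2 y) & pd a (dot F1 y)] = hform a b c w u y.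
Proof.
case/andP=> le_cb le_ba h11 h12 h22 h13 h23 h33.
have [a0|a0] := posnP a.
  exists (0, 1, 2)%N, (0, 0, 0); split => // y.
  move: le_ba le_cb; rewrite a0 leqn0 => /eqP -> /=; rewrite leqn0 => /eqP ->.
  by rewrite /= !pdvd0n.
have [i [j [k [w1 w2 uk]]]] := dot_unit (pdvd_dot_unit a0 h11).
pose G1 l := (F1 k)^-1 * F1 l.
have G1k : G1 k = 1 by rewrite /G1 mulVr.
have dG1 y : dot G1 y = (F1 k)^-1 * dot F1 y by rewrite /dot /G1; cring_over O.
have pG1 y : pd a (dot G1 y) = pd a (dot F1 y) by rewrite dG1 pdvd_unit // unitrV.
pose H2 l := F2 l - F2 k * G1 l.
have H2k : H2 k = 0 by rewrite /H2 G1k; cring_over O.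
have dH2 y : dot F2 y = F2 k * dot G1 y + dot H2 y by rewrite /dot /H2; cring_over O.
have pH2 y : pd a (dot F1 y) -> pd b (dot F2 y) = pd b (dot H2 y).
  by move=> h; rewrite dH2 pdvdDr // pdvdMl // (pdvdW le_ba) // pG1.
have [{w1 w2} i' [j' [G2 [w1 G2k G2j pG2]]]] : exists i j G2, [/\ (i, j, k) \in pivots,
    G2 k = 0, G2 j = 1 & forall y, pd b (dot H2 y) = pd b (dot G2 y)].
  have [b0|b0] := posnP b.
    exists i, j, (fun l => (l == j)%:R); rewrite eqxx b0; split => // [|y].
      by move: i j k w1 {w2 uk G1k H2k G1 dG1 pG1 H2 dH2 pH2}; apply: pivotsP.
    by rewrite !pdvd0n.
  have key i1 j1 : (i1, j1, k) \in pivots -> H2 j1 \is a GRing.unit ->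
      exists i j G2, [/\ (i, j, k) \in pivots,
      G2 k = 0, G2 j = 1 & forall y, pd b (dot H2 y) = pd b (dot G2 y)].
    move=> wk uj; exists i1, j1, (fun l => (H2 j1)^-1 * H2 l).
    rewrite H2k mulr0 mulVr //; split => // y.
    have -> : dot (fun l => (H2 j1)^-1 * H2 l) y = (H2 j1)^-1 * dot H2 y.
      by rewrite /dot; cring_over O.
    by rewrite pdvd_unit // unitrV.
  have [hj|/npdvd_unit] := boolP (pd 1 (H2 j)); last first.
    by move=> /(_ p_unif); apply: key w1.
  have [hi|/npdvd_unit] := boolP (pd 1 (H2 i)); last first.
    by move=> /(_ p_unif); apply: key w2.
  (* The first form vanishes on [Y2], so [H2] and [F2] agree there modulo p; that value is a unit,
     hence [H2] has a unit coefficient at i or j. *)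
  have : pd 1 (dot H2 Y2) by rewrite (dotE _ _ w1) H2k mul0r addr0 pdvdD // pdvdMr.
  rewrite (_ : dot H2 Y2 = dot F2 Y2 - F2 k * dot G1 Y2); last first.
    by rewrite dH2; cring_over O.
  rewrite addrC pdvdDr; first by move=> h; case/negP: (pdvd_dot_unit b0 h22).
  by rewrite pdvdN pdvdMl // (pdvdW a0) // pG1.
pose H3 := F3 i' - F3 k * G1 i' - (F3 j' - F3 k * G1 j') * G2 i'.
have dH3 y : dot F3 y = F3 k * dot G1 y + (F3 j' - F3 k * G1 j') * dot G2 y + H3 * y i'.
  by rewrite !(dotE _ _ w1) G1k G2k G2j /H3; cring_over O.
have pH3 y : pd a (dot F1 y) -> pd b (dot F2 y) -> pd c (dot F3 y) = pd c (y i').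
  move=> hy1; rewrite pH2 // pG2 => hy2.
  have hD x : pd c (dot F3 x) = pd c (H3 * x i') \/ ~~ pd a (dot F1 x) \/ ~~ pd b (dot G2 x).
    have [hx1|] := boolP (pd a (dot F1 x)); last by auto.
    have [hx2|] := boolP (pd b (dot G2 x)); last by auto.
    left; rewrite dH3 pdvdDr // pdvdD // pdvdMl //; last exact: pdvdW hx2.
    by apply: (pdvdW (leq_trans le_cb le_ba)); rewrite pG1.
  have [c0|c0] := posnP c; first by rewrite c0 !pdvd0n.
  have uH3 : H3 \is a GRing.unit.
    apply: (npdvd_unit p_unif); apply/negP => hH3.
    case/negP: (pdvd_dot_unit c0 h33).
    rewrite dH3 pdvdD //; last by rewrite pdvdMr.
    rewrite pdvdD // pdvdMl //.
      by rewrite (pdvdW a0) // pG1.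
    by apply: (pdvdW (leq_trans c0 le_cb)); rewrite -pG2 -pH2.
  case: (hD y) => [->|]; first by rewrite pdvd_unit.
  by rewrite hy1 hy2; case.
exists (i', j', k), (- G2 i', - G1 j', G1 j' * G2 i' - G1 i'); split => // y.
rewrite /hform.
have -> : y k - - G1 j' * (y j' - - G2 i' * y i') - (G1 j' * G2 i' - G1 i') * y i'
  = dot G1 y by rewrite (dotE _ _ w1) G1k; cring_over O.
have -> : y j' - - G2 i' * y i' = dot G2 y.
  by rewrite (dotE _ _ w1) G2k G2j; cring_over O.
rewrite pG1; have [hy1|] := boolP (pd a (dot F1 y)); last by rewrite !andbF.
rewrite -pG2 -pH2 // !andbT.
by have [hy2|] := boolP (pd b (dot F2 y)); [rewrite pH3 | rewrite !andbF].
Qed.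

(** If r is a unit, e_j + r e_k is r times e_k + r^-1 e_j, so k can serve as middle pivot and j as
    last one. *)
Lemma hform_swap_jk a b c i j k (s r t : O) y : (b <= a)%N -> r \is a GRing.unit ->
  hform a b c (i, j, k) (s, r, t) y = hform a b c (i, k, j) (t, r^-1, s) y.
Proof.
move=> le_ba ur; rewrite /hform; congr (_ && _).
set Z := y k - _ - _.
have -> : y j - r^-1 * (y k - t * y i) - s * y i = - r^-1 * Z.
  rewrite -[y j in LHS](mulKr ur) -[s in LHS](mulKr ur) /Z; cring_over O.
rewrite [in RHS]pdvd_unit ?unitrN ?unitrV //.
have [hZ|] := boolP (pd a Z); last by rewrite !andbF.
rewrite !andbT -(pdvd_unit p b (y j - s * y i) ur).
apply/esym; rewrite (_ : y k - _ = Z + r * (y j - s * y i)).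
  by rewrite pdvdDr // (pdvdW le_ba).
by rewrite /Z; cring_over O.
Qed.

(** When the last two moduli coincide, r matters modulo p^0 only, so it may become 0. *)
Lemma hform_exchange_jk b c i j k (s r t : O) y :
  hform b b c (i, j, k) (s, r, t) y = hform b b c (i, k, j) (t, 0, s) y.
Proof.
rewrite /hform mul0r subr0; congr (_ && _).
have [hY|] := boolP (pd b (y j - s * y i)); last by rewrite !andbF.
rewrite !andbT /=; rewrite (_ : y k - r * _ - _ = - (r * (y j - s * y i)) + (y k - t * y i)).
  by apply: pdvdDr; rewrite pdvdN pdvdMl.
by cring_over O.
Qed.

Lemma hform_swap_ij a b c i j k (s r t : O) y : (c <= b)%N -> s \is a GRing.unit ->
  hform a b c (i, j, k) (s, r, t) y
  = hform a b c (j, i, k) (s^-1, t - r * s, s^-1 * t) y.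
Proof.
move=> le_cb us; rewrite /hform.
have -> : y i - s^-1 * y j = - s^-1 * (y j - s * y i).
  by rewrite -[y i in LHS](mulKr us); cring_over O.
rewrite [X in _ = [&& _, X & _]]pdvd_unit ?unitrN ?unitrV //.
have [hY|] := boolP (pd b (y j - s * y i)); last by rewrite !andbF.
congr (_ && _).
  rewrite -(pdvd_unit p c (y i) us).
  rewrite -[in RHS](subrK (s * y i) (y j)) pdvdDr //.
  exact: pdvdW hY.
rewrite /=; congr (pd _ _).
have -> : y k - (t - r * s) * (- s^-1 * (y j - s * y i)) - s^-1 * t * y j
  = y k - r * ((s * s^-1) * (y j - s * y i)) - t * ((s * s^-1) * y i) by cring_over O.
by rewrite mulrV // !mul1r.
Qed.

Lemma hform_exchange_ij a b i j k (s r t : O) y :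
  hform a b b (i, j, k) (s, r, t) y = hform a b b (j, i, k) (0, t - r * s, r) y.
Proof.
rewrite /hform mul0r subr0 andbA [in RHS]andbA; congr (_ && _).
  have [hY|] := boolP (pd b (y i)); last by rewrite andbF.
  rewrite /= andbT; rewrite (_ : _ - _ = - (s * y i) + y j); last by cring_over O.
  by apply: pdvdDr; rewrite pdvdN pdvdMl.
by congr (pd _ _); cring_over O.
Qed.

(** Two units are needed: t makes k the first pivot, and t - r s, up to sign the coefficient of
    [y i] in the congruence modulo p^a, makes i the last. *)
Lemma hform_swap_ik a b c i j k (s r t : O) y : (c <= b <= a)%N ->
  t \is a GRing.unit -> t - r * s \is a GRing.unit ->
  hform a b c (i, j, k) (s, r, t) y
  = hform a b c (k, j, i) (s / t, - r / (t - r * s), t^-1) y.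
Proof.
move=> /andP[le_cb le_ba] ut uv; rewrite /hform.
set Z := y k - r * _ - _; set v := t - r * s in uv *.
have -> : y i - - r / v * (y j - s / t * y k) - t^-1 * y k = - v^-1 * Z.
  rewrite -[y i in LHS](mulKr uv).
  have -> : t^-1 * y k = v^-1 * ((t * t^-1) * y k) - v^-1 * (r * s * (t^-1 * y k)).
    rewrite mulrV // mul1r -mulrBr -[t^-1 * y k in LHS](mulKr uv); congr (_ * _).
    rewrite /v mulrBl; congr (_ - _).
    by rewrite mulrA mulrV // mul1r.
  rewrite mulrV // mul1r /Z /v; cring_over O.
rewrite [X in _ = [&& _, _ & X]]pdvd_unit ?unitrN ?unitrV //.
have [hZ|] := boolP (pd a Z); last by rewrite !andbF.
rewrite !andbT.
have -> : pd b (y j - s / t * y k) = pd b (y j - s * y i).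
  have -> : y j - s / t * y k = - (s / t * Z) + (1 - r * s / t) * (y j - s * y i)
      + s * y i * (1 - t * t^-1).
    by rewrite /Z; cring_over O.
  rewrite mulrV // subrr mulr0 addr0 [LHS]pdvdDr; last first.
    by rewrite pdvdN pdvdMl // (pdvdW le_ba).
  rewrite pdvd_unit // (_ : 1 - _ = v / t) ?unitrM ?uv ?unitrV //.
  by rewrite /v mulrBl mulrV.
have [hY|] := boolP (pd b (y j - s * y i)); last by rewrite !andbF.
rewrite !andbT -(pdvd_unit p c (y i) ut).
have -> : y k = (Z + r * (y j - s * y i)) + t * y i by rewrite /Z; cring_over O.
apply/esym/pdvdDr; rewrite pdvdD //; first exact: pdvdW (leq_trans le_cb le_ba) _.
by rewrite pdvdMl // (pdvdW le_cb).
Qed.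

Definition reduced (w : nat * nat * nat) (u : O * O * O) : bool :=
  let: (i, j, k) := w in let: (s, r, t) := u in
  [&& (j < i)%N ==> pd 1 s, (k < i)%N ==> pd 1 t & (k < j)%N ==> pd 1 r].

(* Each exchange of two pivots that is possible lowers the number of inversions
   of the pivot order. *)
Lemma hform_reduced a b c w u : (c <= b <= a)%N -> w \in pivots ->
  exists w' u', [/\ w' \in pivots, admissible (b - c) (a - b) w', reduced w' u'
    & forall y, hform a b c w u y = hform a b c w' u' y].
Proof.
move=> cba; have /andP[le_cb le_ba] := cba.
pose inv (w : nat * nat * nat) :=
  ((w.1.2 < w.1.1) + (w.2 < w.1.1) + (w.2 < w.1.2))%N.
have [n] := ubnP (inv w); elim: n w u => // n IH [[i j] k] [[s r] t] le_n w_in.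
have step w' u' : w' \in pivots -> (inv w' < inv (i, j, k))%N ->
    (forall y, hform a b c (i, j, k) (s, r, t) y = hform a b c w' u' y) ->
  exists w' u', [/\ w' \in pivots, admissible (b - c) (a - b) w', reduced w' u'
    & forall y, hform a b c (i, j, k) (s, r, t) y = hform a b c w' u' y].
  move=> w'in lt_inv hw'.
  have [|//|w2 [u2 [h1 h2 h3 h4]]] := IH w' u'; first exact: leq_trans lt_inv _.
  by exists w2, u2; split => // y; rewrite hw'.
have mem_jk : (i, k, j) \in pivots by move: i j k {le_n step} w_in; apply: pivotsP.
have mem_ij : (j, i, k) \in pivots by move: i j k {le_n step mem_jk} w_in; apply: pivotsP.
have mem_ik : (k, j, i) \in pivots.
  by move: i j k {le_n step mem_jk mem_ij} w_in; apply: pivotsP.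
have inv_jk : (k < j)%N -> (inv (i, k, j) < inv (i, j, k))%N.
  by rewrite /inv /=; lia.
have inv_ij : (j < i)%N -> (inv (j, i, k) < inv (i, j, k))%N.
  by rewrite /inv /=; lia.
have inv_ik : (k < i)%N -> (inv (k, j, i) < inv (i, j, k))%N.
  by rewrite /inv /=; lia.
have [/andP[kj D0]|hD] := boolP ((k < j) && (a - b == 0))%N.
  apply: (step (i, k, j) (t, 0, s)) => // [|y]; first exact: inv_jk.
  have -> : a = b by lia.
  exact: hform_exchange_jk.
have [/andP[ji B0]|hB] := boolP ((j < i) && (b - c == 0))%N.
  apply: (step (j, i, k) (0, t - r * s, r)) => // [|y]; first exact: inv_ij.
  have -> : c = b by lia.
  exact: hform_exchange_ij.
have [/andP[kj ur]|hr] := boolP ((k < j)%N && ~~ pd 1 r).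
  apply: (step (i, k, j) (t, r^-1, s)) => // [|y]; first exact: inv_jk.
  by apply: hform_swap_jk => //; apply: npdvd_unit ur.
have [/andP[ji us]|hs] := boolP ((j < i)%N && ~~ pd 1 s).
  apply: (step (j, i, k) (s^-1, t - r * s, s^-1 * t)) => // [|y]; first exact: inv_ij.
  by apply: hform_swap_ij => //; apply: npdvd_unit us.
have [/andP[ki ut]|ht] := boolP ((k < i)%N && ~~ pd 1 t).
  apply: (step (k, j, i) (s / t, - r / (t - r * s), t^-1)) => // [|y]; first exact: inv_ik.
  apply: hform_swap_ik => //; first exact: npdvd_unit ut.
  (* One of r, s is already known to be a nonunit: r if k < j, and otherwise s, because then j < i.
     So t - r s is a unit along with t. *)
  apply: (npdvd_unit p_unif); apply: contra ut => h.
  rewrite -[t](subrK (r * s)) pdvdD // pdvd1M //.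
  have [kj|jk] := ltnP k j; first by move: hr; rewrite kj /= negbK => ->.
  have ji : (j < i)%N by apply: leq_ltn_trans ki.
  by move: hs; rewrite ji /= negbK => ->; rewrite orbT.
exists (i, j, k), (s, r, t); split => //; rewrite /admissible /reduced.
  move: hD hB; rewrite !negb_and -!leqNgt -!lt0n.
  by have [] := pivots_neq w_in; lia.
by move: hr hs ht; rewrite !negb_and !negbK !implybE => -> -> ->.
Qed.

End HermiteForms.

(** * Reduction of the parameters to representatives *)

Section HermiteReduction.
Variables (O : idomainType) (p : O) (q : nat) (digits : seq O).
Hypotheses (p0 : p != 0) (p_unif : is_uniformizer p).
Hypotheses (size_digits : size digits = q)
  (digitsP : forall a, \sum_(d <- digits) (pdvd p 1 (d - a))%:R = 1%R :> int).

Local Notation pd := (pdvd p).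
Local Notation reps := (reps p digits).
Local Notation hform := (hform p).
Add Ring ring6 : (@cring_theory O) (power_tac (@cpower_theory O) [nat_literal]).

Lemma hform_reps a b c w u : (c <= b <= a)%N -> w \in pivots ->
  admissible (b - c) (a - b) w -> reduced p w u ->
  exists s r t, [/\ [&& s \in reps (b - c), r \in reps (a - b) & t \in reps (a - c)],
    reduced p w (s, r, t)
    & forall y, hform a b c w u y = hform a b c w (s, r, t) y].
Proof.
move: w u => [[i j] k] [[s r] t] /andP[le_cb le_ba] w_in adm /and3P[cs ct cr].
have le_ca := leq_trans le_cb le_ba.
have [s' s'in ss] := sum_reps_mem p0 size_digits digitsP (b - c) s.
have [r' r'in rr] := sum_reps_mem p0 size_digits digitsP (a - b) r.
case/pdvdP: (ss) => d hd; case/pdvdP: (rr) => e he.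
(* Passing from s to s + d p^(b - c) adds d p^b e_j to the first basis vector; adding d times the
   second basis vector instead also shifts t by r d p^(b - c). *)
have [t' t'in tt] := sum_reps_mem p0 size_digits digitsP (a - c) (t + r * d * p ^+ (b - c)).
case/pdvdP: (tt) => f hf.
exists s', r', t'; rewrite s'in r'in t'in; split => // [|y].
  have [_ jk] := pivots_neq w_in; have [ij _] := pivots_neq w_in.
  move: adm; rewrite /admissible => /andP[aD aB].
  have red n (x x' : O) : (0 < n)%N -> pd n (x' - x) -> pd 1 x -> pd 1 x'.
    by move=> n0 /(pdvdW n0) h hx; rewrite -[x'](subrK x) pdvdD.
  apply/and3P; split; apply/implyP => h.
  - apply: (red (b - c)%N s) => //; last exact: (implyP cs).
    by move: aB h; lia.
  - apply: (red (a - c)%N (t + r * d * p ^+ (b - c))) => //; first by lia.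
    rewrite pdvdD //; first exact: (implyP ct).
    have [b0|b0] := posnP (b - c)%N; last first.
      by rewrite pdvdMl // -[p ^+ _]mul1r (pdvdW b0) // pdvd_exp.
    (* For b = c the factor p^(b - c) does not help. Admissibility then gives i < j, so k < j and r
       is a nonunit. *)
    have kj : (k < j)%N by move: aB h; rewrite b0; lia.
    by rewrite -mulrA pdvdMr //; apply: (implyP cr).
  - apply: (red (a - b)%N r) => //; last exact: (implyP cr).
    by move: aD h; lia.
rewrite /hform.
have [/pdvdP[X hX]|//] := boolP (pd c (y i)).
have eY : pd b (y j - s * y i) = pd b (y j - s' * y i).
  apply: pdvd_congr.
  have -> : y j - s * y i - (y j - s' * y i) = (s' - s) * y i by cring_over O.
  rewrite hd hX mulrCA -mulrA -exprD addnC subnKC // mulrA; exact: pdvd_exp.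
rewrite /= eY; have [/pdvdP[V hV]|//] := boolP (pd b (y j - s' * y i)).
rewrite /=; apply: pdvd_congr.
have -> : y k - r * (y j - s * y i) - t * y i - (y k - r' * (y j - s' * y i) - t' * y i)
  = (r' - r) * (y j - s' * y i) + (t' - (t + r * (s' - s))) * y i.
  by cring_over O.
rewrite hV he [r * _]mulrC hd.
have -> : t' - (t + d * p ^+ (b - c) * r) = f * p ^+ (a - c).
  by rewrite -hf; cring_over O.
rewrite hX pdvdD //.
  rewrite mulrCA -mulrA -exprD addnC subnKC // mulrA; exact: pdvd_exp.
rewrite mulrCA -mulrA -exprD addnC subnKC // mulrA; exact: pdvd_exp.
Qed.

End HermiteReduction.

(** * Lattices of O^4 in Hermite form and their multiplicative closure *)

Section Lattices.
Variables (O : idomainType) (p : O).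
Hypothesis p0 : p != 0.
Local Notation pd := (pdvd p).
Local Notation hform := (hform p).
Add Ring ring7 : (@cring_theory O) (power_tac (@cpower_theory O) [nat_literal]).

(* Subtracting the last coordinate identifies O^4 / O with O^3. *)
Definition dcoord (x : pow4 O) (l : nat) : O :=
  match l with
  | 0 => x.1.1.1 - x.2
  | 1 => x.1.1.2 - x.2
  | _ => x.1.2 - x.2
  end.

Definition hermite a b c w u : {pred pow4 O} := fun x => hform a b c w u (dcoord x).

Definition vec (w : nat * nat * nat) (y1 y2 y3 : O) : pow4 O :=
  let: (i, j, k) := w in
  let f l := if l == i then y1 else if l == j then y2 else y3 in
  (f 0%N, f 1%N, f 2%N, 0).

Lemma dcoord_lin (e : O) x y l : dcoord (e *: x + y) l = e * dcoord x l + dcoord y l.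
Proof.
case: l => [|[|l]].
- rewrite -[LHS]/(e * x.1.1.1 + y.1.1.1 - (e * x.2 + y.2)) /=; cring_over O.
- rewrite -[LHS]/(e * x.1.1.2 + y.1.1.2 - (e * x.2 + y.2)) /=; cring_over O.
- rewrite -[LHS]/(e * x.1.2 + y.1.2 - (e * x.2 + y.2)) /=; cring_over O.
Qed.

Lemma dcoord0 l : dcoord 0 l = 0.
Proof. by case: l => [|[|l]] /=; rewrite subr0. Qed.

Lemma dcoord1 l : dcoord 1 l = 0.
Proof. by case: l => [|[|l]] /=; rewrite subrr. Qed.

Lemma dcoordM x y l :
  dcoord (x * y) l = dcoord x l * dcoord y l + (x.2 * dcoord y l + y.2 * dcoord x l).
Proof.
case: l => [|[|l]].
- rewrite -[LHS]/(x.1.1.1 * y.1.1.1 - x.2 * y.2) /=; cring_over O.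
- rewrite -[LHS]/(x.1.1.2 * y.1.1.2 - x.2 * y.2) /=; cring_over O.
- rewrite -[LHS]/(x.1.2 * y.1.2 - x.2 * y.2) /=; cring_over O.
Qed.

Lemma dcoord_vec i j k y1 y2 y3 : (i, j, k) \in pivots ->
  [/\ dcoord (vec (i, j, k) y1 y2 y3) i = y1, dcoord (vec (i, j, k) y1 y2 y3) j = y2
    & dcoord (vec (i, j, k) y1 y2 y3) k = y3].
Proof. by move: i j k; apply: pivotsP; rewrite /= !subr0. Qed.

Lemma hermiteP a b c i j k s r t x :
  reflect (exists X1 X2 X3, [/\ dcoord x i = X1 * p ^+ c,
      dcoord x j = s * (X1 * p ^+ c) + X2 * p ^+ b
    & dcoord x k = t * (X1 * p ^+ c) + r * (X2 * p ^+ b) + X3 * p ^+ a])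
  (hermite a b c (i, j, k) (s, r, t) x).
Proof.
apply: (iffP and3P) => [[/pdvdP[X1 h1] /pdvdP[X2 h2] /pdvdP[X3 h3]]|].
  exists X1, X2, X3; split=> //; first by rewrite -h1 -h2; cring_over O.
  by rewrite -h1 -h2 -h3; cring_over O.
move=> [X1 [X2 [X3 [h1 h2 h3]]]]; split; apply/pdvdP; [exists X1|exists X2|exists X3];
  rewrite ?h3 ?h2 ?h1 //; cring_over O.
Qed.

Lemma hermite_submod a b c w u : submod_closed (hermite a b c w u).
Proof.
move: w u => [[i j] k] [[s r] t]; split.
  rewrite unfold_in /hermite /hform !dcoord0 !mulr0 !subr0 !mulr0 !subr0 !pdvd0 //.
move=> e x y; rewrite !unfold_in => /hermiteP[X1 [X2 [X3 [h1 h2 h3]]]].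
move=> /hermiteP[Y1 [Y2 [Y3 [g1 g2 g3]]]]; apply/hermiteP.
exists (e * X1 + Y1), (e * X2 + Y2), (e * X3 + Y3).
by rewrite !dcoord_lin h1 h2 h3 g1 g2 g3; split; cring_over O.
Qed.

Lemma hermite_vec a b c i j k s r t X1 X2 X3 : (i, j, k) \in pivots ->
  hermite a b c (i, j, k) (s, r, t)
   (vec (i, j, k) (X1 * p ^+ c) (s * (X1 * p ^+ c) + X2 * p ^+ b)
     (t * (X1 * p ^+ c) + r * (X2 * p ^+ b) + X3 * p ^+ a)).
Proof.
by move=> w_in; apply/hermiteP; exists X1, X2, X3; apply: dcoord_vec.
Qed.

(** Multiples of p^a e_k lie in the lattice, so the coordinates X3 and Y3 drop out and only products
    of the first two basis vectors have to be tested. *)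
Lemma hermite_subalg a b c i j k s r t : (c <= b <= a)%N -> (i, j, k) \in pivots ->
  GRing.subalg_closed (hermite a b c (i, j, k) (s, r, t)) <->
  closed_triple p (b - c) (a - b) c s r t.
Proof.
move=> /andP[le_cb le_ba] w_in.
have le_ca := leq_trans le_cb le_ba.
set L := hermite _ _ _ _ _.
(* Modulo the lattice, x * y may be replaced by a vector whose coordinates are
   the products of those of x and y. *)
have key x y X1 X2 X3 Y1 Y2 Y3 :
   dcoord x i = X1 * p ^+ c ->
   dcoord x j = s * (X1 * p ^+ c) + X2 * p ^+ b ->
   dcoord x k = t * (X1 * p ^+ c) + r * (X2 * p ^+ b) + X3 * p ^+ a ->
   dcoord y i = Y1 * p ^+ c ->
   dcoord y j = s * (Y1 * p ^+ c) + Y2 * p ^+ b ->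
   dcoord y k = t * (Y1 * p ^+ c) + r * (Y2 * p ^+ b) + Y3 * p ^+ a ->
   L x -> L y -> L (x * y) =
   pd b (X1 * Y1 * (p ^+ c * p ^+ c) * (s ^+ 2 - s)) &&
   pd a (X1 * Y1 * (p ^+ c * p ^+ c) * (t ^+ 2 - t - r * (s ^+ 2 - s))
         + (X1 * Y2 + X2 * Y1) * (p ^+ c * p ^+ b) * (r * (t - s))
         + X2 * Y2 * (p ^+ b * p ^+ b) * (r ^+ 2 - r)).
  move=> h1 h2 h3 g1 g2 g3 Lx Ly.
  pose z := (x * y - (x.2 *: y + (y.2 *: x + 0))).
  have cz l : dcoord z l = dcoord x l * dcoord y l.
    rewrite /z -[x * y - _]addrC -scaleN1r dcoord_lin dcoordM !dcoord_lin dcoord0.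
    by cring_over O.
  have -> : L (x * y) = L z.
    have [L0 Llin] := hermite_submod a b c (i, j, k) (s, r, t).
    have Lxy : x.2 *: y + (y.2 *: x + 0) \in L by apply: (Llin) => //; apply: (Llin).
    rewrite -[L (x * y)]/(x * y \in L) -[L z]/(z \in L).
    apply/idP/idP => h.
      by rewrite /z addrC -scaleN1r; apply: (Llin).
    by rewrite -[x * y](subrK (x.2 *: y + (y.2 *: x + 0))) -[x * y - _]scale1r; apply: (Llin).
  rewrite /L /hermite /hform !cz h1 h2 h3 g1 g2 g3.
  rewrite (_ : pd c _); last by rewrite mulrA pdvd_exp.
  rewrite /=; congr (_ && _).
    rewrite (_ : _ - _ = (s * X1 * p ^+ c * Y2 + X2 * (s * Y1 * p ^+ c) + X2 * Y2 * p ^+ b) * p ^+ b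
      + X1 * Y1 * (p ^+ c * p ^+ c) * (s ^+ 2 - s)); last by cring_over O.
    by rewrite pdvdDr // pdvd_exp.
  rewrite (_ : _ - _ - _ = (X3 * (t * (Y1 * p ^+ c) + r * (Y2 * p ^+ b) + Y3 * p ^+ a)
      + Y3 * (t * (X1 * p ^+ c) + r * (X2 * p ^+ b))) * p ^+ a
      + (X1 * Y1 * (p ^+ c * p ^+ c) * (t ^+ 2 - t - r * (s ^+ 2 - s))
         + (X1 * Y2 + X2 * Y1) * (p ^+ c * p ^+ b) * (r * (t - s))
         + X2 * Y2 * (p ^+ b * p ^+ b) * (r ^+ 2 - r))); last by cring_over O.
  by rewrite pdvdDr // pdvd_exp.
have tripleE : closed_triple p (b - c) (a - b) c s r t =
  [&& pd b (p ^+ c * p ^+ c * (s ^+ 2 - s)),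
      pd a (p ^+ c * p ^+ c * (t ^+ 2 - t - r * (s ^+ 2 - s))),
      pd a (p ^+ c * p ^+ b * (r * (t - s)))
    & pd a (p ^+ b * p ^+ b * (r ^+ 2 - r))].
  rewrite /closed_triple -!exprD !pdvd_sub //.
  by congr [&& _, _, _ & _]; congr (pdvd p _ _); lia.
rewrite tripleE; split=> [[_ _ hM]|/and4P[e1 e2 e3 e4]]; last first.
  have [_ Llin] := hermite_submod a b c (i, j, k) (s, r, t).
  split=> //.
    by rewrite unfold_in /L /hermite /hform !dcoord1 !(mulr0, subr0) !pdvd0.
  move=> x y Lx Ly; rewrite -[_ \in L]/(L (x * y)).
  have /hermiteP[X1 [X2 [X3 [h1 h2 h3]]]] := Lx.
  have /hermiteP[Y1 [Y2 [Y3 [g1 g2 g3]]]] := Ly.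
  rewrite (key _ _ _ _ _ _ _ _ h1 h2 h3 g1 g2 g3 Lx Ly).
  apply/andP; split; first by rewrite -mulrA pdvdMl.
  by rewrite !pdvdD // -mulrA pdvdMl.
have prod X1 X2 Y1 Y2 :
   pd b (X1 * Y1 * (p ^+ c * p ^+ c) * (s ^+ 2 - s)) &&
   pd a (X1 * Y1 * (p ^+ c * p ^+ c) * (t ^+ 2 - t - r * (s ^+ 2 - s))
         + (X1 * Y2 + X2 * Y1) * (p ^+ c * p ^+ b) * (r * (t - s))
         + X2 * Y2 * (p ^+ b * p ^+ b) * (r ^+ 2 - r)).
  have Lx := hermite_vec a b c s r t X1 X2 0 w_in.
  have Ly := hermite_vec a b c s r t Y1 Y2 0 w_in.
  have := hM _ _ Lx Ly; set x := vec _ _ _ _ in Lx *; set y := vec _ _ _ _ in Ly *.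
  rewrite -[_ \in L]/(L (x * y)).
  have [x1 x2 x3] := dcoord_vec (X1 * p ^+ c) (s * (X1 * p ^+ c) + X2 * p ^+ b)
     (t * (X1 * p ^+ c) + r * (X2 * p ^+ b) + 0 * p ^+ a) w_in.
  have [y1 y2 y3] := dcoord_vec (Y1 * p ^+ c) (s * (Y1 * p ^+ c) + Y2 * p ^+ b)
     (t * (Y1 * p ^+ c) + r * (Y2 * p ^+ b) + 0 * p ^+ a) w_in.
  by rewrite (key x y _ _ _ _ _ _ x1 x2 x3 y1 y2 y3 Lx Ly).
(* The square of the first basis vector gives two congruences; the mixed product and the square of
   the second give one each. *)
have /andP[e1 e2] := prod 1 0 1 0.
have /andP[_ e3] := prod 1 0 0 1.
have /andP[_ e4] := prod 0 1 0 1.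
move: e1 e2 e3 e4; rewrite !(mulr0, mul0r, mulr1, mul1r, addr0, add0r).
by move=> -> -> -> ->.
Qed.

End Lattices.

(** * Cotype and Hermite form *)

Section Cotype.
Variables (O : idomainType) (p : O) (q : nat) (digits : seq O).
Hypotheses (p0 : p != 0) (p_unif : is_uniformizer p).
Hypotheses (size_digits : size digits = q)
  (digitsP : forall a, \sum_(d <- digits) (pdvd p 1 (d - a))%:R = 1%R :> int).

Local Notation pd := (pdvd p).
Local Notation reps := (reps p digits).
Local Notation hform := (hform p).
Local Notation hermite := (hermite p).
Add Ring ring8 : (@cring_theory O) (power_tac (@cpower_theory O) [nat_literal]).

Lemma quotmod_pi_lin (V : lmodType O) (S : {pred V}) (h : submod_closed S) e x y :
  quotmod_pi h (e *: x + y) = e *: quotmod_pi h x + quotmod_pi h y.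
Proof. by rewrite quotmod_piD -quotmod_piZ. Qed.

Lemma quotmod_pi0 (V : lmodType O) (S : {pred V}) (h : submod_closed S) :
  quotmod_pi h 0 = 0.
Proof. by apply: (addrI (quotmod_pi h 0)); rewrite -quotmod_piD !addr0. Qed.

Lemma quot_powP n (x y : O) :
  quotmod_pi (principal_submod (p ^+ n)) x = quotmod_pi (principal_submod (p ^+ n)) y
  <-> pd n (x - y).
Proof. exact: quotmod_piP. Qed.

Lemma finite_quot_pow n : finite_set [set: quot_pow p n].
Proof.
suff -> : [set: quot_pow p n] =
    [set` [seq quotmod_pi (principal_submod (p ^+ n)) x | x <- reps n]]%classic.
  exact: finite_seq.
apply/seteqP; split => // z _ /=.
have [x xin hx] := sum_reps_mem p0 size_digits digitsP n (repr z).
apply/mapP; exists x => //.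
by rewrite -[z](quotmod_reprK (S_submod := principal_submod (p ^+ n))) quot_powP pdvd_sym.
Qed.

Lemma finite_of_cotype (L : {pred pow4 O}) (hL : submod_closed L) a b c :
  has_cotype p hL a b c -> finite_set [set: quotmod hL].
Proof.
case=> f [g fK gK].
have -> : [set: quotmod hL] = (g @` [set: _])%classic.
  by apply/seteqP; split => // z _; exists (f z) => //; rewrite fK.
apply: finite_image.
have -> : [set: (quot_pow p a * quot_pow p b * quot_pow p c)%type] =
  (([set: quot_pow p a] `*` [set: quot_pow p b]) `*` [set: quot_pow p c])%classic.
  by apply/seteqP; split.
by do 2?[apply: finite_setX]; apply: finite_quot_pow.
Qed.

(** The lattice is the common kernel of its three defining forms, read modulo p^c, p^b and p^a. The
    forms are triangular with diagonal 1, so [vec] solves for any prescribed values. *)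
Lemma hermite_cotype a b c w u (hL : submod_closed (hermite a b c w u)) :
  w \in pivots -> has_cotype p hL a b c.
Proof.
move: w u hL => [[i j] k] [[s r] t] hL w_in.
pose E1 (x : pow4 O) := dcoord x i.
pose E2 (x : pow4 O) := dcoord x j - s * dcoord x i.
pose E3 (x : pow4 O) := dcoord x k - r * (dcoord x j - s * dcoord x i) - t * dcoord x i.
pose pi n (x : O) : quot_pow p n := quotmod_pi (principal_submod (p ^+ n)) x.
pose F (x : pow4 O) := (pi a (E3 x), pi b (E2 x), pi c (E1 x)).
pose f (z : quotmod hL) := F (repr z).
have LE x : (x \in hermite a b c (i, j, k) (s, r, t))
  = [&& pd c (E1 x), pd b (E2 x) & pd a (E3 x)] by [].
have FP (x y : pow4 O) : F x = F y <-> quotmod_pi hL x = quotmod_pi hL y.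
  rewrite quotmod_piP LE.
  have eB l : dcoord (x - y) l = dcoord x l - dcoord y l.
    by rewrite addrC -scaleN1r dcoord_lin; cring_over O.
  have -> : E1 (x - y) = E1 x - E1 y by exact: eB.
  have -> : E2 (x - y) = E2 x - E2 y by rewrite /E2 !eB; cring_over O.
  have -> : E3 (x - y) = E3 x - E3 y by rewrite /E3 !eB; cring_over O.
  split=> [[/quot_powP h3 /quot_powP h2 /quot_powP h1]|/and3P[h1 h2 h3]].
    exact/and3P.
  by congr (_, _, _); apply/quot_powP.
have fpi x : f (quotmod_pi hL x) = F x.
  by apply/FP; rewrite quotmod_reprK.
have flin : linear f.
  move=> e z1 z2; rewrite -[z1]quotmod_reprK -[z2]quotmod_reprK -quotmod_pi_lin !fpi.
  set x := repr _; set y := repr _.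
  rewrite /F.
  have -> : E1 (e *: x + y) = e * E1 x + E1 y by exact: dcoord_lin.
  have -> : E2 (e *: x + y) = e * E2 x + E2 y by rewrite /E2 !dcoord_lin; cring_over O.
  have -> : E3 (e *: x + y) = e * E3 x + E3 y by rewrite /E3 !dcoord_lin; cring_over O.
  rewrite /pi !(quotmod_pi_lin (V := O^o)) //.
pose f' : {linear quotmod hL -> (quot_pow p a * quot_pow p b * quot_pow p c)%type} :=
  HB.pack f (GRing.isLinear.Build _ _ _ _ f flin).
exists f'.
pose g (y : quot_pow p a * quot_pow p b * quot_pow p c) : quotmod hL :=
  let y1 : O := repr y.2 in let y2 : O := repr y.1.2 in let y3 : O := repr y.1.1 in
  quotmod_pi hL (vec (i, j, k) y1 (s * y1 + y2) (t * y1 + r * y2 + y3)).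
have gK : cancel g f.
  move=> [[z3 z2] z1]; rewrite /g fpi /F /E1 /E2 /E3 /=.
  set y1 : O := repr z1; set y2 : O := repr z2; set y3 : O := repr z3.
  have [-> -> ->] := dcoord_vec y1 (s * y1 + y2) (t * y1 + r * y2 + y3) w_in.
  have -> : s * y1 + y2 - s * y1 = y2 by cring_over O.
  have -> : t * y1 + r * y2 + y3 - r * y2 - t * y1 = y3 by cring_over O.
  by rewrite /pi !quotmod_reprK.
exists g => // z; rewrite -[z]quotmod_reprK -[RHS]quotmod_reprK; apply/FP.
by rewrite -fpi quotmod_reprK gK.
Qed.

Lemma pow4_eq (x y : pow4 O) : x.1.1.1 = y.1.1.1 -> x.1.1.2 = y.1.1.2 ->
  x.1.2 = y.1.2 -> x.2 = y.2 -> x = y.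
Proof.
by move: x y => [[[x0 x1] x2] x3] [[[y0 y1] y2] y3] /= -> -> -> ->.
Qed.

Definition unit_vec (l : nat) : pow4 O :=
  ((l == 0%N)%:R, (l == 1%N)%:R, (l == 2%N)%:R, 0).

Lemma pow4_decomp (x : pow4 O) :
  x = x.2 *: 1 + (dcoord x 0 *: unit_vec 0 + (dcoord x 1 *: unit_vec 1 +
        (dcoord x 2 *: unit_vec 2 + 0))).
Proof.
apply: pow4_eq.
- rewrite -[RHS]/(x.2 * 1 + (dcoord x 0 * 1 + (dcoord x 1 * 0 + (dcoord x 2 * 0 + 0)))).
  by rewrite /dcoord; cring_over O.
- rewrite -[RHS]/(x.2 * 1 + (dcoord x 0 * 0 + (dcoord x 1 * 1 + (dcoord x 2 * 0 + 0)))).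
  by rewrite /dcoord; cring_over O.
- rewrite -[RHS]/(x.2 * 1 + (dcoord x 0 * 0 + (dcoord x 1 * 0 + (dcoord x 2 * 1 + 0)))).
  by rewrite /dcoord; cring_over O.
rewrite -[RHS]/(x.2 * 1 + (dcoord x 0 * 0 + (dcoord x 1 * 0 + (dcoord x 2 * 0 + 0)))).
by rewrite /dcoord; cring_over O.
Qed.

(** The projection to the quotient kills 1, so it is given by three linear forms in [dcoord x],
    lifted to O by representatives. Preimages of the three generators are the vectors that
    [hform_exists] needs. *)
Lemma cotype_hermite (L : {pred pow4 O}) (hL : submod_closed L) a b c :
  (c <= b <= a)%N -> 1 \in L -> has_cotype p hL a b c ->
  exists w u, w \in pivots /\ L = hermite a b c w u.
Proof.
move=> cba L1 [f [g fK gK]].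
pose ph x := f (quotmod_pi hL x).
have ph_lin e x y : ph (e *: x + y) = e *: ph x + ph y.
  by rewrite /ph quotmod_pi_lin linearP.
have ph_eq0 x : ph x = 0 <-> x \in L.
  have pi0 := quotmod_pi0 hL.
  split=> [h|h]; last first.
    by rewrite /ph (_ : quotmod_pi hL x = 0) ?linear0 // -pi0; apply/quotmod_piP; rewrite subr0.
  rewrite -[x]subr0; apply/(quotmod_piP hL); rewrite pi0.
  by apply: (can_inj fK); rewrite linear0.
pose F1 l : O := repr (ph (unit_vec l)).1.1.
pose F2 l : O := repr (ph (unit_vec l)).1.2.
pose F3 l : O := repr (ph (unit_vec l)).2.
pose pi n (x : O) : quot_pow p n := quotmod_pi (principal_submod (p ^+ n)) x.
have pi_lin n (e x y : O) : pi n (e * x + y) = e *: pi n x + pi n y.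
  exact: (quotmod_pi_lin (V := O^o)).
have phE x : ph x = (pi a (dot F1 (dcoord x)), pi b (dot F2 (dcoord x)),
    pi c (dot F3 (dcoord x))).
  rewrite [in LHS](pow4_decomp x) !ph_lin (_ : ph 1 = 0); last exact/ph_eq0.
  rewrite scaler0 add0r (_ : ph 0 = 0); last by rewrite /ph quotmod_pi0 linear0.
  have dotE3 F : dot F (dcoord x) = dcoord x 0 * F 0%N + (dcoord x 1 * F 1%N +
      (dcoord x 2 * F 2%N + 0)) by rewrite /dot; cring_over O.
  by rewrite !dotE3 !pi_lin /pi !quotmod_pi0 /F1 /F2 /F3 !quotmod_reprK.
have surj (z : quot_pow p a * quot_pow p b * quot_pow p c) : exists x, ph x = z.
  by exists (repr (g z)); rewrite /ph quotmod_reprK gK.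
have [y1 hy1] := surj (pi a 1, 0, 0).
have [y2 hy2] := surj (0, pi b 1, 0).
have [y3 hy3] := surj (0, 0, pi c 1).
have pi_eq n (x y : O) : pi n x = pi n y -> pd n (x - y) by move/quot_powP.
have pi_eq0 n (x : O) : pi n x = 0 <-> pd n x.
  rewrite -(quotmod_pi0 (principal_submod (p ^+ n))).
  by rewrite -[x in pd n x]subr0; apply: quot_powP.
move: hy1 hy2 hy3; rewrite !phE.
move=> [/pi_eq h11 _ _] [/pi_eq0 h12 /pi_eq h22 _] [/pi_eq0 h13 /pi_eq0 h23 /pi_eq h33].
have [w [u [w_in hw]]] := hform_exists p_unif cba h11 h12 h22 h13 h23 h33.
exists w, u; split => //; apply/funext => x.
rewrite /hermite -hw -[LHS]/(x \in L).
apply/idP/and3P => [/ph_eq0|[h1 h2 h3]].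
  by rewrite phE => -[/pi_eq0 h1 /pi_eq0 h2 /pi_eq0 h3].
by apply/ph_eq0; rewrite phE; congr (_, _, _); apply/pi_eq0.
Qed.

End Cotype.

(** * Subalgebras and their reduced parameters *)

Section Enumeration.
Variables (O : idomainType) (p : O) (q : nat) (digits : seq O).
Hypotheses (p0 : p != 0) (p_unif : is_uniformizer p).
Hypotheses (size_digits : size digits = q)
  (digitsP : forall a, \sum_(d <- digits) (pdvd p 1 (d - a))%:R = 1%R :> int).

Local Notation pd := (pdvd p).
Local Notation reps := (reps p digits).
Local Notation hermite := (hermite p).
Add Ring ring9 : (@cring_theory O) (power_tac (@cpower_theory O) [nat_literal]).

(* The first and last pivots are read off the lattice itself, whence the
   uniqueness of the pivot order. *)
Lemma first_pivot a b c i j k (s r t : O) : (c <= b <= a)%N -> (0 < b - c)%N ->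
  (i, j, k) \in pivots -> reduced p (i, j, k) (s, r, t) ->
  forall l, (l <= i)%N ->
  (l == i) = `[< exists2 x, hermite a b c (i, j, k) (s, r, t) x & ~~ pd c.+1 (dcoord x l) >].
Proof.
move=> /andP[le_cb le_ba] B0 w_in /and3P[cs ct cr] l le_li.
apply/eqP/asboolP => [->|[x /hermiteP[X1 [X2 [X3 [h1 h2 h3]]]] hx]].
  exists (vec (i, j, k) (1 * p ^+ c) (s * (1 * p ^+ c) + 0 * p ^+ b)
    (t * (1 * p ^+ c) + r * (0 * p ^+ b) + 0 * p ^+ a)).
    exact: hermite_vec.
  have [-> _ _] := dcoord_vec (1 * p ^+ c) (s * (1 * p ^+ c) + 0 * p ^+ b)
    (t * (1 * p ^+ c) + r * (0 * p ^+ b) + 0 * p ^+ a) w_in.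
  by rewrite mul1r -[p ^+ c]mulr1 pdvd_sub // subSnn pdvd11.
apply/eqP; apply: contraNT hx => nli.
have lt_li : (l < i)%N by rewrite ltn_neqAle nli.
have lt_cb : (c < b)%N by lia.
have ppd n y : (c < n)%N -> pd c.+1 (y * p ^+ n).
  by move=> h; apply: (pdvdW h); apply: pdvd_exp.
have p1c (y z : O) : pd 1 y -> pd c.+1 (y * (z * p ^+ c)).
  by move=> /pdvdP[v ->]; apply/pdvdP; exists (v * z); rewrite expr1 (exprS p c); cring_over O.
have [lj|lk] : l = j \/ l = k.
  move: lt_li {le_li nli h1 h2 h3 cs ct cr}.
  by move: i j k w_in l; apply: pivotsP => -[|[|[|l]]] //=; auto.
- rewrite lj h2 pdvdD ?ppd // p1c //; apply: (implyP cs); by rewrite -lj.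
- rewrite lk h3 !pdvdD ?ppd //; last exact: leq_trans lt_cb le_ba.
    by apply: p1c; apply: (implyP ct); rewrite -lk.
  by rewrite pdvdMl // ppd.
Qed.

(** So k is the largest coordinate l with p^(a - 1) e_l outside the lattice: for l > k reducedness
    makes the coefficient at l in the congruence modulo p^a a nonunit. *)
Lemma last_pivot a b c i j k (s r t : O) : (c <= b <= a)%N -> (0 < a - b)%N ->
  (i, j, k) \in pivots -> reduced p (i, j, k) (s, r, t) ->
  forall l, (k <= l < 3)%N ->
  (l == k) = ~~ hermite a b c (i, j, k) (s, r, t) (p ^+ a.-1 *: unit_vec O l).
Proof.
move=> /andP[le_cb le_ba] D0 w_in /and3P[cs ct cr] l /andP[le_kl l3].
have eu l' : (l' < 3)%N -> dcoord (p ^+ a.-1 *: unit_vec O l) l' = (l == l')%:R * p ^+ a.-1.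
  move=> l'3; rewrite -[_ *: _]addr0 dcoord_lin dcoord0 addr0 mulrC; congr (_ * _).
  by move: l l' l3 l'3 {le_kl} => [|[|[|l]]] [|[|[|l']]] //= _ _; rewrite subr0.
have [i3 j3 k3] : [/\ (i < 3)%N, (j < 3)%N & (k < 3)%N].
  by move: i j k w_in {le_kl cs ct cr}; apply: pivotsP.
rewrite /hermite /hform !eu //.
have pa n (y : O) : (n < a)%N -> pd n (y * p ^+ a.-1).
  by move=> h; rewrite (@pdvdW _ p n a.-1) ?pdvd_exp //; lia.
have p1a (y : O) : pd 1 y -> pd a (y * p ^+ a.-1).
  move=> /pdvdP[v ->]; apply/pdvdP; exists v.
  by rewrite expr1 -mulrA -exprS prednK //; lia.
have [ij jk] := pivots_neq w_in.
have ik : i != k by move: i j k w_in {le_kl cs ct cr i3 j3 k3 ij jk}; apply: pivotsP.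
have [lk|nlk] := eqVneq l k.
  rewrite lk [k == i]eq_sym (negPf ik) [k == j]eq_sym (negPf jk).
  rewrite !(mul0r, mulr0, subr0) mul1r !pdvd0.
  rewrite /= -[p ^+ _]mulr1 pdvd_sub // (_ : a - a.-1 = 1)%N ?pdvd11 //; lia.
have lt_kl : (k < l)%N by rewrite ltn_neqAle eq_sym nlk.
apply/esym/negbTE; rewrite negbK.
have -> : (l == j)%:R * p ^+ a.-1 - s * ((l == i)%:R * p ^+ a.-1)
  = ((l == j)%:R - s * (l == i)%:R) * p ^+ a.-1 by cring_over O.
rewrite mul0r sub0r.
have -> : - (r * (((l == j)%:R - s * (l == i)%:R) * p ^+ a.-1)) - t * ((l == i)%:R * p ^+ a.-1)
  = (0 - r * ((l == j)%:R - s * (l == i)%:R) - t * (l == i)%:R) * p ^+ a.-1.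
  by cring_over O.
apply/and3P; split; try (by apply: pa; lia).
apply: p1a.
have [li|nli] := eqVneq l i.
  have pt : pd 1 t by apply: (implyP ct); rewrite -li.
  rewrite !mulr1 sub0r; apply: pdvdB => //; rewrite pdvdN mulrBr; apply: pdvdB.
    have [lj|_] := eqVneq l j; last by rewrite mulr0 pdvd0.
    by rewrite mulr1; apply: (implyP cr); rewrite -lj.
  rewrite pdvd1M //; have [kj|jk'] := ltnP k j; first by rewrite (implyP cr).
  rewrite (implyP cs) ?orbT // -li; exact: leq_ltn_trans lt_kl.
have [lj|nlj] := eqVneq l j; last by rewrite !(mulr0, subr0) pdvd0.
by rewrite !(mulr0, subr0) mulr1 sub0r pdvdN; apply: (implyP cr); rewrite -lj.
Qed.

(** If B or D vanishes, the corresponding pivot cannot be read off, but admissibility then fixes the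
    order of the two exchangeable ones. *)
Lemma pivots_inj B D i j k i' j' k' :
  (i, j, k) \in pivots -> (i', j', k') \in pivots ->
  ((0 < B)%N -> i = i') -> ((0 < D)%N -> k = k') ->
  admissible B D (i, j, k) -> admissible B D (i', j', k') ->
  (i, j, k) = (i', j', k').
Proof.
move=> w_in w'_in; rewrite /admissible.
move: i' j' k' w'_in; apply: pivotsP; move: i j k w_in; apply: pivotsP => //;
  case: (0 < B)%N => h1; case: (0 < D)%N => h2 //=;
  by [have := h1 isT | have := h2 isT].
Qed.

Lemma hermite_pivots a b c w u w' u' : (c <= b <= a)%N ->
  w \in pivots -> w' \in pivots ->
  admissible (b - c) (a - b) w -> admissible (b - c) (a - b) w' ->
  reduced p w u -> reduced p w' u' ->
  hermite a b c w u = hermite a b c w' u' -> w = w'.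
Proof.
move: w u w' u' => [[i j] k] [[s r] t] [[i' j'] k'] [[s' r'] t'] cba w_in w'_in ad ad' re re' e.
have ii : (0 < b - c)%N -> i = i'.
  move=> B0.
  have [le|le] := leqP i i'.
    have := first_pivot cba B0 w'_in re' le; rewrite -e.
    by rewrite -(first_pivot cba B0 w_in re (leqnn i)) eqxx => /eqP.
  have := first_pivot cba B0 w_in re (ltnW le); rewrite e.
  by rewrite -(first_pivot cba B0 w'_in re' (leqnn i')) eqxx => /eqP.
have lt3 i1 j1 k1 : (i1, j1, k1) \in pivots -> (k1 < 3)%N by move: i1 j1 k1; apply: pivotsP.
have kk : (0 < a - b)%N -> k = k'.
  move=> D0.
  have [le|le] := leqP k k'.
    have lk : (k <= k' < 3)%N by rewrite le (lt3 _ _ _ w'_in).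
    have := last_pivot cba D0 w_in re lk; rewrite e.
    rewrite -(last_pivot cba D0 w'_in re') ?leqnn ?(lt3 _ _ _ w'_in) // eqxx.
    by move/eqP.
  have lk : (k' <= k < 3)%N by rewrite (ltnW le) (lt3 _ _ _ w_in).
  have := last_pivot cba D0 w'_in re' lk; rewrite -e.
  rewrite -(last_pivot cba D0 w_in re) ?leqnn ?(lt3 _ _ _ w_in) // eqxx.
  by move/eqP.
exact: (pivots_inj w_in w'_in ii kk ad ad').
Qed.

Lemma hermite_inj a b c i j k (s r t s' r' t' : O) : (c <= b <= a)%N ->
  (i, j, k) \in pivots ->
  [&& s \in reps (b - c), r \in reps (a - b) & t \in reps (a - c)] ->
  [&& s' \in reps (b - c), r' \in reps (a - b) & t' \in reps (a - c)] ->
  hermite a b c (i, j, k) (s, r, t) = hermite a b c (i, j, k) (s', r', t') ->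
  (s, r, t) = (s', r', t').
Proof.
move=> /andP[le_cb le_ba] w_in /and3P[sin rin tin] /and3P[s'in r'in t'in] e.
have le_ca := leq_trans le_cb le_ba.
(* Vectors of the first lattice satisfy the congruences of the second: the first basis vector
   compares s and then t, the second compares r. *)
have conds X1 X2 :
    pd b ((s - s') * (X1 * p ^+ c) + X2 * p ^+ b) &&
    pd a ((t - t') * (X1 * p ^+ c) + r * (X2 * p ^+ b)
      - r' * ((s - s') * (X1 * p ^+ c) + X2 * p ^+ b)).
  have := hermite_vec p a b c s r t X1 X2 0 w_in; rewrite e => /and3P[_].
  have [-> -> ->] := dcoord_vec (X1 * p ^+ c) (s * (X1 * p ^+ c) + X2 * p ^+ b)
    (t * (X1 * p ^+ c) + r * (X2 * p ^+ b) + 0 * p ^+ a) w_in.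
  move=> h1 h2; apply/andP; split.
    by move: h1; congr (is_true (pdvd p b _)); cring_over O.
  by move: h2; congr (is_true (pdvd p a _)); cring_over O.
have es : s = s'.
  apply: (uniq_reps p0 size_digits digitsP sin s'in).
  have /andP[h _] := conds 1 0; move: h.
  by rewrite mul0r addr0 mul1r mulrC pdvd_sub.
have er : r = r'.
  apply: (uniq_reps p0 size_digits digitsP rin r'in).
  have /andP[_ h] := conds 0 1; move: h.
  by rewrite !(mul0r, mulr0, add0r) mul1r -mulrBl mulrC pdvd_sub.
have et : t = t'.
  apply: (uniq_reps p0 size_digits digitsP tin t'in).
  have /andP[_ h] := conds 1 0; move: h.
  by rewrite es subrr !(mul0r, mulr0, addr0, subr0) mul1r mulrC pdvd_sub.
by rewrite es er et.
Qed.

Definition triples B D : seq (O * O * O) :=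
  [seq (u, t) | u <- [seq (s, r) | s <- reps B, r <- reps D], t <- reps (B + D)].

Definition closed_params B D c : seq (nat * nat * nat * (O * O * O)) :=
  [seq wu <- [seq (w, u) | w <- [seq w <- pivots | admissible B D w], u <- triples B D]
   | reduced p wu.1 wu.2 && closed_triple p B D c wu.2.1.1 wu.2.1.2 wu.2.2].

Lemma mem_triples B D s r t : ((s, r, t) \in triples B D) =
  [&& s \in reps B, r \in reps D & t \in reps (B + D)].
Proof.
apply/allpairsP/and3P => [[[u t1] [/allpairsP[[s1 r1] [h1 h2 /= ->]] h3 [-> -> ->]]]|[h1 h2 h3]].
  by [].
exists ((s, r), t); split => //; apply/allpairsP; by exists (s, r).
Qed.

Lemma mem_closed_params B D c w s r t : ((w, (s, r, t)) \in closed_params B D c) =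
  [&& w \in pivots, admissible B D w, reduced p w (s, r, t),
      closed_triple p B D c s r t & (s, r, t) \in triples B D].
Proof.
rewrite mem_filter /=.
have -> : ((w, (s, r, t)) \in
    [seq (w0, u) | w0 <- [seq w0 <- pivots | admissible B D w0], u <- triples B D])
  = [&& admissible B D w, w \in pivots & (s, r, t) \in triples B D].
  apply/allpairsP/and3P => [[[w1 u1] [h1 h2 [-> ->]]]|[h1 h2 h3]].
    by move: h1; rewrite mem_filter => /andP[].
  by exists (w, (s, r, t)); rewrite mem_filter h1 h2.
by case: (reduced _ _ _); case: (closed_triple _ _ _ _ _ _ _);
  case: (admissible _ _ _); case: (_ \in pivots) => //=; rewrite ?andbF.
Qed.

Lemma closed_params_uniq B D c : uniq (closed_params B D c).
Proof.
have ru n := reps_uniq p0 size_digits digitsP n.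
apply: filter_uniq; apply: allpairs_uniq; first exact: filter_uniq.
  apply: allpairs_uniq => //; last by move=> [x1 x2] [y1 y2] _ _ /= [-> ->].
  apply: allpairs_uniq => //; by move=> [x1 x2] [y1 y2] _ _ /= [-> ->].
by move=> [x1 x2] [y1 y2] _ _ /= [-> ->].
Qed.

Lemma size_closed_params B D c :
  (size (closed_params B D c))%:R = cotype_count q%:R D B c :> int.
Proof.
rewrite -(sum_cells p0 p_unif size_digits digitsP) size_filter -sum1_count natr_sum.
rewrite big_mkcond big_allpairs_dep big_filter big_mkcond /=.
apply: eq_bigr => -[[i j] k] _; case: (admissible _ _ _); last by rewrite mul0r.
rewrite mul1r big_allpairs_dep big_allpairs_dep.
apply: eq_bigr => s _; apply: eq_bigr => r _; apply: eq_bigr => t _ /=.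
by rewrite andbC; case: (closed_triple _ _ _ _ _ _ _); case: (_ ==> _); case: (_ ==> _);
  case: (_ ==> _).
Qed.

Definition lattice a b c (wu : nat * nat * nat * (O * O * O)) : {pred pow4 O} :=
  hermite a b c wu.1 wu.2.

Lemma subalgebras_of_cotypeE a b c : (c <= b <= a)%N ->
  subalgebras_of_cotype p a b c =
  [set` [seq lattice a b c wu | wu <- closed_params (b - c) (a - b) c]].
Proof.
move=> cba; have BD : (b - c + (a - b) = a - c)%N by lia.
apply/seteqP; split => L /=.
  case=> hL _ hcot; have [L1 _ _] := hL.
  have [w [u [w_in eL]]] := cotype_hermite p_unif cba L1 hcot.
  have [w' [u' [w'_in adm red hw']]] := hform_reduced p0 p_unif u cba w_in.
  have [s [r [t [rin red' hu']]]] := hform_reps p0 size_digits digitsP cba w'_in adm red.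
  have {}eL : L = hermite a b c w' (s, r, t).
    by rewrite eL; apply/funext => x; rewrite /hermite hw' hu'.
  apply/mapP; exists (w', (s, r, t)) => //.
  rewrite mem_closed_params w'_in adm red' mem_triples BD rin andbT /=.
  move: w' w'_in {adm red hw' red' hu'} eL => [[i j] k] w'_in eL.
  by apply: (proj1 (hermite_subalg p0 s r t cba w'_in)); rewrite -eL.
case/mapP=> -[[[i j] k] [[s r] t]].
rewrite mem_closed_params => /and5P[w_in adm red hcl tin] ->.
have hL : GRing.subalg_closed (hermite a b c (i, j, k) (s, r, t)).
  exact/hermite_subalg.
have hcot := hermite_cotype (GRing.subalg_closedZ hL) w_in.
by exists hL => //; apply: (finite_of_cotype p0 size_digits digitsP hcot).
Qed.

Lemma lattice_inj a b c : (c <= b <= a)%N ->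
  {in closed_params (b - c) (a - b) c &, injective (lattice a b c)}.
Proof.
move=> cba [w [[s r] t]] [w' [[s' r'] t']]; rewrite !mem_closed_params !mem_triples.
have -> : (b - c + (a - b) = a - c)%N by lia.
move=> /and5P[w_in adm red _ tin] /and5P[w'_in adm' red' _ tin'] e.
have ew := hermite_pivots cba w_in w'_in adm adm' red red' e.
move: e; rewrite /lattice /= -ew => e; congr (_, _).
by move: w w_in e {adm red ew} => [[i j] k] w_in; apply: hermite_inj.
Qed.

Lemma f4_cotype_count a b c : (c <= b <= a)%N ->
  (f4 p a b c)%:Z = cotype_count q%:R (a - b) (b - c) c.
Proof.
move=> cba; rewrite -size_closed_params /f4 (subalgebras_of_cotypeE cba).
set s := map _ _.
have -> : [set` s] = [set` [fset x in s]%fset]%classic.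
  by apply/seteqP; split => x /=; rewrite inE.
rewrite set_fsetK card_fseq undup_id ?size_map ?natz //.
by rewrite map_inj_in_uniq ?closed_params_uniq //; apply: lattice_inj.
Qed.

End Enumeration.

(** * The generating function *)

Section PartialFractions.
Variables (R : comNzRingType) (q : nat) (x y z : R).
Local Notation Q := (q%:R : int).
Add Ring ring10 : (@cring_theory R) (power_tac (@cpower_theory R) [nat_literal]).

Local Notation mon d b e := (x ^+ d * (x * y) ^+ b * (x * y * z) ^+ e).
Local Notation fac w d b e := (1 - w%:R * mon d b e).
Local Notation dX := (fac 1 1 0 0).
Local Notation dY := (fac 1 0 1 0).
Local Notation dZ := (fac 1 0 0 1).
Local Notation dXY := (fac q 1 1 0).
Local Notation dXZ := (fac (q ^ 2) 1 0 1).
Local Notation dYZ := (fac (q ^ 2) 0 1 1).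
Local Notation dXYZ := (fac (q ^ 3) 1 1 1).

Lemma denominator_factors :
  denominator q%:R x y z = dX * dY * dZ * dXY * dXZ * dYZ * dXYZ.
Proof. by rewrite /denominator !natrX; cring_over R. Qed.

(** One summand per cone: the term of its apex times the factors of the denominator that are not
    rays of the cone. In the last bracket [dX] is absent because it has been spent on taking the
    difference in the direction D. *)
Lemma partial_fractions :
    dX * dY * dXY * dXZ * dYZ * dXYZ * (1%:~R * mon 0 0 0)
  + dX * dY * dXY * dYZ * dXYZ * ((Q ^+ 2 + Q + 1)%:~R * mon 1 0 1)
  + dY * dZ * dXY * dYZ * dXYZ * (6%:~R * mon 1 0 0)
  + dX * dY * dXY * dXZ * dXYZ * ((Q ^+ 2 + Q + 1)%:~R * mon 0 1 1)
  + dX * dZ * dXY * dXZ * dXYZ * (7%:~R * mon 0 1 0)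
  + dX * dY * dXY * dXYZ * (((Q ^+ 2 + Q + 1) * (Q + 1) * Q)%:~R * mon 1 1 2)
  + dX * dY * dZ * dXY * (((Q ^+ 2 + 8 * Q + 1) * Q)%:~R * mon 1 1 1)
  + dX * dZ * dXY * dXZ * ((7 * (Q + 1) * Q ^+ 2)%:~R * mon 1 2 1)
  + dZ * dXY * dXZ * dYZ * (6%:~R * mon 1 1 0)
  + dX * dZ * dXZ * dYZ * ((4 * (Q + 1))%:~R * mon 1 1 0)
  + (dY * dZ * dYZ * ((12 * (Q - 1) * Q ^+ 2)%:~R * mon 2 1 1)
     + dY * dZ * dYZ * dXYZ * ((8 * Q - 4)%:~R * mon 2 1 0)
     + dY * dZ * dXZ * dYZ * ((4 * Q + 4)%:~R * mon 2 1 0)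
     + dY * dZ * dXY * dYZ * (((10 - 2 * Q) * Q ^+ 2)%:~R * mon 2 1 1))
  = numerator q%:R x y z.
Proof.
rewrite !(rmorph_nat, rmorph1, rmorphM, rmorphXn, rmorphB, rmorphD) /=.
by rewrite /numerator /A0 /A1 /A2 /A3 ?natrX; cring_over R.
Qed.

End PartialFractions.

Section MonomialExpr.
Variable R : comNzRingType.
Add Ring ring11 : (@cring_theory R) (power_tac (@cpower_theory R) [nat_literal]).

Lemma monomial_expr (x y z : R) d b e :
  x ^+ d * (x * y) ^+ b * (x * y * z) ^+ e = x ^+ (d + b + e) * y ^+ (b + e) * z ^+ e.
Proof. by rewrite !exprMn !exprD; cring_over R. Qed.

End MonomialExpr.

(** * Polynomials acting on power series *)

Section SeriesAction.

Definition act (P : poly3) (F : series3) : series3 :=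
  series3_mul (series3_of_poly P) F.

Definition series3_add (F G : series3) : series3 := fun i j k => F i j k + G i j k.

(** A coefficient of a product involves finitely many coefficients of the series, so the rules for
    the action are inherited from [poly3] by truncation. *)
Definition trunc (F : series3) (n : nat) : poly3 :=
  \poly_(k < n) \poly_(j < n) \poly_(i < n) F i j k.

Lemma coef_trunc F n i j k : (i < n)%N -> (j < n)%N -> (k < n)%N ->
  (trunc F n)`_k`_j`_i = F i j k.
Proof. by move=> hi hj hk; rewrite coef_poly hk coef_poly hj coef_poly hi. Qed.

Lemma coef_mul3 (P T : poly3) i j k :
  (P * T)`_k`_j`_i =
  \sum_(a < i.+1) \sum_(b < j.+1) \sum_(c < k.+1)
    P`_c`_b`_a * T`_(k - c)`_(j - b)`_(i - a).
Proof.
rewrite coefM !coef_sum.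
under eq_bigr => c _ do rewrite coefM coef_sum.
rewrite exchange_big /=.
under eq_bigr => b _ do under eq_bigr => c _ do rewrite coefM.
under eq_bigr => b _ do rewrite exchange_big /=.
by rewrite exchange_big.
Qed.

Lemma act_trunc P F n i j k : (i < n)%N -> (j < n)%N -> (k < n)%N ->
  act P F i j k = (P * trunc F n)`_k`_j`_i.
Proof.
move=> hi hj hk; rewrite coef_mul3; apply: eq_bigr => a _; apply: eq_bigr => b _.
apply: eq_bigr => c _; rewrite coef_trunc //.
- exact: leq_ltn_trans (leq_subr _ _) hi.
- exact: leq_ltn_trans (leq_subr _ _) hj.
- exact: leq_ltn_trans (leq_subr _ _) hk.
Qed.

Lemma series3_eq (F G : series3) : (forall i j k, F i j k = G i j k) -> F = G.
Proof. by move=> h; apply/funext => i; apply/funext => j; apply/funext => k. Qed.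

Lemma act_mul P T F : act (P * T) F = act P (act T F).
Proof.
apply: series3_eq => i j k.
pose n := (maxn i (maxn j k)).+1.
have [hi hj hk] : [/\ (i < n)%N, (j < n)%N & (k < n)%N] by rewrite /n; split; lia.
rewrite (act_trunc _ _ hi hj hk) -mulrA coef_mul3.
apply: eq_bigr => a _; apply: eq_bigr => b _; apply: eq_bigr => c _.
rewrite -act_trunc //.
- exact: leq_ltn_trans (leq_subr _ _) hi.
- exact: leq_ltn_trans (leq_subr _ _) hj.
- exact: leq_ltn_trans (leq_subr _ _) hk.
Qed.

Lemma act_poly P T : act P (series3_of_poly T) = series3_of_poly (P * T).
Proof. by apply: series3_eq => i j k; rewrite /series3_of_poly coef_mul3. Qed.

Lemma act_addr P F G : act P (series3_add F G) = series3_add (act P F) (act P G).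
Proof.
apply: series3_eq => i j k; rewrite /act /series3_add /series3_mul -big_split.
apply: eq_bigr => a _; rewrite -big_split; apply: eq_bigr => b _.
by rewrite -big_split; apply: eq_bigr => c _; rewrite mulrDr.
Qed.

Lemma series3_add_poly P T :
  series3_add (series3_of_poly P) (series3_of_poly T) = series3_of_poly (P + T).
Proof. by apply: series3_eq => i j k; rewrite /series3_of_poly !coefD. Qed.

Definition var_X : poly3 := var_x.
Definition var_Y : poly3 := var_x * var_y.
Definition var_Z : poly3 := var_x * var_y * var_z.

Definition monomial (d b e : nat) : poly3 := var_X ^+ d * var_Y ^+ b * var_Z ^+ e.

Lemma monomialE d b e : monomial d b e =
  ('X^(d + b + e))%:P%:P * ('X^(b + e))%:P * 'X^e.
Proof.
have -> : ('X^(d + b + e))%:P%:P = var_x ^+ (d + b + e) by rewrite !rmorphXn.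
have -> : ('X^(b + e))%:P = var_y ^+ (b + e) by rewrite rmorphXn.
exact: monomial_expr.
Qed.

Lemma coef_monomial d b e (w : nat) (T : poly3) i j k :
  (w%:R * monomial d b e * T)`_k`_j`_i =
  if [&& (e <= k)%N, (b + e <= j)%N & (d + b + e <= i)%N]
  then w%:R * T`_(k - e)`_(j - (b + e))`_(i - (d + b + e)) else 0.
Proof.
rewrite monomialE -!mulrA mulr_natl !coefMn !coefCM !coefXnM.
case: (ltnP k e) => _ /=; first by do 2?[case: ifP => _]; rewrite ?coef0 mul0rn.
case: (ltnP j (b + e)) => _ /=; first by case: ifP => _; rewrite ?coef0 mul0rn.
by case: ltnP => _; rewrite ?mul0rn // mulr_natl.
Qed.

(* The coefficient [h D B c] belongs to the monomial x^D (x y)^B (x y z)^c. *)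
Definition embed (h : nat -> nat -> nat -> int) : series3 := fun i j k =>
  if (k <= j <= i)%N then h (i - j)%N (j - k)%N k else 0.

Definition series_shift (w d b e : nat) (h : nat -> nat -> nat -> int) :
    nat -> nat -> nat -> int := fun D B c =>
  if [&& (d <= D)%N, (b <= B)%N & (e <= c)%N] then w%:R * h (D - d)%N (B - b)%N (c - e)%N
  else 0.

Lemma act_monomial w d b e h :
  act (w%:R * monomial d b e) (embed h) = embed (series_shift w d b e h).
Proof.
apply: series3_eq => i j k.
pose n := (maxn i (maxn j k)).+1.
have [hi hj hk] : [/\ (i < n)%N, (j < n)%N & (k < n)%N] by rewrite /n; split; lia.
rewrite (act_trunc _ _ hi hj hk) coef_monomial.
rewrite coef_trunc ?(leq_ltn_trans (leq_subr _ _)) // /embed /series_shift.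
case: ifP => h1; last by case: ifP => // h2; rewrite ifF //; lia.
case: ifP => h2; last by rewrite mulr0; case: ifP => // h3; rewrite ifF //; lia.
by rewrite ifT; [rewrite ifT; [congr (_ * h _ _ _); lia | lia] | lia].
Qed.

Lemma act_sub P T F : act (P - T) F = fun i j k => act P F i j k - act T F i j k.
Proof.
apply: series3_eq => i j k.
pose n := (maxn i (maxn j k)).+1.
have [hi hj hk] : [/\ (i < n)%N, (j < n)%N & (k < n)%N] by rewrite /n; split; lia.
by rewrite !(act_trunc _ _ hi hj hk) mulrBl !coefB.
Qed.

Lemma act1 F : act 1 F = F.
Proof.
apply: series3_eq => i j k.
pose n := (maxn i (maxn j k)).+1.
have [hi hj hk] : [/\ (i < n)%N, (j < n)%N & (k < n)%N] by rewrite /n; split; lia.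
by rewrite (act_trunc _ _ hi hj hk) mul1r coef_trunc.
Qed.

Lemma act_step w d b e h g :
  (forall D B c, h D B c = g D B c + series_shift w d b e h D B c) ->
  act (1 - w%:R * monomial d b e) (embed h) = embed g.
Proof.
move=> hg; rewrite act_sub act1 act_monomial; apply: series3_eq => i j k.
by rewrite /embed; case: ifP => _; rewrite ?subr0 // hg addrK.
Qed.

Lemma embed_add h g : embed (fun D B c => h D B c + g D B c) = series3_add (embed h) (embed g).
Proof.
by apply: series3_eq => i j k; rewrite /series3_add /embed; case: ifP; rewrite ?addr0.
Qed.

Definition cone_fun (C : nat -> nat -> nat -> bool) (l : nat -> nat -> nat -> nat)
  (w : nat) (k : nat -> nat -> nat -> int) D B c : int :=
  if C D B c then (w ^ l D B c)%:R * k D B c else 0.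

(* [l] is the coordinate along the generator (d, b, e) of the cone [C]. *)
Definition cone_ray d b e (C : nat -> nat -> nat -> bool)
    (l : nat -> nat -> nat -> nat) : Prop :=
  (forall D B c, C D B c -> (0 < l D B c)%N ->
    [/\ (d <= D)%N, (b <= B)%N & (e <= c)%N] /\
    C (D - d)%N (B - b)%N (c - e)%N /\ l (D - d)%N (B - b)%N (c - e)%N = (l D B c).-1)
  /\ (forall D B c, C D B c -> C (D + d)%N (B + b)%N (c + e)%N /\
     (0 < l (D + d)%N (B + b)%N (c + e)%N)%N).

(** A geometric series along the ray: consecutive points cancel, and only the face [l = 0]
    survives. *)
Lemma act_ray w d b e C l (k : nat -> nat -> nat -> int) :
  cone_ray d b e C l ->
  (forall D B c, C D B c -> k (D + d)%N (B + b)%N (c + e)%N = k D B c) ->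
  act (1 - w%:R * monomial d b e) (embed (cone_fun C l w k))
  = embed (fun D B c => if C D B c && (l D B c == 0)%N then k D B c else 0).
Proof.
move=> [h1 h2] hk; apply: act_step => D B c; rewrite /series_shift /cone_fun.
case: (boolP (C D B c)) => [hC|nC] /=; last first.
  rewrite add0r; case: ifP => // /and3P[hd hb he]; case: ifP => [hC|]; last by rewrite mulr0.
  by have [] := h2 _ _ _ hC; rewrite !subnK // (negPf nC).
case: posnP => [l0|l0].
  rewrite l0 expn0 mul1r; case: ifP => [/and3P[hd hb he]|]; last by rewrite addr0.
  case: ifP => [hC'|]; last by rewrite mulr0 addr0.
  by have [_] := h2 _ _ _ hC'; rewrite !subnK // l0.
have [[hd hb he] [hC' hl]] := h1 _ _ _ hC l0.
rewrite hd hb he hC' hl add0r /= mulrA -natrM -expnS prednK //.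
by rewrite -(hk _ _ _ hC') !subnK.
Qed.

End SeriesAction.

(** * Generating functions of unimodular cones *)

Section Cones.
Implicit Types (C : nat -> nat -> nat -> bool) (l : nat -> nat -> nat -> nat).

Definition ray_factor (w d b e : nat) : poly3 := 1 - w%:R * monomial d b e.

Lemma embed_apex (a : int) d b e C :
  (forall D B c, C D B c = [&& D == d, B == b & c == e]) ->
  embed (fun D B c => if C D B c then a else 0) = series3_of_poly (a%:~R * monomial d b e).
Proof.
move=> hC.
have a0 : series3_of_poly (a%:~R) =
    embed (fun D B c => if [&& D == 0, B == 0 & c == 0]%N then a else 0).
  apply: series3_eq => i j k; rewrite /series3_of_poly /embed.
  rewrite -[a in LHS]intz -!(rmorph_int polyC) !coefC.
  by case: k => [|k]; case: j => [|j]; case: i => [|i]; rewrite /= ?coef0 ?coefC //=;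
    repeat case: ifP => //; lia.
rewrite mulrC -act_poly a0 -[monomial d b e]mul1r -[1]/(1%:R) act_monomial.
apply: series3_eq => i j k; rewrite /embed; case: ifP => // hkji.
rewrite /series_shift hC.
by repeat (case: ifP => ?); rewrite ?mulr0 ?mul1r //; lia.
Qed.

Definition two_rays C l1 w1 l2 w2 (a : int) D B c : int :=
  cone_fun C l1 w1 (fun D B c => (w2 ^ l2 D B c)%:R * a) D B c.

Definition three_rays C l1 w1 l2 w2 l3 w3 (a : int) D B c : int :=
  cone_fun C l1 w1 (fun D B c => (w2 ^ l2 D B c)%:R * ((w3 ^ l3 D B c)%:R * a)) D B c.

(* The face of the cone [C] on which the coordinate [l] vanishes. *)
Definition face C l D B c := C D B c && (l D B c == 0)%N.

Definition steady (d b e : nat) C l : Prop :=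
  forall D B c, C D B c -> l (D + d)%N (B + b)%N (c + e)%N = l D B c.

(** The rays are cleared one at a time, each factor passing to a face; [steady] keeps the other
    coordinate constant along the ray being cleared. *)
Lemma act_two_rays C l1 w1 d1 b1 e1 l2 w2 d2 b2 e2 (a : int) d b e :
  cone_ray d1 b1 e1 C l1 -> steady d1 b1 e1 C l2 ->
  cone_ray d2 b2 e2 (face C l1) l2 ->
  (forall D B c, face (face C l1) l2 D B c = [&& D == d, B == b & c == e]) ->
  act (ray_factor w2 d2 b2 e2 * ray_factor w1 d1 b1 e1)
    (embed (two_rays C l1 w1 l2 w2 a)) = series3_of_poly (a%:~R * monomial d b e).
Proof.
move=> h1 s12 h2 hv; rewrite act_mul.
rewrite (act_ray (k := fun D B c => (w2 ^ l2 D B c)%:R * a) _ h1); last first.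
  by move=> D B c hC; rewrite s12.
rewrite -/(face C l1).
rewrite -(embed_apex a hv) -(act_ray (k := fun _ _ _ => a) w2 h2) //.
Qed.

Lemma act_three_rays C l1 w1 d1 b1 e1 l2 w2 d2 b2 e2 l3 w3 d3 b3 e3 (a : int) d b e :
  cone_ray d1 b1 e1 C l1 -> steady d1 b1 e1 C l2 -> steady d1 b1 e1 C l3 ->
  cone_ray d2 b2 e2 (face C l1) l2 -> steady d2 b2 e2 (face C l1) l3 ->
  cone_ray d3 b3 e3 (face (face C l1) l2) l3 ->
  (forall D B c, face (face (face C l1) l2) l3 D B c = [&& D == d, B == b & c == e]) ->
  act (ray_factor w3 d3 b3 e3 * ray_factor w2 d2 b2 e2 * ray_factor w1 d1 b1 e1)
    (embed (three_rays C l1 w1 l2 w2 l3 w3 a)) = series3_of_poly (a%:~R * monomial d b e).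
Proof.
move=> h1 s12 s13 h2 s23 h3 hv; rewrite act_mul.
rewrite (act_ray (k := fun D B c => (w2 ^ l2 D B c)%:R * ((w3 ^ l3 D B c)%:R * a)) _ h1).
  exact: (act_two_rays _ _ _ h2 s23 h3 hv).
by move=> D B c hC; rewrite s12 ?s13.
Qed.

End Cones.

(** * The cones of the decomposition *)

Section Pieces.
Variable q : nat.
Local Notation Q := (q%:R : int).
Local Notation "'cond' D B c => t" := (fun D B c : nat => (t)%N)
  (at level 200, D name, B name, c name, only parsing).

Definition fX := ray_factor 1 1 0 0.
Definition fY := ray_factor 1 0 1 0.
Definition fZ := ray_factor 1 0 0 1.
Definition fXY := ray_factor q 1 1 0.
Definition fXZ := ray_factor (q ^ 2) 1 0 1.
Definition fYZ := ray_factor (q ^ 2) 0 1 1.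
Definition fXYZ := ray_factor (q ^ 3) 1 1 1.

(** A single ray; the second coordinate is constantly 0 and only fills the format. *)
Definition piece0 := two_rays
  (cond D B c => (D == 0) && (B == 0)) (cond D B c => c) 1 (cond D B c => 0) 1 1.

Definition piece1 := two_rays (cond D B c => (B == 0) && (0 < D <= c))
  (cond D B c => c - D) 1 (cond D B c => D - 1) (q ^ 2) (Q ^+ 2 + Q + 1).

Definition piece2 := two_rays (cond D B c => (B == 0) && (c < D))
  (cond D B c => D - c - 1) 1 (cond D B c => c) (q ^ 2) 6.

Definition piece3 := two_rays (cond D B c => (D == 0) && (0 < B <= c))
  (cond D B c => c - B) 1 (cond D B c => B - 1) (q ^ 2) (Q ^+ 2 + Q + 1).

Definition piece4 := two_rays (cond D B c => (D == 0) && (c < B))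
  (cond D B c => B - c - 1) 1 (cond D B c => c) (q ^ 2) 7.

Definition piece5 := three_rays (cond D B c => [&& 0 < B, 0 < D & B + D <= c])
  (cond D B c => c - B - D) 1 (cond D B c => D - 1) (q ^ 2)
  (cond D B c => B - 1) (q ^ 2) ((Q ^+ 2 + Q + 1) * (Q + 1) * Q).

(** Q^2 + 8 Q + 1 = (Q - 2)(Q + 3) + 7 (Q + 1): generic triples, then the same and cross branches
    with 7 = 4 + 3. *)
Definition piece6 := three_rays (cond D B c => [&& D <= c, B <= c & c < B + D])
  (cond D B c => c - B) (q ^ 2) (cond D B c => c - D) (q ^ 2)
  (cond D B c => B + D - c - 1) (q ^ 3) ((Q ^+ 2 + 8 * Q + 1) * Q).

Definition piece7 := three_rays (cond D B c => [&& 0 < D, D <= c & c < B])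
  (cond D B c => B - c - 1) 1 (cond D B c => c - D) (q ^ 2)
  (cond D B c => D - 1) (q ^ 3) (7 * (Q + 1) * Q ^+ 2).

(** The cross branch where c is below both B and D. It overlaps [piece9], the same branch for c < D
    <= B. *)
Definition piece8 := three_rays (cond D B c => (c < B) && (c < D))
  (cond D B c => D - c - 1) 1 (cond D B c => B - c - 1) 1
  (cond D B c => c) (q ^ 3) 6.

Definition piece9 := three_rays (cond D B c => c < D <= B)
  (cond D B c => B - D) 1 (cond D B c => D - c - 1) q
  (cond D B c => c) (q ^ 3) (4 * (Q + 1)).

Definition slope1 := three_rays (cond D B c => [&& D <= B + c, B < D & c < D])
  (cond D B c => D - c - 1) q (cond D B c => D - B - 1) (q ^ 2)
  (cond D B c => B + c - D) (q ^ 3) (12 * (Q - 1) * Q ^+ 2).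

Definition slope2 := two_rays (cond D B c => (D == B + c + 1) && (0 < B))
  (cond D B c => B - 1) q (cond D B c => c) (q ^ 2) (8 * Q - 4).

Definition slope3 := two_rays (cond D B c => (D == B + 1) && (c < B))
  (cond D B c => B - c - 1) q (cond D B c => c) (q ^ 3) (4 * Q + 4).

Definition slope4 := two_rays (cond D B c => (D == c + 1) && (0 < B <= c))
  (cond D B c => c - B) (q ^ 2) (cond D B c => B - 1) (q ^ 3) ((10 - 2 * Q) * Q ^+ 2).

Ltac cone :=
  rewrite /cone_ray /steady /face; repeat split; intros; lia.

Lemma act_piece0 : act fZ (embed piece0) = series3_of_poly (1%:~R * monomial 0 0 0).
Proof.
rewrite -(embed_apex 1 (C := face (cond D B c => (D == 0) && (B == 0)) (cond D B c => c))).
  by apply: act_ray => //; cone.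
by cone.
Qed.

Lemma act_piece1 : act (fXZ * fZ) (embed piece1)
  = series3_of_poly ((Q ^+ 2 + Q + 1)%:~R * monomial 1 0 1).
Proof. by apply: act_two_rays; cone. Qed.

Lemma act_piece2 : act (fXZ * fX) (embed piece2) = series3_of_poly (6%:~R * monomial 1 0 0).
Proof. by apply: act_two_rays; cone. Qed.

Lemma act_piece3 : act (fYZ * fZ) (embed piece3)
  = series3_of_poly ((Q ^+ 2 + Q + 1)%:~R * monomial 0 1 1).
Proof. by apply: act_two_rays; cone. Qed.

Lemma act_piece4 : act (fYZ * fY) (embed piece4) = series3_of_poly (7%:~R * monomial 0 1 0).
Proof. by apply: act_two_rays; cone. Qed.

Lemma act_piece5 : act (fYZ * fXZ * fZ) (embed piece5)
  = series3_of_poly (((Q ^+ 2 + Q + 1) * (Q + 1) * Q)%:~R * monomial 1 1 2).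
Proof. by apply: act_three_rays; cone. Qed.

Lemma act_piece6 : act (fXYZ * fYZ * fXZ) (embed piece6)
  = series3_of_poly (((Q ^+ 2 + 8 * Q + 1) * Q)%:~R * monomial 1 1 1).
Proof. by apply: act_three_rays; cone. Qed.

Lemma act_piece7 : act (fXYZ * fYZ * fY) (embed piece7)
  = series3_of_poly ((7 * (Q + 1) * Q ^+ 2)%:~R * monomial 1 2 1).
Proof. by apply: act_three_rays; cone. Qed.

Lemma act_piece8 : act (fXYZ * fY * fX) (embed piece8)
  = series3_of_poly (6%:~R * monomial 1 1 0).
Proof. by apply: act_three_rays; cone. Qed.

Lemma act_piece9 : act (fXYZ * fXY * fY) (embed piece9)
  = series3_of_poly ((4 * (Q + 1))%:~R * monomial 1 1 0).
Proof. by apply: act_three_rays; cone. Qed.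

Lemma act_slope1 : act (fXYZ * fXZ * fXY) (embed slope1)
  = series3_of_poly ((12 * (Q - 1) * Q ^+ 2)%:~R * monomial 2 1 1).
Proof. by apply: act_three_rays; cone. Qed.

Lemma act_slope2 : act (fXZ * fXY) (embed slope2)
  = series3_of_poly ((8 * Q - 4)%:~R * monomial 2 1 0).
Proof. by apply: act_two_rays; cone. Qed.

Lemma act_slope3 : act (fXYZ * fXY) (embed slope3)
  = series3_of_poly ((4 * Q + 4)%:~R * monomial 2 1 0).
Proof. by apply: act_two_rays; cone. Qed.

Lemma act_slope4 : act (fXYZ * fXZ) (embed slope4)
  = series3_of_poly (((10 - 2 * Q) * Q ^+ 2)%:~R * monomial 2 1 1).
Proof. by apply: act_two_rays; cone. Qed.

End Pieces.

(** * Decomposition of the count into cone functions *)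

Section PieceValues.
Variable q : nat.
Local Notation Q := (q%:R : int).

Lemma two_raysE (C : nat -> nat -> nat -> bool) l1 e1 l2 e2 (k a : int) m n D B c :
  a = k * Q ^+ m -> (C D B c -> (e1 * l1 D B c + e2 * l2 D B c + m = n)%N) ->
  two_rays C l1 (q ^ e1) l2 (q ^ e2) a D B c = if C D B c then k * Q ^+ n else 0.
Proof.
move=> -> hn; rewrite /two_rays /cone_fun; case: ifP => // /hn <-.
by rewrite !natrX -!exprM !exprD; lra.
Qed.

Lemma three_raysE (C : nat -> nat -> nat -> bool) l1 e1 l2 e2 l3 e3 (k a : int) m n D B c :
  a = k * Q ^+ m ->
  (C D B c -> (e1 * l1 D B c + e2 * l2 D B c + e3 * l3 D B c + m = n)%N) ->
  three_rays C l1 (q ^ e1) l2 (q ^ e2) l3 (q ^ e3) a D B c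
  = if C D B c then k * Q ^+ n else 0.
Proof.
move=> -> hn; rewrite /three_rays /cone_fun; case: ifP => // /hn <-.
by rewrite !natrX -!exprM !exprD; lra.
Qed.

Lemma piece0E D B c : piece0 D B c = if (D == 0%N) && (B == 0%N) then 1 else 0.
Proof.
rewrite /piece0 /two_rays /cone_fun; case: ifP => // _.
by rewrite exp1n expn0 !mul1r.
Qed.

Lemma piece1E D B c : piece1 q D B c =
  if (B == 0%N) && (0 < D <= c)%N then (Q ^+ 2 + Q + 1) * Q ^+ (2 * D - 2) else 0.
Proof. by apply: (@two_raysE _ _ 0 _ 2 _ _ 0); [rewrite mulr1 | lia]. Qed.

Lemma piece2E D B c : piece2 q D B c =
  if (B == 0%N) && (c < D)%N then 6 * Q ^+ (2 * c) else 0.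
Proof. by apply: (@two_raysE _ _ 0 _ 2 _ _ 0); [rewrite mulr1 | lia]. Qed.

Lemma piece3E D B c : piece3 q D B c =
  if (D == 0%N) && (0 < B <= c)%N then (Q ^+ 2 + Q + 1) * Q ^+ (2 * B - 2) else 0.
Proof. by apply: (@two_raysE _ _ 0 _ 2 _ _ 0); [rewrite mulr1 | lia]. Qed.

Lemma piece4E D B c : piece4 q D B c =
  if (D == 0%N) && (c < B)%N then 7 * Q ^+ (2 * c) else 0.
Proof. by apply: (@two_raysE _ _ 0 _ 2 _ _ 0); [rewrite mulr1 | lia]. Qed.

Lemma piece5E D B c : piece5 q D B c =
  if [&& 0 < B, 0 < D & B + D <= c]%N
  then (Q ^+ 2 + Q + 1) * (Q + 1) * Q ^+ (2 * (B + D) - 3) else 0.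
Proof. by apply: (@three_raysE _ _ 0 _ 2 _ 2 _ _ 1); [| lia]. Qed.

Lemma piece6E D B c : piece6 q D B c =
  if [&& D <= c, B <= c & c < B + D]%N
  then (Q ^+ 2 + 8 * Q + 1) * Q ^+ (B + D + c - 2) else 0.
Proof. by apply: (@three_raysE _ _ 2 _ 2 _ 3 _ _ 1); [| lia]. Qed.

Lemma piece7E D B c : piece7 q D B c =
  if [&& 0 < D, D <= c & c < B]%N then 7 * (Q + 1) * Q ^+ (2 * c + D - 1) else 0.
Proof. by apply: (@three_raysE _ _ 0 _ 2 _ 3 _ _ 2); [| lia]. Qed.

Lemma piece8E D B c : piece8 q D B c =
  if (c < B)%N && (c < D)%N then 6 * Q ^+ (3 * c) else 0.
Proof. by apply: (@three_raysE _ _ 0 _ 0 _ 3 _ _ 0); [rewrite mulr1 | lia]. Qed.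

Lemma piece9E D B c : piece9 q D B c =
  if (c < D <= B)%N then 4 * (Q + 1) * Q ^+ (2 * c + D - 1) else 0.
Proof. by apply: (@three_raysE _ _ 0 _ 1 _ 3 _ _ 0); [rewrite mulr1 | lia]. Qed.

Lemma slope1E D B c : slope1 q D B c =
  if [&& D <= B + c, B < D & c < D]%N then 12 * (Q - 1) * Q ^+ (B + 2 * c - 1) else 0.
Proof. by apply: (@three_raysE _ _ 1 _ 2 _ 3 _ _ 2); [| lia]. Qed.

Lemma slope2E D B c : slope2 q D B c =
  if (D == B + c + 1)%N && (0 < B)%N then (8 * Q - 4) * Q ^+ (B + 2 * c - 1) else 0.
Proof. by apply: (@two_raysE _ _ 1 _ 2 _ _ 0); [rewrite mulr1 | lia]. Qed.

Lemma slope3E D B c : slope3 q D B c =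
  if (D == B + 1)%N && (c < B)%N then (4 * Q + 4) * Q ^+ (B + 2 * c - 1) else 0.
Proof. by apply: (@two_raysE _ _ 1 _ 3 _ _ 0); [rewrite mulr1 | lia]. Qed.

Lemma slope4E D B c : slope4 q D B c =
  if (D == c + 1)%N && (0 < B <= c)%N then (10 - 2 * Q) * Q ^+ (B + 2 * c - 1) else 0.
Proof. by apply: (@two_raysE _ _ 2 _ 3 _ _ 2); [| lia]. Qed.

(* The part of the count that is piecewise linear in D; its difference in the
   direction D is a sum of four cone functions. *)
Definition ramp (D B c : nat) : int :=
  if [&& 0 < B, B < D & c < D]%N then
    (if (B <= c)%N then
       6 * (Q - 1) +
       (if (D <= B + c)%N then 4 * (Q + 1) + 12 * (D - c - 1)%:R * (Q - 1)
        else 12 * ((B - 1)%:R * (Q - 1) + Q))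
     else if (D <= B + c)%N then 4 * (3 * (D - B)%:R * (Q - 1) + Q + 1)
     else 12 * (c%:R * (Q - 1) + Q)) * Q ^+ (B + 2 * c - 1)
  else 0.

Ltac decide_ifs :=
  repeat match goal with |- context [if ?b then _ else _] =>
    first [rewrite if_same | rewrite (_ : b = true); [|lia] | rewrite (_ : b = false); [|lia]]
  end.

(** In units of Q^(B + 2 c - 1) and for B > 0, [ramp] is 0 up to D = max(B, c) and constant from D =
    B + c + 1 on. In between, [slope1] is the steady rise by 12 (Q - 1); [slope3] and [slope4]
    adjust the first step for c < B and for B <= c, and [slope2] belongs to the step to B + c +
    1. *)
Lemma ramp_step D B c : ramp D B c =
  slope1 q D B c + slope2 q D B c + slope3 q D B c + slope4 q D B c
  + series_shift 1 1 0 0 ramp D B c.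
Proof.
rewrite slope1E slope2E slope3E slope4E /series_shift /ramp !subn0 mul1r.
set T := Q ^+ _.
have [B0|B0] := posnP B; first by decide_ifs; lra.
have [le_DB|lt_BD] := leqP D B; first by decide_ifs; lra.
have [le_Dc|lt_cD] := leqP D c; first by decide_ifs; lra.
have [le_Bc|lt_cB] := leqP B c.
  have [e|ne] := eqVneq D (c + 1)%N.
    have -> : (D - c - 1 = 0)%N by lia.
    by decide_ifs; lra.
  have [le|lt] := leqP D (B + c).
    rewrite (_ : D - c - 1 = (D - 1 - c - 1).+1)%N; last lia.
    by rewrite -natr1; decide_ifs; lra.
  have [e|ne'] := eqVneq D (B + c + 1)%N; last by decide_ifs; lra.
  rewrite (_ : D - 1 - c - 1 = B - 1)%N; last lia.
  by decide_ifs; lra.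
have [e|ne] := eqVneq D (B + 1)%N.
  have -> : (D - B = 1)%N by lia.
  have [c0|c0] := posnP c; last by decide_ifs; lra.
  by rewrite c0; decide_ifs; lra.
have [le|lt] := leqP D (B + c).
  rewrite (_ : D - B = (D - 1 - B).+1)%N; last lia.
  by rewrite -natr1; decide_ifs; lra.
have [e|ne'] := eqVneq D (B + c + 1)%N; last by decide_ifs; lra.
rewrite (_ : D - 1 - B = c)%N; last lia.
by decide_ifs; lra.
Qed.

Definition piece_sum D B c : int :=
  piece0 D B c + piece1 q D B c + piece2 q D B c + piece3 q D B c + piece4 q D B c
  + piece5 q D B c + piece6 q D B c + piece7 q D B c + piece8 q D B c
  + piece9 q D B c.

(** For 0 < B <= c < D the generic triples and the cross branch contribute 6 (Q - 2) and 6 times the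
    same power of Q; together they are the term 6 (Q - 1) of [ramp]. *)
Lemma cotype_count_pieces D B c :
  cotype_count Q D B c = piece_sum D B c + ramp D B c.
Proof.
rewrite /piece_sum piece0E piece1E piece2E piece3E piece4E piece5E piece6E piece7E.
rewrite piece8E piece9E /cotype_count /ramp.
have [->|B0] := posnP B; have [->|D0] := posnP D; first by decide_ifs; lra.
- by have [le|lt] := leqP D c; decide_ifs; lra.
- by have [le|lt] := leqP B c; decide_ifs; lra.
have [le_Ac|lt_cA] := leqP (B + D) c; first by decide_ifs; lra.
(* Naming predecessors turns the truncated exponents into sums. *)
have [b eB] : exists b, B = b.+1 by exists B.-1; lia.
have [d eD] : exists d, D = d.+1 by exists D.-1; lia.
have [le_Bc|lt_cB] := leqP B c; have [le_Dc|lt_cD] := leqP D c.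
- have -> : minn c B.-1 = b by lia.
  have [e ec] : exists e, c = e.+1 by exists c.-1; lia.
  decide_ifs; rewrite eB eD ec /= !addSn !addnS !subSS subn0 /=.
  rewrite ?exprS ?exprD ?exprS; lra.
- have -> : minn c B.-1 = b by lia.
  have [e ec] : exists e, c = e.+1 by exists c.-1; lia.
  have -> : maxn B c.+1 = c.+1 by lia.
  have -> : (B + 2 * c - 1 = b + e.+1 + e.+1)%N by lia.
  have -> : ((B + c).-1 = b + e.+1)%N by lia.
  have -> : (B + c = b.+1 + e.+1)%N by lia.
  have -> : (B - 1 = b)%N by lia.
  have [le|lt] := leqP D (b.+1 + e.+1).
    have [e1|ne1] := eqVneq D c.+1.
      have -> : (D - c - 1 = 0)%N by lia.
      have -> : (D.-1 = e.+1)%N by lia.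
      by decide_ifs; rewrite ec /= !(exprD, exprS); lra.
    rewrite (_ : D - c - 1 = D - c.+1)%N; last lia.
    by decide_ifs; rewrite ec /= !(exprD, exprS); lra.
  by decide_ifs; rewrite ec /= !(exprD, exprS); lra.
- have -> : minn c B.-1 = c by lia.
  have -> : (2 * c + D - 1 = c + c + d)%N by lia.
  by decide_ifs; rewrite eD /= !(exprD, exprS); lra.
have -> : minn c B.-1 = c by lia.
have -> : maxn B c.+1 = B by lia.
have -> : (2 * c + D - 1 = c + c + d)%N by lia.
have -> : (B + 2 * c - 1 = b + c + c)%N by lia.
have -> : ((B + c).-1 = b + c)%N by lia.
have -> : (3 * c = c + c + c)%N by lia.
have [le1|lt1] := leqP D B.
  by decide_ifs; rewrite eD /= !(exprD, exprS); lra.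
have [le2|lt2] := leqP D (B + c).
  by decide_ifs; rewrite !(exprD, exprS); lra.
by decide_ifs; rewrite !(exprD, exprS); lra.
Qed.

End PieceValues.

(** * Assembling the partial fractions *)

Section GeneratingFunction.
Variable q : nat.
Local Notation Q := (q%:R : int).
Local Notation fXY := (fXY q).
Local Notation fXZ := (fXZ q).
Local Notation fYZ := (fYZ q).
Local Notation fXYZ := (fXYZ q).

Lemma denominatorE : denominator q%:R var_x var_y var_z =
  fX * fY * fZ * fXY * fXZ * fYZ * fXYZ.
Proof.
exact: denominator_factors.
Qed.

Lemma act_ramp : act fX (embed (ramp q)) =
  embed (fun D B c => slope1 q D B c + slope2 q D B c + slope3 q D B c + slope4 q D B c).
Proof. by apply: act_step => D B c; apply: ramp_step. Qed.

Lemma act_cofactor (P T S U : poly3) F : P = S * T ->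
  act T F = series3_of_poly U -> act P F = series3_of_poly (S * U).
Proof. by move=> -> h; rewrite act_mul h act_poly. Qed.

Lemma act_denominator :
  act (denominator q%:R var_x var_y var_z)
    (embed (fun D B c => cotype_count Q D B c))
  = series3_of_poly (numerator q%:R var_x var_y var_z).
Proof.
rewrite denominatorE.
have -> : embed (fun D B c => cotype_count Q D B c) =
    embed (fun D B c => piece_sum q D B c + ramp q D B c).
  by congr embed; do 3!apply/funext => ?; apply: cotype_count_pieces.
pose P := fX * fY * fZ * fXY * fXZ * fYZ * fXYZ; rewrite -/P.
have c0 : P = fX * fY * fXY * fXZ * fYZ * fXYZ * (fZ).
  by rewrite /P [LHS](ACl ((1*2*4*5*6*7)*(3))).
have {}c0 := act_cofactor c0 act_piece0.
have c1 : P = fX * fY * fXY * fYZ * fXYZ * (fXZ * fZ).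
  by rewrite /P [LHS](ACl ((1*2*4*6*7)*(5*3))).
have {}c1 := act_cofactor c1 (act_piece1 q).
have c2 : P = fY * fZ * fXY * fYZ * fXYZ * (fXZ * fX).
  by rewrite /P [LHS](ACl ((2*3*4*6*7)*(5*1))).
have {}c2 := act_cofactor c2 (act_piece2 q).
have c3 : P = fX * fY * fXY * fXZ * fXYZ * (fYZ * fZ).
  by rewrite /P [LHS](ACl ((1*2*4*5*7)*(6*3))).
have {}c3 := act_cofactor c3 (act_piece3 q).
have c4 : P = fX * fZ * fXY * fXZ * fXYZ * (fYZ * fY).
  by rewrite /P [LHS](ACl ((1*3*4*5*7)*(6*2))).
have {}c4 := act_cofactor c4 (act_piece4 q).
have c5 : P = fX * fY * fXY * fXYZ * (fYZ * fXZ * fZ).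
  by rewrite /P [LHS](ACl ((1*2*4*7)*(6*5*3))).
have {}c5 := act_cofactor c5 (act_piece5 q).
have c6 : P = fX * fY * fZ * fXY * (fXYZ * fYZ * fXZ).
  by rewrite /P [LHS](ACl ((1*2*3*4)*(7*6*5))).
have {}c6 := act_cofactor c6 (act_piece6 q).
have c7 : P = fX * fZ * fXY * fXZ * (fXYZ * fYZ * fY).
  by rewrite /P [LHS](ACl ((1*3*4*5)*(7*6*2))).
have {}c7 := act_cofactor c7 (act_piece7 q).
have c8 : P = fZ * fXY * fXZ * fYZ * (fXYZ * fY * fX).
  by rewrite /P [LHS](ACl ((3*4*5*6)*(7*2*1))).
have {}c8 := act_cofactor c8 (act_piece8 q).
have c9 : P = fX * fZ * fXZ * fYZ * (fXYZ * fXY * fY).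
  by rewrite /P [LHS](ACl ((1*3*5*6)*(7*4*2))).
have {}c9 := act_cofactor c9 (act_piece9 q).
(* The factor [fX] turns [ramp] into the four slopes; the remaining factors [R] clear their
   cones. *)
pose R := fY * fZ * fXY * fXZ * fYZ * fXYZ.
have cr : P = R * fX by rewrite /P [LHS](ACl ((2*3*4*5*6*7)*1)).
have s1 : R = fY * fZ * fYZ * (fXYZ * fXZ * fXY).
  by rewrite /R [LHS](ACl ((1*2*5)*(6*4*3))).
have {}s1 := act_cofactor s1 (act_slope1 q).
have s2 : R = fY * fZ * fYZ * fXYZ * (fXZ * fXY).
  by rewrite /R [LHS](ACl ((1*2*5*6)*(4*3))).
have {}s2 := act_cofactor s2 (act_slope2 q).
have s3 : R = fY * fZ * fXZ * fYZ * (fXYZ * fXY).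
  by rewrite /R [LHS](ACl ((1*2*4*5)*(6*3))).
have {}s3 := act_cofactor s3 (act_slope3 q).
have s4 : R = fY * fZ * fXY * fYZ * (fXYZ * fXZ).
  by rewrite /R [LHS](ACl ((1*2*3*5)*(6*4))).
have {}s4 := act_cofactor s4 (act_slope4 q).
have act_PR : act P (embed (ramp q)) = act R (embed (fun D B c =>
    slope1 q D B c + slope2 q D B c + slope3 q D B c + slope4 q D B c)).
  by rewrite cr act_mul act_ramp.
rewrite embed_add act_addr act_PR.
rewrite /piece_sum !embed_add !act_addr.
rewrite c0 c1 c2 c3 c4 c5 c6 c7 c8 c9 s1 s2 s3 s4 !series3_add_poly.
congr series3_of_poly; rewrite -partial_fractions.
by [].
Qed.

End GeneratingFunction.

(** * The residue field and the zeta function *)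

Lemma uniformizer_neq0 (O : idomainType) (p : O) : is_dvr O -> is_uniformizer p -> p != 0.
Proof.
case=> _ _ [x x0 xN] hp; apply: contraNneq x0 => p0.
by move: xN; rewrite hp p0 => /asboolP[u ->]; rewrite mulr0.
Qed.

(** One representative is taken for each element of the residue field; the only nonzero term of the
    sum belongs to the class of a. *)
Lemma residue_digits (O : idomainType) (p : O) (q : nat) :
  is_uniformizer p -> residue_card O q ->
  exists digits : seq O, size digits = q /\
    forall a, \sum_(d <- digits) (pdvd p 1 (d - a))%:R = 1%R :> int.
Proof.
move=> hp [h hq]; pose F := fset_set [set: quotmod h].
have finF : finite_set [set: quotmod h] by exists q.
exists [seq (repr z : O) | z <- F]; split; first by rewrite size_map; apply: card_fset_set.
move=> a; rewrite big_map.
have aF : quotmod_pi h a \in F by rewrite in_fset_set // in_setT.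
rewrite (perm_big _ (perm_to_rem aF)) big_cons /=.
have dE (z : quotmod h) : pdvd p 1 ((repr z : O) - a) = (z == quotmod_pi h a).
  rewrite /pdvd expr1 -[RHS]/(z == _) -[LHS]/(_ \in principal p) -hp.
  apply/idP/eqP => [/(quotmod_piP h)|e]; first by rewrite quotmod_reprK.
  by apply/(quotmod_piP h); rewrite quotmod_reprK.
rewrite dE eqxx big_seq big1 ?addr0 // => z.
by rewrite mem_rem_uniq ?fset_uniq // !inE dE => /andP[/negPf ->].
Qed.

Theorem proposition4p3 (O : idomainType) (p : O) (q : nat)
    (hO : is_dvr O) (hp : is_uniformizer p) (hc : compact [set: adic p])
    (hq : residue_card O q) :
  (forall a b c : nat, (c <= b <= a)%N ->
     finite_set (subalgebras_of_cotype p a b c)) /\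
  series3_mul (series3_of_poly (denominator q%:R var_x var_y var_z))
              (cotype_zeta p)
  = series3_of_poly (numerator q%:R var_x var_y var_z).
Proof.
have p0 := uniformizer_neq0 hO hp.
have [digits [size_digits digitsP]] := residue_digits hp hq.
split=> [a b c cba|].
  (* The enumeration by reduced parameters is a finite list, so [f4] is a genuine cardinality. *)
  rewrite (subalgebras_of_cotypeE p0 hp size_digits digitsP cba).
  exact: finite_seq.
rewrite -act_denominator; congr (act _ _).
apply: series3_eq => i j k; rewrite /cotype_zeta /embed; case: ifP => // kji.
exact: (f4_cotype_count p0 hp size_digits digitsP kji).
Qed.
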